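(* Let $\mu,\nu$ be Borel probability measures on $\mathbb{R}$ such that $\operatorname{supp}(\mu)\subseteq[0,1]$, $\mu$ is atomless and $\nu$ is embedded in $\mu$. Let $\gamma\in[0,\pi/2]^2$ and let $$\overline{s}_{\nu,\mu}=\limsup_{x\to\infty}\frac{\ln N^\gamma_{\nu,\mu}(x)}{\ln x}$$ be the upper spectral dimension of $\Delta_{\nu,\mu}$. Then $$\overline{s}_{\nu,\mu}=q_{\nu\circ F_\mu^{-1}}\le\frac{\overline{\dim}_M(\operatorname{supp}(\nu\circ F_\mu^{-1}))}{1+\overline{\dim}_M(\operatorname{supp}(\nu\circ F_\mu^{-1}))}.$$
   Context: Embedded: $\nu$ is embedded in $\mu$ if $\operatorname{supp}(\nu)\subseteq\operatorname{supp}(\mu)$ and no atom of $\nu$ is a boundary point of a connected component of $\mathbb{R}\setminus\operatorname{supp}(\mu)$. $F_\mu$ is the distribution function of $\mu$ and $\nu\circ F_\mu^{-1}$ is the push-forward of $\nu$ under $F_\mu$. A function $f\in C([0,1])$ lies in $\mathcal{D}^w(\Delta_{\nu,\mu})$ if there are $a,b\in\mathbb{R}$ and $g\in L^2(\nu)$ with $$f(x)=a+bF_\mu(x)+\int_{[0,x]}(F_\mu(x)-F_\mu(y))g(y)\,d\nu(y)\quad\text{for all }x\in[0,1].$$ Then $a$, $b$ and $g$ (in $L^2(\nu)$) are uniquely determined by $f$, and one sets $\Delta_{\nu,\mu}f:=g$, $\nabla_\mu f(0):=b$, $\nabla_\mu f(1):=b+\int g\,d\nu$. For $\gamma=(\alpha,\beta)\in[0,\pi/2]^2$,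 $\mathcal{D}^w_\gamma(\Delta_{\nu,\mu})$ is the set of $f\in\mathcal{D}^w(\Delta_{\nu,\mu})$ with $f(0)\cos\alpha-\nabla_\mu f(0)\sin\alpha=0$ and $f(1)\cos\beta+\nabla_\mu f(1)\sin\beta=0$. $N^\gamma_{\nu,\mu}(x)$ is the number of eigenvalues of $-\Delta_{\nu,\mu}$ with domain $\mathcal{D}^w_\gamma(\Delta_{\nu,\mu})$ (as an operator on $L^2(\nu)$) not exceeding $x$. For a compactly supported finite Borel measure $\eta$ on $\mathbb{R}$ and $q>0$, $$\beta_\eta(q)=\limsup_{n\to\infty}\frac{1}{n\ln2}\ln\Big(\sum_{k\in\mathbb{Z}}\eta\big((k2^{-n},(k+1)2^{-n}]\big)^q\Big),\qquad q_\eta=\inf\{q>0:\beta_\eta(q)<q\}.$$ $\overline{\dim}_M(A)$ is the upper Minkowski (box-counting) dimension of a bounded set $A\subseteq\mathbb{R}$. *)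

(* Defs.v *)
From HB Require Import structures.
From mathcomp Require Import all_boot all_order all_algebra.
From mathcomp Require Import all_classical all_reals all_analysis.
From mathcomp Require Import measurable_realfun.

Set Implicit Arguments.
Unset Strict Implicit.
Unset Printing Implicit Defensive.

Import Order.TTheory GRing.Theory Num.Theory.
Import numFieldNormedType.Exports.

Local Open Scope classical_set_scope.
Local Open Scope ring_scope.

Section measures_on_the_line.
Context {R : realType}.
Implicit Types eta : {measure set R -> \bar R}.
Implicit Types mu nu : probability R R.

Definition supp eta : set R :=
  [set x | forall U : set R, open U -> U x -> (0 < eta U)%E].

Definition is_atom eta (x : R) : Prop := (0 < eta [set x])%E.

Definition atomless eta : Prop := forall x : R, ~ is_atom eta x.

Definition boundary (A : set R) : set R := closure A `\` interior A.

(* The connected components of an open set are the sets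
   [connected_component A x] for [x] ranging over the set. *)
Definition embedded nu mu : Prop :=
  supp nu `<=` supp mu /\
  forall x y : R, (~` supp mu) x -> is_atom nu y ->
    ~ boundary (connected_component (~` supp mu) x) y.

Definition distr_fun mu (x : R) : R :=
  fine (mu `]-oo, x]%classic).

Lemma distr_fun_measurable mu : measurable_fun [set: R] (distr_fun mu).
Proof.
apply: nondecreasing_measurable => //= r s rs.
by rewrite fine_le ?fin_num_measure// le_measure ?inE//; exact: subitvPr.
Qed.

(* Makes [distribution nu (distr_fun mu)] the push-forward of [nu]. *)
HB.instance Definition _ mu :=
  isMeasurableFun.Build _ _ R R (distr_fun mu) (distr_fun_measurable mu).

Local Open Scope ereal_scope.

Definition Lq_spectrum eta (q : R) : \bar R :=
  limn_esup (fun n : nat =>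
    lne (\esum_(k in [set: int])
           eta `](k%:~R / 2 ^+ n)%R, ((k + 1)%:~R / 2 ^+ n)%R]%classic `^ q)
    / (n%:R * ln 2)%:E).

Definition critical_exponent eta : \bar R :=
  ereal_inf [set q%:E | q in [set q : R | (0 < q)%R /\ Lq_spectrum eta q < q%:E]].

Definition covering_number (A : set R) (e : R) : \bar R :=
  ereal_inf [set n%:R%:E | n in [set n : nat |
    exists c : 'I_n -> R, A `<=` \bigcup_i ball (c i) e]].

Definition upper_minkowski_dim (A : set R) : \bar R :=
  limf_esup (fun e : R => lne (covering_number A e) / (- ln e)%:E) 0^'+.

End measures_on_the_line.

Section krein_feller.
Context {R : realType}.
Implicit Types mu nu : probability R R.

(* [f] is in the domain of the generalized Laplacian iff some [a], [b], [g] are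
   related to it; when [nu] is embedded in [mu] these are unique ([g] in
   L^2(nu)), [g] represents the generalized Laplacian of [f], [b] is its mu-derivative at 0 and
   [b + \int[nu]_y g y] its mu-derivative at 1.  Elements of C([0,1]) are
   functions on [R] of which only the restriction to [0,1] matters. *)
Definition weak_laplacian nu mu (f : R -> R) (a b : R) (g : R -> R) : Prop :=
  [/\ {within `[0, 1]%classic, continuous f},
      g \in Lfun nu 2%:E &
      forall x : R, x \in `[0, 1] ->
        f x = a + b * distr_fun mu x +
          \int[nu]_(y in `[0, x]%classic)
            ((distr_fun mu x - distr_fun mu y) * g y)].

(* The graph of the operator restricted by the boundary conditions. *)
Definition laplacian_bc nu mu (alpha beta : R) (f g : R -> R) : Prop :=
  exists a b : R,
    [/\ weak_laplacian nu mu f a b g,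
        f 0 * cos alpha - b * sin alpha = 0 &
        f 1 * cos beta + (b + \int[nu]_y g y) * sin beta = 0].

(* Equality in L^2(nu) is equality nu-almost everywhere; [nu] is carried by
   [0,1], so the values of [f] elsewhere play no role. *)
Definition laplacian_eigenvalue nu mu (alpha beta lambda : R) : Prop :=
  exists f g : R -> R,
    [/\ laplacian_bc nu mu alpha beta f g,
        ~ {ae nu, forall x, f x = 0} &
        {ae nu, forall x, - g x = lambda * f x}].

(* All eigenvalues are simple (an eigenfunction is determined by its value and
   its derivative at 0), so no multiplicity enters the count. *)
Definition eigenvalue_counting nu mu (alpha beta x : R) : \bar R :=
  counting [set lambda : R |
    laplacian_eigenvalue nu mu alpha beta lambda /\ lambda <= x].

Definition upper_spectral_dim nu mu (alpha beta : R) : \bar R :=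
  limf_esup (fun x : R =>
    (lne (eigenvalue_counting nu mu alpha beta x) / (ln x)%:E)%E) +oo.

End krein_feller.

(* Main.v *)
Require Import Defs.
From HB Require Import structures.
From mathcomp Require Import all_boot all_order all_algebra.
From mathcomp Require Import all_classical all_reals all_analysis.
From mathcomp Require Import measurable_realfun.
From mathcomp Require Import zify ring lra.

Set Implicit Arguments.
Unset Strict Implicit.
Unset Printing Implicit Defensive.

Import Order.TTheory GRing.Theory Num.Theory.
Import numFieldNormedType.Exports.

Local Open Scope classical_set_scope.
Local Open Scope ring_scope.

(** Let [F] be the distribution function of [mu] and [eta] the image of [nu] under [F].
    The change of variables [t = F x] turns the eigenvalue problem into the string
    equation [h t = a + b t - lam * int (t - s)^+ h s d(eta) s] on [0, 1] with a Robin
    condition at [1]; embeddedness ensures that [eta] does not charge [0] and [1].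

    Eigenvalues up to [x] are counted from both sides in terms of the masses of
    intervals.  From above: if [x |I| eta(I) <= 1/2] for all intervals [I] avoiding a
    finite set [S], there are at most [#S + 2] of them, because more orthogonal
    eigenfunctions would have a nonzero combination vanishing on [S] and at both
    ends, which is too steep between consecutive zeros.  For [S] one takes the
    midpoints of the dyadic cells [Q] with [2 x |Q| eta(Q) > 1].  From below: by
    the Green representation, the solution with [lam = x] has a zero in or next to
    each dyadic cell [Q] with [x |Q| eta(Q) > 3], and as [lam] grows from 0 to [x] the
    zeros enter (0, 1) one by one through the right end, each at an eigenvalue.

    So the counting function has the growth of the number of dyadic cells with
    [|Q| eta(Q) > 1/x], and the exponent of this growth is the infimum of the [q] with
    [sum_Q eta(Q)^q <= 2^(s m)] at the levels [m] for some [s < q].  A sum over at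
    most [M] cells is at most [2 M^(1-q)] by concavity, which yields the bound by
    the Minkowski dimension. *)

(** [eta] may be singular and may have atoms inside ]0, 1[, so no differential equation holds
    pointwise. Solutions are continuous functions satisfying a Volterra equation, and the Sturm
    theory that is needed (separation of zeros, sign changes, dependence on the parameter) is
    derived from that equation and from Green functions. The measure enters this theory only as a
    positive linear functional on continuous functions, because the arguments are run for several
    functionals: [x * J], [- lam * J] for negative [lam], and [lam * J] plus an atom at 1 that turns
    the Robin condition into a Dirichlet one. No spectral theorem and no completeness of
    eigenfunctions is invoked: the upper count is finite linear algebra with an L^2 estimate, the
    lower count a shooting argument. The data at 0 are prescribed up to a factor, so eigenvalues can
    be counted as lists of distinct reals. The absence of mass at 0 and 1 matters because the
    half-open dyadic cells between 0 and 1 would miss an atom at 0, and because ]0, 1[ must be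
    charged for the shooting argument to produce any eigenvalue. *)

Section continuity.
Context {R : realType}.
Implicit Types f g : R -> R.

Definition cts f : Prop := continuous f.

Lemma ctsD f g : cts f -> cts g -> cts (fun x => f x + g x).
Proof. by move=> cf cg x; apply: cvgD; [exact: cf|exact: cg]. Qed.

Lemma ctsN f : cts f -> cts (fun x => - f x).
Proof. by move=> cf x; apply: cvgN; exact: cf. Qed.

Lemma ctsB f g : cts f -> cts g -> cts (fun x => f x - g x).
Proof. by move=> cf cg; apply: ctsD => //; exact: ctsN. Qed.

Lemma ctsM f g : cts f -> cts g -> cts (fun x => f x * g x).
Proof. by move=> cf cg x; apply: cvgM; [exact: cf|exact: cg]. Qed.

Lemma cts_norm f : cts f -> cts (fun x => `|f x|).
Proof. by move=> cf x; apply: cvg_norm; exact: cf. Qed.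

Lemma cts_cst (k : R) : cts (fun _ : R => k).
Proof. by move=> x; exact: cvg_cst. Qed.

Lemma cts_id : cts (fun x : R => x).
Proof. by move=> x; exact: cvg_id. Qed.

Lemma maxE (x y : R) : Num.max x y = (x + y + `|x - y|) / 2.
Proof.
by case: (lerP x y) => h; lra.
Qed.

Lemma cts_max f g : cts f -> cts g ->
  cts (fun x => Num.max (f x) (g x)).
Proof.
move=> cf cg; have -> : (fun x => Num.max (f x) (g x)) =
  (fun x => (f x + g x + `|f x - g x|) / 2) by apply/funext => x; rewrite maxE.
by apply: ctsM; [apply: ctsD; [exact: ctsD|apply: cts_norm; exact: ctsB]|exact: cts_cst].
Qed.

Lemma cts_sum (I : Type) (r : seq I) (F : I -> R -> R) :
  (forall i, cts (F i)) -> cts (fun x => \sum_(i <- r) F i x).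
Proof.
move=> cF; elim: r => [|i r ih].
  by under eq_fun do rewrite big_nil; exact: cts_cst.
by under eq_fun do rewrite big_cons; exact: ctsD.
Qed.

Lemma cts_expR f : cts f -> cts (fun x => expR (f x)).
Proof. by move=> cf x; apply: continuous_comp; [exact: cf|exact: continuous_expR]. Qed.

Lemma lipschitz_cts f (k : R) :
  (forall x y, `|f x - f y| <= k * `|x - y|) -> cts f.
Proof.
move=> fk x; apply/cvgrPdist_le => e e0.
have k0 : 0 < `|k| + 1 by rewrite ltr_wpDl.
near=> y; apply: le_trans (fk x y) _.
have : `|x - y| <= e / (`|k| + 1).
  by near: y; apply: cvgr_dist_le; [exact: cvg_id|exact: divr_gt0].
rewrite ler_pdivlMr// => h; apply: le_trans h; rewrite mulrC ler_wpM2l//.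
by rewrite (le_trans (ler_norm k))// ler_wpDr.
Unshelve. all: by end_near. Qed.

Lemma EVT_max_cts f (a b : R) : a <= b -> cts f ->
  exists2 c, a <= c <= b & forall t, a <= t <= b -> f t <= f c.
Proof.
move=> ab cf; have [c cab h] := EVT_max ab (continuous_subspaceT cf).
by exists c => [|t tab]; [move: cab; rewrite in_itv|apply: h; rewrite in_itv].
Qed.

Lemma EVT_min_cts f (a b : R) : a <= b -> cts f ->
  exists2 c, a <= c <= b & forall t, a <= t <= b -> f c <= f t.
Proof.
move=> ab cf; have [c cab h] := EVT_min ab (continuous_subspaceT cf).
by exists c => [|t tab]; [move: cab; rewrite in_itv|apply: h; rewrite in_itv].
Qed.

Lemma IVT_zero f (a b : R) : a <= b -> cts f -> f a * f b <= 0 ->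
  exists2 c, a <= c <= b & f c = 0.
Proof.
move=> ab cf fab.
have [c cab fc] : exists2 c, c \in `[a, b] & f c = 0; last first.
  by exists c => //; move: cab; rewrite in_itv.
apply: IVT => //; first exact: continuous_subspaceT.
rewrite ge_min le_max; move: fab.
case: (ltrgtP (f a) 0) => fa; case: (ltrgtP (f b) 0) => fb h //=.
- by have := nmulr_rgt0 (f b) fa; rewrite fb ltNge h.
- by have := mulr_gt0 fa fb; rewrite ltNge h.
Qed.

(** The bounds [x_ n - 2 * C / 2 ^+ n] increase and [x_ n + 2 * C / 2 ^+ n] decrease, so the
    supremum of the former is the limit, with an explicit rate from [n = 0] on. *)
Lemma half_steps_cvg (x_ : nat -> R) (C : R) :
  (forall n, `|x_ n.+1 - x_ n| <= C / 2 ^+ n) ->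
  exists l, forall n, `|l - x_ n| <= 2 * C / 2 ^+ n.
Proof.
move=> xC; have C0 : 0 <= C.
  by have := xC 0%N; rewrite expr0 divr1; apply: le_trans.
have p n : 0 < (2 : R) ^+ n by rewrite exprn_gt0.
have iS n : (2 ^+ n.+1 : R)^-1 = (2 ^+ n)^-1 / 2 by rewrite exprS invfM mulrC.
pose y n := x_ n - 2 * C / 2 ^+ n; pose z n := x_ n + 2 * C / 2 ^+ n.
have y1 n : y n <= y n.+1.
  have := xC n; rewrite ler_norml => /andP[]; rewrite /y iS => ? ?; nra.
have z1 n : z n.+1 <= z n.
  have := xC n; rewrite ler_norml => /andP[]; rewrite /z iS => ? ?; nra.
have yh : {homo y : m n / (m <= n)%N >-> m <= n} by apply: homo_leq => //; exact: le_trans.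
have zh : {homo z : m n / (m <= n)%N >-> n <= m}.
  by apply: homo_leq => // a b c h1 h2; exact: le_trans h2 h1.
have yz m n : y m <= z n.
  have ymn : y (maxn m n) <= z (maxn m n).
    rewrite /y /z lerD2l ge0_cp// divr_ge0 ?mulr_ge0// ltW//.
  by apply: le_trans (yh _ _ (leq_maxl m n)) (le_trans ymn (zh _ _ (leq_maxr m n))).
exists (sup (range y)) => n; rewrite ler_distl; apply/andP; split.
  apply: ub_le_sup; last by exists n.
  by exists (z 0%N) => _ [m _ <-].
by apply: ge_sup => [|_ [m _ <-]]; [exists (y 0%N), 0%N|exact: yz].
Qed.

Lemma le_half_pow_eq0 (x C : R) : (forall n, `|x| <= C / 2 ^+ n) -> x = 0.
Proof.
move=> h; apply/eqP; rewrite -normr_le0 leNgt; apply/negP => x0.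
have C0 : 0 < C by have := h 0%N; rewrite expr0 divr1; exact: lt_le_trans.
have [n hn] : exists n, C / `|x| < 2 ^+ n.
  exists (Num.bound (C / `|x|)); apply: lt_trans (archi_boundP _) _.
    by rewrite divr_ge0// ltW.
  by rewrite -natrX ltr_nat ltn_expl.
have := h n; rewrite ler_pdivlMr ?exprn_gt0// leNgt mulrC -ltr_pdivrMr//.
by rewrite hn.
Qed.

End continuity.

Ltac solve_cts := repeat first [ assumption | lazymatch goal with
  | |- cts (fun x => @?f x + @?g x) => apply: (@ctsD _ f g)
  | |- cts (fun x => - @?f x) => apply: (@ctsN _ f)
  | |- cts (fun x => @?f x * @?g x) => apply: (@ctsM _ f g)
  | |- cts (fun x => `|@?f x|) => apply: (@cts_norm _ f)
  | |- cts (fun x => Num.max (@?f x) (@?g x)) => apply: (@cts_max _ f g)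
  | |- cts (fun x => expR (@?f x)) => apply: (@cts_expR _ f)
  | |- cts (fun x => x) => exact: cts_id
  | |- cts (fun x => ?c) => exact: cts_cst
  end | eassumption | solve [auto 3 with cts nocore] ].

Create HintDb cts.

(** * The integral equation of a string *)

Section positive_functional.
Context {R : realType}.

(** Integration against a finite measure on [[0, T]], seen only through continuous functions. These
    are total on R, but [pf_ge0] looks at [[0, T]] only, so [L f] depends only on the values of [f]
    there ([pf_eq]). *)
Record positive_functional (T : R) (L : (R -> R) -> R) : Prop := PosFun {
  pfD : forall f g : R -> R, cts f -> cts g ->
    L (fun s => f s + g s) = L f + L g;
  pfZ : forall (k : R) (f : R -> R), cts f -> L (fun s => k * f s) = k * L f;
  pf_ge0 : forall f : R -> R, cts f -> (forall s, 0 <= s <= T -> 0 <= f s) ->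
    0 <= L f }.

(** The kernel of double integration from the left: as a function of [t], its second derivative is
    the unit mass at [s]. *)
Definition ramp (t s : R) : R := Num.max (t - s) 0.

Lemma ramp_cts t : cts (ramp t).
Proof. by rewrite /ramp; solve_cts. Qed.
#[local] Hint Resolve ramp_cts : cts.

Lemma ramp_ge0 t s : 0 <= ramp t s.
Proof. by rewrite /ramp le_max lexx orbT. Qed.

Lemma ramp_le t s : 0 <= s -> ramp t s <= `|t|.
Proof.
by move=> s0; rewrite /ramp ge_max normr_ge0 andbT; have := ler_norm t; lra.
Qed.

Lemma ramp_lipschitz t t' s : `|ramp t s - ramp t' s| <= `|t - t'|.
Proof.
rewrite /ramp; case: (lerP (t - s) 0); case: (lerP (t' - s) 0) => h1 h2.
- by rewrite subrr normr0.
- rewrite sub0r normrN (gtr0_norm h1) distrC.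
  by rewrite (le_trans _ (ler_norm _))//; lra.
- by rewrite subr0 (gtr0_norm h2) (le_trans _ (ler_norm _))//; lra.
- by rewrite (_ : t - s - (t' - s) = t - t') //; lra.
Qed.

(** The integrated form of [- h'' = h dL] with initial value [a] and initial slope [b]; it makes
    sense for singular measures and for atoms. *)
Definition solution (T : R) (L : (R -> R) -> R) (a b : R) (h : R -> R) : Prop :=
  cts h /\
  forall t, 0 <= t <= T -> h t = a + b * t - L (fun s => ramp t s * h s).

Context (T : R) (L : (R -> R) -> R) (Lp : positive_functional T L).
Implicit Types f g h : R -> R.

Lemma pfN f : cts f -> L (fun s => - f s) = - L f.
Proof.
move=> cf; rewrite -mulN1r -(pfZ Lp)//; congr L.
by apply/funext => s; rewrite mulN1r.
Qed.

Lemma pfB f g : cts f -> cts g ->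
  L (fun s => f s - g s) = L f - L g.
Proof. by move=> cf cg; rewrite (pfD Lp) ?pfN//; exact: ctsN. Qed.

Lemma pf_le f g : cts f -> cts g ->
  (forall s, 0 <= s <= T -> f s <= g s) -> L f <= L g.
Proof.
move=> cf cg fg; rewrite -subr_ge0 -pfB//; apply: (pf_ge0 Lp); first exact: ctsB.
by move=> s sT; rewrite subr_ge0 fg.
Qed.

Lemma pf_eq f g : cts f -> cts g ->
  (forall s, 0 <= s <= T -> f s = g s) -> L f = L g.
Proof.
by move=> cf cg fg; apply/eqP; rewrite eq_le !pf_le// => s /fg ->.
Qed.

Definition mass := L (fun=> 1).

Lemma mass_ge0 : 0 <= mass.
Proof. by apply: (pf_ge0 Lp) => //; exact: cts_cst. Qed.

Lemma pf_cst k : L (fun=> k) = k * mass.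
Proof.
rewrite -(pfZ Lp); last exact: cts_cst.
by congr L; apply/funext => s; rewrite mulr1.
Qed.

Lemma pf_norm f : cts f -> `|L f| <= L (fun s => `|f s|).
Proof.
move=> cf; rewrite ler_norml -pfN; last by solve_cts.
by apply/andP; split; apply: pf_le; first [by solve_cts | move=> s _]; rewrite ?ler_norm// lerNl -normrN ler_norm.
Qed.

Lemma pf_le_mass f k : cts f ->
  (forall s, 0 <= s <= T -> `|f s| <= k) -> `|L f| <= k * mass.
Proof.
move=> cf fk; apply: le_trans (pf_norm cf) _.
by rewrite -pf_cst; apply: pf_le; solve_cts.
Qed.

Lemma volterra_lipschitz f k t t' : cts f ->
  (forall s, 0 <= s <= T -> `|f s| <= k) ->
  `|L (fun s => ramp t s * f s) - L (fun s => ramp t' s * f s)| <=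
    `|t - t'| * k * mass.
Proof.
move=> cf fk; rewrite -pfB; [|by solve_cts..].
apply: pf_le_mass => [|s sT]; first by solve_cts.
by rewrite -mulrBl normrM ler_pM// ?ramp_lipschitz// fk.
Qed.

Lemma bounded_cts f : 0 <= T -> cts f ->
  exists2 k, 0 <= k & forall s, 0 <= s <= T -> `|f s| <= k.
Proof.
move=> T0 cf; have [c _ h] := EVT_max_cts T0 (cts_norm cf).
by exists `|f c|.
Qed.

Lemma volterra_cts f : 0 <= T -> cts f ->
  cts (fun t => L (fun s => ramp t s * f s)).
Proof.
move=> T0 cf; have [k _ fk] := bounded_cts T0 cf.
apply: (@lipschitz_cts _ _ (k * mass)) => x y.
by apply: le_trans (volterra_lipschitz x y cf fk) _; rewrite -mulrA mulrC.
Qed.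

(* From [K (t - s) <= expR (K (t - s))]. *)
Lemma volterra_expR K t : 0 < K ->
  L (fun s => ramp t s * expR (K * s)) <= expR (K * t) / K * mass.
Proof.
move=> K0; rewrite -pf_cst; apply: pf_le; [by solve_cts|by solve_cts|].
move=> s sT; rewrite ler_pdivlMr// /ramp.
case: (lerP (t - s) 0) => h; first by rewrite !mul0r expR_ge0.
have -> : K * t = K * (t - s) + K * s by ring.
rewrite expRD mulrAC ler_wpM2r ?expR_ge0//.
by have := expR_ge1Dx (K * (t - s)); lra.
Qed.

(** The weight [expR (- (2 * X) * t)] makes the Volterra operator a contraction by 1/2
    ([volterra_expR] with [K = 2 * X]). Evaluated where the weighted norm of [d] attains its maximum
    [M], the hypothesis therefore gives [M <= 2 * e]. *)
Lemma gronwall X e d : 0 <= T -> 0 < X -> mass <= X -> 0 <= e -> cts d ->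
  (forall t, 0 <= t <= T -> `|d t| <= e + L (fun s => ramp t s * `|d s|)) ->
  forall t, 0 <= t <= T -> `|d t| <= 2 * e * expR (2 * X * T).
Proof.
move=> T0 X0 mX e0 cd de.
have cw : cts (fun t => expR (- (2 * X) * t) * `|d t|) by solve_cts.
have [t0 t0T ht0] := EVT_max_cts T0 cw.
set M := expR _ * _ in ht0.
have dM s : 0 <= s <= T -> `|d s| <= M * expR (2 * X * s).
  move=> sT; have := ht0 _ sT; rewrite /M mulNr expRN mulrC.
  by rewrite ler_pdivrMr ?expR_gt0.
have M2 : M <= 2 * e.
  have : `|d t0| <= e + M * (expR (2 * X * t0) / (2 * X) * X).
    apply: le_trans (de _ t0T) _; rewrite lerD2l.
    apply: (@le_trans _ _ (M * L (fun s => ramp t0 s * expR (2 * X * s)))).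
      rewrite -(pfZ Lp); last by solve_cts.
      apply: pf_le; [by solve_cts..|move=> s sT].
      by rewrite mulrCA ler_wpM2l ?ramp_ge0// dM.
    rewrite ler_wpM2l//; first by rewrite /M mulr_ge0// expR_ge0.
    apply: le_trans (volterra_expR _ _) _; first by rewrite mulr_gt0.
    by rewrite ler_wpM2l// divr_ge0 ?expR_ge0// mulr_ge0// ltW.
  have -> : expR (2 * X * t0) / (2 * X) * X = expR (2 * X * t0) / 2.
    by field; rewrite gt_eqF.
  have Md : `|d t0| = M * expR (2 * X * t0).
    by rewrite /M mulNr expRN mulrC mulrA divff ?mul1r// gt_eqF// expR_gt0.
  have : 1 <= expR (2 * X * t0).
    by rewrite -expR0 ler_expR; case/andP: t0T => ? _; rewrite !mulr_ge0// ltW.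
  by rewrite Md; set E := expR _ => E1 h; nra.
move=> t tT; apply: le_trans (dM _ tT) _.
apply: ler_pM => //; first by rewrite /M mulr_ge0// expR_ge0.
by rewrite ler_expR ler_wpM2l//; [rewrite mulr_ge0// ltW|case/andP: tT].
Qed.

Lemma gronwall0 d : 0 <= T -> cts d ->
  (forall t, 0 <= t <= T -> `|d t| <= L (fun s => ramp t s * `|d s|)) ->
  forall t, 0 <= t <= T -> d t = 0.
Proof.
move=> T0 cd de t tT; apply/eqP; rewrite -normr_le0.
rewrite -[leRHS](mul0r (expR (2 * (mass + 1) * T))) -[X in X * _](mulr0 2).
apply: (@gronwall (mass + 1)) => //.
- by rewrite ltr_wpDl// mass_ge0.
- by rewrite lerDl.
- by move=> s sT; rewrite add0r de.
Qed.

Lemma solutionZ k a b h : solution T L a b h ->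
  solution T L (k * a) (k * b) (fun t => k * h t).
Proof.
move=> [ch eh]; split=> [|t tT]; first by solve_cts.
rewrite eh// !mulrDr mulrN mulrA; congr (_ - _).
rewrite -(pfZ Lp); last by solve_cts.
by congr L; apply/funext => s; rewrite mulrCA.
Qed.

Lemma solution_bound X a b h : 0 <= T -> 0 < X -> mass <= X ->
  solution T L a b h ->
  forall t, 0 <= t <= T -> `|h t| <= 2 * (`|a| + `|b| * T) * expR (2 * X * T).
Proof.
move=> T0 X0 mX [ch eh]; apply: gronwall => //; first by rewrite addr_ge0// mulr_ge0.
move=> t tT; rewrite eh//; apply: le_trans (ler_normB _ _) _; apply: lerD.
  apply: le_trans (ler_normD _ _) _; rewrite lerD2l normrM ler_wpM2l//.
  by case/andP: tT => t0 tT; rewrite ger0_norm.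
apply: le_trans (pf_norm _) _; first by solve_cts.
apply: pf_le; [by solve_cts..|move=> s _].
by rewrite normrM ger0_norm// ramp_ge0.
Qed.

Fixpoint picard (a b : R) (n : nat) : R -> R :=
  if n is n'.+1 then fun t => a + b * t - L (fun s => ramp t s * picard a b n' s)
  else fun=> 0.

Arguments picard : simpl never.

Lemma picardS a b n t :
  picard a b n.+1 t = a + b * t - L (fun s => ramp t s * picard a b n s).
Proof. by []. Qed.

Lemma picard_diff a b n m t : picard a b n.+1 t - picard a b m.+1 t =
  L (fun s => ramp t s * picard a b m s) - L (fun s => ramp t s * picard a b n s).
Proof. by rewrite !picardS; ring. Qed.

Lemma picard_cts a b n : 0 <= T -> cts (picard a b n).
Proof.
move=> T0; elim: n => [|n ih]; first exact: cts_cst.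
by apply: (@ctsB _ (fun t => a + b * t)); [solve_cts|exact: volterra_cts].
Qed.

Lemma volterra_diff_le f g t k : cts f -> cts g ->
  (forall s, 0 <= s <= T -> `|f s - g s| <= k) ->
  `|L (fun s => ramp t s * f s) - L (fun s => ramp t s * g s)| <= `|t| * k * mass.
Proof.
move=> cf cg fg; rewrite -pfB; [|by solve_cts..].
apply: pf_le_mass => [|s sT]; first by solve_cts.
rewrite -mulrBr normrM ler_pM// ?fg// ger0_norm ?ramp_ge0// ramp_le//.
by case/andP: sT.
Qed.

(** The weight of [gronwall] again: each iteration costs a factor [mass / K], which is below 1/2.
    The summand 1 keeps [K] positive when the mass is zero. *)
Lemma picard_step a b : 0 <= T -> exists2 C, 0 <= C & forall n t, 0 <= t <= T ->
  `|picard a b n.+1 t - picard a b n t| <= C * expR (2 * (mass + 1) * t) / 2 ^+ n.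
Proof.
move=> T0; set K := 2 * (mass + 1).
have m0 := mass_ge0; have K0 : 0 < K by rewrite /K; lra.
have [C C0 hC] := bounded_cts T0 (@picard_cts a b 1 T0).
exists C => //; elim => [|n ih] t tT.
  rewrite expr0 divr1 subr0; apply: le_trans (hC _ tT) _.
  rewrite ler_peMr// -expR0 ler_expR mulr_ge0//; first exact: ltW.
  by case/andP: tT.
have cn m : cts (picard a b m) by exact: picard_cts.
rewrite picard_diff distrC -pfB; [|by solve_cts..].
apply: le_trans (pf_norm _) _; first by solve_cts.
apply: (@le_trans _ _ (C / 2 ^+ n * L (fun s => ramp t s * expR (K * s)))).
  rewrite -(pfZ Lp); last by solve_cts.
  apply: pf_le; [by solve_cts..|move=> s sT].
  rewrite -mulrBr normrM ger0_norm ?ramp_ge0// mulrCA ler_wpM2l ?ramp_ge0//.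
  by rewrite mulrAC ih.
have -> : C * expR (K * t) / 2 ^+ n.+1 = C / 2 ^+ n * (expR (K * t) / 2).
  by rewrite exprS; field; rewrite expf_neq0.
rewrite ler_wpM2l ?divr_ge0 ?exprn_ge0//.
apply: le_trans (volterra_expR _ K0) _.
rewrite -mulrA ler_wpM2l ?expR_ge0//.
by rewrite mulrC ler_pdivrMr// /K; lra.
Qed.

Lemma solution_exists a b : 0 <= T -> exists h, solution T L a b h.
Proof.
move=> T0; have m0 := mass_ge0; have [C C0 hC] := picard_step a b T0.
have cn m : cts (picard a b m) by exact: picard_cts.
have [C' C'0 hC'] : exists2 C', 0 <= C' & forall n t, 0 <= t <= T ->
    `|picard a b n.+1 t - picard a b n t| <= C' / 2 ^+ n.
  exists (C * expR (2 * (mass + 1) * T)) => [|n t tT]; first by rewrite mulr_ge0// expR_ge0.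
  apply: le_trans (hC n t tT) _; rewrite ler_wpM2r ?invr_ge0 ?exprn_ge0//.
  rewrite ler_wpM2l// ler_expR ler_wpM2l//; [lra|by case/andP: tT].
(* A bound at every real [t], not only on [[0, T]]: an iterate at [t] sees the previous one only
   through its values on [[0, T]]. It is needed because [cts h] speaks about all of R. *)
pose D t := `|a + b * t| + 2 * C' * `|t| * mass.
have D0 t : (0 : R) <= D t by rewrite /D addr_ge0// !mulr_ge0.
have hD t n : `|picard a b n.+1 t - picard a b n t| <= D t / 2 ^+ n.
  case: n => [|n].
    rewrite expr0 divr1 subr0 picardS /D.
    rewrite (_ : (fun s => _) = (fun=> 0)); last by apply/funext => s; rewrite mulr0.
    by rewrite pf_cst mul0r subr0 lerDl !mulr_ge0.
  rewrite picard_diff distrC.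
  apply: le_trans (volterra_diff_le _ (cn _) (cn _) (hC' n)) _.
  rewrite /D exprS invfM mulrDl.
  apply: (@le_trans _ _ (2 * C' * `|t| * mass * (2^-1 / 2 ^+ n))); last first.
    by rewrite lerDr mulr_ge0// mulr_ge0// invr_ge0 exprn_ge0.
  by rewrite le_eqVlt; apply/orP; left; apply/eqP; field; rewrite expf_neq0.
have /choice[h hh] t := half_steps_cvg (hD t).
(* The iterates share a bound [M] on [[0, T]], hence a Lipschitz constant on R, and the latter
   survives the pointwise limit. *)
have ch : cts h.
  have [M M0 hM] : exists2 M, 0 <= M &
      forall n s, 0 <= s <= T -> `|picard a b n s| <= M.
    have [B B0 hB] : exists2 B, 0 <= B & forall s, 0 <= s <= T -> D s <= B.
      have [|B B0 hB] := @bounded_cts (fun s => D s) T0.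
        by rewrite /D; solve_cts.
      by exists B => // s /hB; apply: le_trans; exact: ler_norm.
    exists (4 * B) => [|n s sT]; first by rewrite mulr_ge0.
    have h0 := hh s 0%N; have hn := hh s n; have := hB _ sT.
    rewrite subr0 expr0 divr1 in h0.
    have Dn : 2 * D s / 2 ^+ n <= 2 * D s.
      rewrite ler_pdivrMr ?exprn_gt0// ler_peMr//; last first.
        by rewrite exprn_ege1// ler1n.
      by rewrite mulr_ge0.
    move=> DB.
    have -> : picard a b n s = h s - (h s - picard a b n s) by ring.
    by apply: le_trans (ler_normB _ _) _; lra.
  apply: (@lipschitz_cts _ _ (`|b| + M * mass)) => x y.
  apply/ler_addgt0Pr => e e0.
  pose E := 2 * D x + 2 * D y.
  have E0 : 0 <= E by rewrite /E; have := D0 x; have := D0 y; lra.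
  have [n hn] : exists n, E / 2 ^+ n <= e.
    exists (Num.bound (E / e)); rewrite ler_pdivrMr ?exprn_gt0//.
    rewrite mulrC -ler_pdivrMr//; apply: ltW; apply: lt_trans (archi_boundP _) _.
      by apply: divr_ge0 => //; exact: ltW.
    by rewrite -natrX ltr_nat ltn_expl.
  have hx := hh x n.+1; have hy := hh y n.+1.
  have pn : 2 * D x / 2 ^+ n.+1 + 2 * D y / 2 ^+ n.+1 <= e.
    apply: le_trans hn; rewrite -mulrDl -/E exprS invfM.
    rewrite mulrCA ler_piMl//; last by rewrite invf_le1 ?ler1n.
    by rewrite divr_ge0// exprn_ge0.
  have -> : h x - h y = (h x - picard a b n.+1 x) - (h y - picard a b n.+1 y)
     + (picard a b n.+1 x - picard a b n.+1 y) by ring.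
  apply: le_trans (ler_normD _ _) _; rewrite addrC lerD//; last first.
    by apply: le_trans (ler_normB _ _) _; apply: le_trans pn; rewrite lerD.
  rewrite !picardS.
  set A := L _; set B := L _.
  have -> : a + b * x - A - (a + b * y - B) = b * (x - y) - (A - B) by ring.
  apply: le_trans (ler_normB _ _) _; rewrite normrM mulrDl lerD//.
  apply: le_trans (volterra_lipschitz x y (cn n) (hM n)) _.
  by rewrite -mulrA mulrC.
exists h; split=> // t tT; apply/eqP; rewrite -subr_eq0; apply/eqP.
pose B := (2 * D t + `|t| * mass * (2 * C')).
(* both [h] and [L (ramp t * h)] are approximated at rate [2 ^- n] *)
have hC2 n s : 0 <= s <= T -> `|h s - picard a b n s| <= 2 * C' / 2 ^+ n.
  move=> sT.
  have [l hl] := half_steps_cvg (fun n => hC' n s sT).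
  have -> : h s = l.
    apply/eqP; rewrite -subr_eq0; apply/eqP.
    apply: (@le_half_pow_eq0 _ _ (2 * D s + 2 * C')) => m.
    have -> : h s - l = (h s - picard a b m s) - (l - picard a b m s) by ring.
    by apply: le_trans (ler_normB _ _) _; rewrite mulrDl lerD.
  exact: hl.
apply: (@le_half_pow_eq0 _ _ B) => n.
have -> : h t - (a + b * t - L (fun s => ramp t s * h s)) =
  (h t - picard a b n.+1 t) + (L (fun s => ramp t s * h s) - L (fun s => ramp t s * picard a b n s)).
  by rewrite picardS; ring.
apply: le_trans (ler_normD _ _) _; rewrite /B mulrDl lerD//.
  apply: le_trans (hh t n.+1) _; rewrite ler_wpM2l//.
    by rewrite mulr_ge0.
  by rewrite lef_pV2 ?posrE ?exprn_gt0// ler_weXn2l ?ler1n.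
apply: le_trans (volterra_diff_le _ ch (cn _) (hC2 n)) _.
by rewrite mulrAC !mulrA.
Qed.

End positive_functional.

(** * Zeros of solutions *)

Section green_function.
Context {R : realType}.

#[local] Hint Resolve ramp_cts : cts.

(** The Dirichlet Green function of minus the second derivative on [[u, v]], extended by 0. Written
    with ramps it is continuous in [s] on R and combines directly with the Volterra equation. *)
Definition green (u v t s : R) : R :=
  ((v - t) * ramp u s + (t - u) * ramp v s) / (v - u) - ramp t s.

Lemma green_cts u v t : cts (green u v t).
Proof.
by rewrite /green; solve_cts.
Qed.

Lemma greenL u v t s : u < v -> u <= s <= t -> t <= v ->
  green u v t s = (v - t) * (s - u) / (v - u).
Proof.
move=> uv /andP[us st] tv; rewrite /green /ramp.
rewrite (max_r (x := u - s)) ?subr_le0// !max_l ?subr_ge0//; last exact: le_trans st tv.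
by field; rewrite subr_eq0 gt_eqF.
Qed.

Lemma greenR u v t s : u < v -> u <= t -> t <= s <= v ->
  green u v t s = (t - u) * (v - s) / (v - u).
Proof.
move=> uv ut /andP[ts sv]; rewrite /green /ramp.
rewrite (max_r (x := u - s)) ?subr_le0//; last exact: le_trans ut ts.
rewrite (max_l (x := v - s)) ?subr_ge0// max_r ?subr_le0//.
by rewrite mulr0 add0r subr0.
Qed.

Lemma green0 u v t s : u < v -> u <= t <= v -> (s <= u) || (v <= s) ->
  green u v t s = 0.
Proof.
move=> uv /andP[ut tv] /orP[su|vs]; rewrite /green /ramp.
  rewrite !max_l ?subr_ge0//; first by field; rewrite subr_eq0 gt_eqF.
    exact: le_trans su ut.
  exact: le_trans (ltW uv).
rewrite !max_r ?subr_le0// ?mulr0 ?addr0 ?mul0r ?subr0//.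
  exact: le_trans vs.
exact: le_trans (ltW uv) vs.
Qed.

Lemma green_le u v t s : u < v -> u <= t <= v -> 0 <= green u v t s <= v - u.
Proof.
move=> uv /andP[ut tv]; have d0 : 0 < v - u by rewrite subr_gt0.
case: (lerP s u) => [su|us]; first by rewrite green0 ?su ?ut// lexx ltW.
case: (lerP v s) => [vs|sv]; first by rewrite green0 ?vs ?ut ?orbT// lexx ltW.
case: (lerP s t) => st.
  rewrite greenL ?(ltW us)// divr_ge0/= ?mulr_ge0 ?subr_ge0 ?(ltW us) ?(ltW uv)//.
  by rewrite ler_pdivrMr// ler_pM ?subr_ge0 ?(ltW us)//; lra.
rewrite greenR ?(ltW st) ?(ltW sv)// divr_ge0/= ?mulr_ge0 ?subr_ge0 ?(ltW sv) ?(ltW uv)//.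
by rewrite ler_pdivrMr// ler_pM ?subr_ge0 ?(ltW sv)//; lra.
Qed.

Lemma green_ge u v t s d : u < v -> 0 <= d ->
  u + d <= t <= v - d -> u + d <= s <= v - d -> d ^+ 2 / (v - u) <= green u v t s.
Proof.
move=> uv d0 /andP[t1 t2] /andP[s1 s2]; have e0 : 0 < v - u by rewrite subr_gt0.
case: (lerP s t) => st.
  rewrite greenL//; [|by apply/andP; split=> //; lra|lra].
  by rewrite ler_pM2r ?invr_gt0// expr2 ler_pM//; lra.
rewrite greenR//; [|lra|by apply/andP; split; lra].
by rewrite ler_pM2r ?invr_gt0// expr2 ler_pM//; lra.
Qed.

Context (T : R) (L : (R -> R) -> R) (Lp : positive_functional T L).
Hint Resolve ramp_cts green_cts : cts.
Implicit Types h : R -> R.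

(** The equations at [u], [v] and [t], combined with the weights of linear interpolation, cancel the
    affine part [a + b * t]; the kernel that remains is [green]. *)
Lemma green_repr a b h u v t : solution T L a b h ->
  0 <= u -> u < v -> v <= T -> u <= t <= v ->
  h t = ((v - t) * h u + (t - u) * h v) / (v - u) + L (fun s => green u v t s * h s).
Proof.
move=> [ch eh] u0 uv vT /andP[ut tv].
have -> : (fun s => green u v t s * h s) =
    fun s => (v - u)^-1 * ((v - t) * (ramp u s * h s) + (t - u) * (ramp v s * h s)) - ramp t s * h s.
  by apply/funext => s; rewrite /green; ring.
rewrite (pfB Lp); [|by solve_cts..].
rewrite (pfZ Lp); last by solve_cts.
rewrite (pfD Lp); [|by solve_cts..].
rewrite !(pfZ Lp); [|by solve_cts..].
have := eh u; have := eh v; have := eh t.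
have -> : 0 <= u <= T by rewrite u0 (le_trans (ltW uv)).
have -> : 0 <= t <= T by rewrite (le_trans u0)// (le_trans tv).
have -> : 0 <= v <= T by rewrite vT (le_trans u0)// ltW.
move=> /(_ isT) -> /(_ isT) -> /(_ isT) ->.
by field; rewrite subr_eq0 gt_eqF.
Qed.

(** With zero boundary values only the Green term is left. As [green] is at most [v - u], the
    maximum of the norm of [h] is at most itself times a factor below 1. *)
Lemma lyapunov a b h u v : solution T L a b h ->
  0 <= u -> u < v -> v <= T -> h u = 0 -> h v = 0 -> (v - u) * mass L < 1 ->
  forall t, u <= t <= v -> h t = 0.
Proof.
move=> sh u0 uv vT hu hv uv1.
have [c cuv hc] := EVT_max_cts (ltW uv) (cts_norm sh.1).
move=> t tuv; apply/eqP; rewrite -normr_le0; apply: le_trans (hc _ tuv) _.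
have hc' : `|h c| <= (v - u) * `|h c| * mass L.
  rewrite {1}(green_repr sh u0 uv vT cuv) hu hv !mulr0 addr0 mul0r add0r.
  have ch := sh.1; apply: (pf_le_mass Lp); first by solve_cts.
  move=> s _; have /andP[g0 g1] := green_le s uv cuv.
  rewrite normrM (ger0_norm g0).
  case: (boolP ((s <= u) || (v <= s))) => [uvs|].
    by rewrite green0// mul0r mulr_ge0// subr_ge0 ltW.
  rewrite negb_or -!ltNge => /andP[us sv].
  by rewrite ler_pM// hc// !ltW.
by rewrite leNgt; apply/negP => c0; nra.
Qed.

(* [h] and its slope vanish at [u], so [h] vanishes also a bit to the left. *)
Lemma zero_step_left a b h e u v : solution T L a b h ->
  0 <= e -> e < u -> u < v -> v <= T -> (u - e) * mass L < 1 ->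
  (forall t, u <= t <= v -> h t = 0) -> forall t, e <= t <= v -> h t = 0.
Proof.
move=> sh e0 eu uv vT eu1 h0; have ch := sh.1.
have [c /andP[ec cu] hc] := EVT_max_cts (ltW eu) (cts_norm ch).
suff hc0 : h c = 0.
  move=> t /andP[et tv]; case: (lerP t u) => [tu|ut]; last by rewrite h0// ltW.
  by apply/eqP; rewrite -normr_le0; apply: le_trans (hc t _) _; rewrite ?et// hc0 normr0.
have hu : h u = 0 by rewrite h0// lexx ltW.
have hv : h v = 0 by rewrite h0// lexx ltW.
move: cu; rewrite le_eqVlt => /predU1P[->//|cu].
have cv := lt_trans cu uv; have c0 := le_trans e0 ec.
have vc0 : 0 < v - c by rewrite subr_gt0.
have vu0 : 0 < v - u by rewrite subr_gt0.
have ucv : c <= u <= v by rewrite !ltW.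
have := green_repr sh c0 cv vT ucv.
rewrite hu hv mulr0 addr0 => /eqP; rewrite eq_sym addr_eq0 => /eqP hcE.
have bound : `|L (fun s => green c v u s * h s)| <= (v - u) * (u - c) / (v - c) * `|h c| * mass L.
  apply: (pf_le_mass Lp); first by solve_cts.
  move=> s _; have /andP[g0 _] := green_le s cv ucv.
  rewrite normrM (ger0_norm g0).
  have B0 : 0 <= (v - u) * (u - c) / (v - c) * `|h c|.
    by rewrite mulr_ge0// divr_ge0 ?mulr_ge0// ?subr_ge0 ltW.
  case: (lerP s c) => [sc|cs]; first by rewrite green0 ?sc// mul0r.
  case: (lerP v s) => [vs|sv]; first by rewrite green0 ?vs ?orbT// mul0r.
  case: (lerP s u) => [su|us]; last by rewrite h0 ?(ltW us) ?(ltW sv)// normr0 mulr0.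
  rewrite greenL ?su ?(ltW cs) ?(ltW uv)// ler_pM//.
  - by rewrite divr_ge0 ?mulr_ge0// ?subr_ge0// ltW.
  - by rewrite ler_pM2r ?invr_gt0// ler_pM2l// lerB.
  - by rewrite hc// su (le_trans ec (ltW cs)).
have hcE2 : `|h c| = (v - c) / (v - u) * `|L (fun s => green c v u s * h s)|.
  rewrite -[in RHS]normrN -hcE normrM normrM (gtr0_norm vu0) normfV (gtr0_norm vc0).
  by field; rewrite !gt_eqF.
have : `|h c| <= (u - c) * mass L * `|h c|.
  rewrite {1}hcE2; have -> : (u - c) * mass L * `|h c| = (v - c) / (v - u) *
      ((v - u) * (u - c) / (v - c) * `|h c| * mass L) by field; rewrite !gt_eqF.
  by apply: ler_wpM2l bound; apply: divr_ge0; exact: ltW.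
have := mass_ge0 Lp => m0; move=> hh; apply/eqP; rewrite -normr_le0 leNgt.
apply/negP => c1.
have : (u - c) * mass L < 1 by apply: le_lt_trans eu1; rewrite ler_wpM2r// lerB.
by nra.
Qed.

(** Unique continuation: [zero_step_left] advances by the fixed length [(mass L + 1)^-1], so 0 is
    reached after finitely many steps. Then [a + b * t] vanishes on a nontrivial interval. *)
Lemma solution_zero_itv a b h u v : solution T L a b h ->
  0 <= u -> u < v -> v <= T -> (forall t, u <= t <= v -> h t = 0) ->
  a = 0 /\ b = 0.
Proof.
move=> sh u0 uv vT h0; have m0 := mass_ge0 Lp.
pose d := (mass L + 1)^-1; have d0 : 0 < d by rewrite invr_gt0 ltr_wpDl.
have steps n : forall t, Num.max 0 (u - n%:R * d) <= t <= v -> h t = 0.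
  elim: n => [|n ih]; first by rewrite mul0r subr0 max_r.
  set u' := Num.max 0 (u - n%:R * d) in ih; set e := Num.max _ _.
  have u'u : u' <= u by rewrite /u' ge_max u0 gerBl mulr_ge0// ltW.
  have eu' : e <= u'.
    rewrite /e /u' ge_max !le_max lexx/=; apply/orP; right.
    by rewrite lerB// ler_wpM2r ?ler_nat// ltW.
  have u'v : u' < v by apply: le_lt_trans uv.
  have e0 : 0 <= e by rewrite /e le_max lexx.
  move: eu'; rewrite le_eqVlt => /predU1P[->//|eu'].
  apply: (zero_step_left sh e0 eu' u'v vT) => //.
  apply: (@le_lt_trans _ _ (d * mass L)); last first.
    by rewrite mulrC /d ltr_pdivrMr ?mul1r ?ltrDl// ltr_wpDl.
  rewrite ler_wpM2r//.
  have : u - n.+1%:R * d <= e by rewrite /e le_max lexx orbT.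
  have : u' = 0 \/ u' = u - n%:R * d by rewrite /u'; case: lerP; [right|left].
  rewrite -natr1 mulrDl mul1r => -[] ->; lra.
have [n hn] : exists n, u - n%:R * d <= 0.
  exists (Num.bound (u / d)); rewrite subr_le0 -ler_pdivrMr//.
  by apply/ltW/archi_boundP; rewrite divr_ge0// ltW.
have {hn}h0v t : 0 <= t <= v -> h t = 0 by move=> tv; apply: (steps n); rewrite max_l.
have v0 : 0 < v by apply: le_lt_trans uv.
have E t : 0 <= t <= v -> a + b * t = 0.
  move=> /andP[t0 tv]; have := sh.2 t; rewrite t0 (le_trans tv)// => /(_ isT).
  rewrite h0v ?t0// => /eqP; rewrite eq_sym subr_eq0 => /eqP ->.
  rewrite (pf_eq Lp (g := fun=> 0)); [|by have := sh.1 => ?; solve_cts|exact: cts_cst|].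
    by rewrite (pf_cst Lp) mul0r.
  move=> s /andP[s0 sT]; case: (lerP s v) => sv; first by rewrite h0v ?s0// mulr0.
  by rewrite /ramp max_r ?mul0r// subr_le0 (le_trans tv)// ltW.
have := E 0; have := E v; rewrite !lexx ltW// => /(_ isT) Ev /(_ isT).
rewrite mulr0 addr0 => a0; move: Ev; rewrite a0 add0r => /eqP.
by rewrite mulf_eq0 (gt_eqF v0) orbF => /eqP.
Qed.

(** Two zeros that are too close force [h] to vanish between them by [lyapunov], and unique
    continuation then annihilates the initial data. *)
Lemma zeros_separated a b h u v : solution T L a b h -> (a != 0) || (b != 0) ->
  0 <= u -> u < v -> v <= T -> h u = 0 -> h v = 0 -> 1 <= (v - u) * mass L.
Proof.
move=> sh ab u0 uv vT hu hv; rewrite leNgt; apply/negP => uv1.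
have := solution_zero_itv sh u0 uv vT (lyapunov sh u0 uv vT hu hv uv1).
by move=> [a0 b0]; move: ab; rewrite a0 b0 eqxx.
Qed.

(* Near a zero [z] the solution has no other zero, and if it had the same strict
   sign on both sides, then [h z] would be at least a positive chord value. *)
Lemma zero_sign_change a b h z e : solution T L a b h -> (a != 0) || (b != 0) ->
  0 < z < T -> h z = 0 -> 0 < e ->
  exists l r, [/\ z - e < l, l < z, z < r, r < z + e & h l * h r < 0].
Proof.
move=> sh ab /andP[z0 zT] hz e0; have m0 := mass_ge0 Lp; have ch := sh.1.
pose d := Num.min (e / 2) (Num.min z (Num.min (T - z) (mass L + 1)^-1)).
have m1 : 0 < (mass L + 1)^-1 by rewrite invr_gt0 ltr_wpDl.
have d0 : 0 < d by rewrite !lt_min divr_gt0// z0 subr_gt0 zT m1.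
have [de dz dT dm] : [/\ d <= e / 2, d <= z, d <= T - z & d <= (mass L + 1)^-1].
  by split; rewrite /d !ge_min lexx ?orbT.
have dm1 x : x <= d -> x * mass L < 1.
  move=> xd; apply: (@le_lt_trans _ _ ((mass L + 1)^-1 * mass L)).
    by rewrite ler_wpM2r// (le_trans xd).
  by rewrite mulrC ltr_pdivrMr ?mul1r ?ltrDl// ltr_wpDl.
have nr t : z < t <= z + d -> h t != 0.
  move=> /andP[zt tz]; apply/eqP => ht.
  have tT : t <= T by lra.
  have tz1 : (t - z) * mass L < 1 by apply: dm1; lra.
  by have := zeros_separated sh ab (ltW z0) zt tT hz ht; rewrite leNgt tz1.
have nl t : z - d <= t < z -> h t != 0.
  move=> /andP[zt tz]; apply/eqP => ht.
  have t0 : 0 <= t by lra.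
  have tz1 : (z - t) * mass L < 1 by apply: dm1; lra.
  by have := zeros_separated sh ab t0 tz (ltW zT) ht hz; rewrite leNgt tz1.
exists (z - d), (z + d); split; [lra|lra|lra|lra|].
rewrite ltNge; apply/negP => hh.
have zd0 : 0 <= z - d by lra.
have zdT : z + d <= T by lra.
have zz : z - d < z + d by lra.
have hl : h (z - d) != 0 by apply: nl; lra.
have hr : h (z + d) != 0 by apply: nr; lra.
have {}hh : 0 < h (z - d) * h (z + d) by rewrite lt0r mulf_neq0.
pose sg := Num.sg (h (z - d)).
have sgl : 0 < sg * h (z - d) by rewrite -normrEsg normr_gt0.
have sg2 : sg * sg = 1 by rewrite -expr2 sqr_sg hl.
have sgr : 0 < sg * h (z + d).
  have : 0 < (sg * h (z - d)) * (sg * h (z + d)) by rewrite mulrACA sg2 mul1r.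
  by rewrite pmulr_rgt0.
have pos t : z - d <= t <= z + d -> 0 <= sg * h t.
  move=> /andP[t1 t2]; case: (ltgtP t z) => [tz|zt|->]; last by rewrite hz mulr0.
  - rewrite leNgt; apply/negP => neg.
    have [||c /andP[c1 c2] /eqP] := @IVT_zero _ (fun x => sg * h x) _ _ t1.
    - by solve_cts.
    - by rewrite pmulr_rle0// ltW.
    rewrite mulf_eq0 sgr_eq0 (negPf hl)/= => hc.
    by have := nl c; rewrite c1 (le_lt_trans c2 tz) hc => /(_ isT).
  - rewrite leNgt; apply/negP => neg.
    have [||c /andP[c1 c2] /eqP] := @IVT_zero _ (fun x => sg * h x) _ _ t2.
    - by solve_cts.
    - by rewrite pmulr_lle0// ltW.
    rewrite mulf_eq0 sgr_eq0 (negPf hl)/= => hc.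
    by have := nr c; rewrite c2 (lt_le_trans zt c1) hc => /(_ isT).
have zin : z - d <= z <= z + d by apply/andP; split; lra.
have := green_repr (solutionZ Lp sg sh) zd0 zz zdT zin.
have G0 : 0 <= L (fun s => green (z - d) (z + d) z s * (sg * h s)).
  apply: (pf_ge0 Lp); first by solve_cts.
  move=> s _; have /andP[g0 _] := green_le s zz zin.
  case: (boolP ((s <= z - d) || (z + d <= s))) => [?|]; first by rewrite green0// mul0r.
  by rewrite negb_or -!ltNge => /andP[? ?]; rewrite mulr_ge0// pos// !ltW.
have : 0 < ((z + d - z) * (sg * h (z - d)) + (z - (z - d)) * (sg * h (z + d))) / (z + d - (z - d)).
  rewrite divr_gt0//; last by lra.
  by rewrite addr_gt0// mulr_gt0//; lra.
by rewrite hz mulr0; lra.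
Qed.

(** Without a zero, [h] is, up to sign, positive on ]u, v[. At its minimum over the core
    [[u + d, v - d]] the chord term is nonnegative, and the Green term exceeds the minimum itself
    because [green] is at least [d ^+ 2 / (v - u)] on the core. The number [w] stands for the mass
    of the core, expressed through continuous functions since [L] is not applied to indicators. *)
Lemma zero_exists a b h u v d w : solution T L a b h ->
  0 <= u -> v <= T -> 0 < d -> u + d <= v - d ->
  (forall g k, cts g -> (forall s, 0 <= s <= T -> 0 <= g s) -> 0 <= k ->
    (forall s, u + d <= s <= v - d -> k <= g s) -> w * k <= L g) ->
  1 < w * (d ^+ 2 / (v - u)) -> exists2 z, u < z < v & h z = 0.
Proof.
move=> sh u0 vT d0 uvd hw w1; have ch := sh.1.
have uv : u < v by lra.
apply: contrapT => nz.
have h0 t : u < t < v -> h t != 0.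
  by move=> tuv; apply/eqP => ht; apply: nz; exists t.
pose m := u + d; have muv : u < m < v by rewrite /m; apply/andP; split; lra.
pose sg := Num.sg (h m).
have sgm : 0 < sg * h m by rewrite -normrEsg normr_gt0 h0.
have pos t : u < t < v -> 0 < sg * h t.
  move=> tuv; rewrite lt0r mulf_neq0 ?sgr_eq0 ?h0//= leNgt; apply/negP => neg.
  have [z zuv hz] : exists2 z, u < z < v & sg * h z = 0.
    case: (lerP t m) => tm.
      have [||c /andP[c1 c2] hc] := @IVT_zero _ (fun x => sg * h x) _ _ tm.
      - by solve_cts.
      - by rewrite pmulr_lle0// ltW.
      by exists c => //; move: tuv muv => /andP[? ?] /andP[? ?]; apply/andP; split; lra.
    have [||c /andP[c1 c2] hc] := @IVT_zero _ (fun x => sg * h x) _ _ (ltW tm).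
    - by solve_cts.
    - by rewrite pmulr_rle0// ltW.
    by exists c => //; move: tuv muv => /andP[? ?] /andP[? ?]; apply/andP; split; lra.
  by move: hz => /eqP; rewrite mulf_eq0 sgr_eq0 (negPf (h0 _ muv)) (negPf (h0 _ zuv)).
have csg : cts (fun t => sg * h t) by solve_cts.
have pos' t : u <= t <= v -> 0 <= sg * h t.
  move=> /andP[ut tv]; rewrite leNgt; apply/negP => neg.
  have [c cuv hc] : exists2 c, u < c < v & sg * h c < 0.
    have /= := csg t; move/cvgrPdist_lt => /(_ (- (sg * h t))).
    rewrite oppr_gt0 => /(_ neg) [e /= e0 he].
    (* A small move to the right for [t] near [u] and to the left otherwise stays in ]u, v[; this
       settles the two ends, where [pos] does not apply. *)
    pose c := if t <= m then t + Num.min (e / 2) (d / 2) else t - Num.min (e / 2) (d / 2).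
    have mi0 : 0 < Num.min (e / 2) (d / 2) by rewrite lt_min !divr_gt0.
    have mie : Num.min (e / 2) (d / 2) <= e / 2 by rewrite ge_min lexx.
    have mid : Num.min (e / 2) (d / 2) <= d / 2 by rewrite ge_min lexx orbT.
    exists c.
      by rewrite /c; case: (lerP t m) => tm; apply/andP; rewrite /m in tm; split; lra.
    have /he : ball t e c.
      rewrite /ball/= /c; case: ifPn => _.
        by rewrite opprD addrA subrr sub0r normrN gtr0_norm//; lra.
      by rewrite opprB addrC addrNK gtr0_norm//; lra.
    by rewrite /= ltr_norml => /andP[]; lra.
  by have := pos _ cuv; rewrite ltNge ltW.
have md : m <= v - d by rewrite /m.
have [c /andP[c1 c2] hc] := EVT_min_cts md csg.
have cuv : u <= c <= v by apply/andP; rewrite /m in c1; split; lra.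
have := green_repr (solutionZ Lp sg sh) u0 uv vT cuv.
set chord := (X in X + _); have ch0 : 0 <= chord.
  have hu0 := pos' u; have hv0 := pos' v; rewrite !lexx !(ltW uv) in hu0 hv0.
  move: cuv => /andP[uc cv]; rewrite /chord; apply: divr_ge0; last by lra.
  by apply: addr_ge0; apply: mulr_ge0; [lra|exact: hu0|lra|exact: hv0].
have : w * (d ^+ 2 / (v - u) * (sg * h c)) <= L (fun s => green u v c s * (sg * h s)).
  have hc0 : 0 <= sg * h c by exact: pos'.
  apply: hw; first by solve_cts.
  - move=> s _; have /andP[g0 _] := green_le s uv cuv.
    case: (boolP ((s <= u) || (v <= s))) => [?|]; first by rewrite green0// mul0r.
    by rewrite negb_or -!ltNge => /andP[? ?]; rewrite mulr_ge0// pos'// !ltW.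
  - by rewrite mulr_ge0// divr_ge0 ?exprn_ge0 ?ltW// subr_gt0.
  - move=> s sd; apply: ler_pM => //; last exact: hc.
      by rewrite divr_ge0 ?exprn_ge0 ?ltW// subr_gt0.
    by apply: green_ge => //; [exact: ltW|rewrite c1 c2].
rewrite mulrA => hLc E.
have : 0 < sg * h c.
  by apply: pos; rewrite /m in c1; apply/andP; split; lra.
by nra.
Qed.

End green_function.

(** * Eigenvalues from zeros *)

Section spectral_family.
Context {R : realType}.

(** A half-open grid cell of length [d] contains at most one point of [A], so the list grows by at
    most one entry per cell. *)
Lemma separated_finite (A : set R) (d : R) : 0 < d ->
  (forall t, A t -> 0 <= t) ->
  (forall t u, A t -> A u -> t < u -> d <= u - t) ->
  (exists M, forall t, A t -> t <= M) ->
  exists s : seq R, uniq s /\ forall t, t \in s <-> A t.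
Proof.
move=> d0 A0 Ad [M AM].
have fin n : exists s : seq R, uniq s /\ forall t, t \in s <-> (A t /\ t < n%:R * d).
  elim: n => [|n [s [us hs]]].
    exists [::]; split=> // t; split=> // -[/A0 t0]; rewrite mul0r => tn.
    by have := le_lt_trans t0 tn; rewrite ltxx.
  have [[t0 [At0 t0n]]|no] := pselect (exists t, A t /\ n%:R * d <= t < n.+1%:R * d); last first.
    exists s; split=> // t; rewrite hs; split=> -[At tn]; split=> //.
      by apply: lt_trans tn _; rewrite ltr_pM2r// ltr_nat.
    by rewrite ltNge; apply/negP => nt; apply: no; exists t; rewrite nt tn.
  exists (t0 :: s); split=> [|t].
    rewrite /= us andbT; apply/negP => /hs[_]; case/andP: t0n => h _.
    by rewrite ltNge h.
  rewrite inE; split=> [/orP[/eqP ->|/hs[At tn]]|[At tn]].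
  - by split=> //; case/andP: t0n.
  - by split=> //; apply: lt_trans tn _; rewrite ltr_pM2r// ltr_nat.
  - case: (ltP t (n%:R * d)) => nt; first by apply/orP; right; apply/hs.
    apply/orP; left; move: t0n tn; rewrite -natr1 mulrDl mul1r => /andP[t1 t2] t3.
    case: (ltgtP t t0) => // h.
      by have := Ad _ _ At At0 h; lra.
    by have := Ad _ _ At0 At h; lra.
have [s [us hs]] := fin (Num.bound (`|M| / d)).
exists s; split=> // t; rewrite hs; split=> [[]//|At]; split=> //.
rewrite -ltr_pdivrMr//; apply: le_lt_trans (archi_boundP _); last by rewrite divr_ge0// ltW.
by rewrite ler_pM2r ?invr_gt0// (le_trans (AM _ At))// ler_norm.
Qed.

Lemma uniform_radius (I : eqType) (s : seq I) (P : I -> R -> Prop) :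
  (forall i, i \in s -> exists2 e, 0 < e & P i e) ->
  (forall i e e', P i e -> e' <= e -> P i e') ->
  exists2 e, 0 < e & forall i, i \in s -> P i e.
Proof.
move=> hP mono; elim: s hP => [|i s ih] hP; first by exists 1.
have [|e e0 he] := ih; first by move=> j js; apply: hP; rewrite inE js orbT.
have [e' e'0 he'] := hP i (mem_head _ _).
exists (Num.min e e') => [|j]; first by rewrite lt_min e0.
rewrite inE => /predU1P[->|js].
  by apply: mono he' _; rewrite ge_min lexx orbT.
by apply: mono (he _ js) _; rewrite ge_min lexx.
Qed.

Context (T a b : R) (J E : (R -> R) -> R).
Hypothesis T0 : 0 < T.
Hypothesis Jp : positive_functional T J.
Hypothesis Ep : positive_functional T E.
Hypothesis ab : (a != 0) || (b != 0).

(** Only [J] is scaled by the spectral parameter; [E] is reserved for the atom that encodes the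
    boundary condition at 1. *)
Definition Lfam (lam : R) (f : R -> R) := lam * J f + E f.

Lemma Lfam_positive lam : 0 <= lam -> positive_functional T (Lfam lam).
Proof.
move=> lam0; split=> [f g cf cg|k f cf|f cf f0]; rewrite /Lfam.
- by rewrite (pfD Jp)// (pfD Ep)//; ring.
- by rewrite (pfZ Jp)// (pfZ Ep)//; ring.
- by rewrite addr_ge0// ?mulr_ge0// ?(pf_ge0 Jp)// (pf_ge0 Ep).
Qed.

Lemma mass_Lfam lam : mass (Lfam lam) = lam * mass J + mass E.
Proof. by []. Qed.

Variable psi : R -> R -> R.
Hypothesis psi_sol : forall lam, 0 <= lam -> solution T (Lfam lam) a b (psi lam).
Hypothesis psi0 : forall t, 0 < t < T -> psi 0 t != 0.
#[local] Hint Resolve ramp_cts : cts.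

Let psi_cts lam : 0 <= lam -> cts (psi lam).
Proof. by move=> /psi_sol[]. Qed.

(** The difference of two solutions satisfies a Volterra inequality whose error term is proportional
    to the difference of the parameters; [gronwall] concludes, with mass bound and sup bound uniform
    up to [X]. *)
Lemma psi_lipschitz X : 0 <= X -> exists2 C, 0 <= C &
  forall lam lam' t, 0 <= lam <= X -> 0 <= lam' <= X -> 0 <= t <= T ->
    `|psi lam t - psi lam' t| <= C * `|lam - lam'|.
Proof.
move=> X0; have T0' := ltW T0; have mJ := mass_ge0 Jp; have mE := mass_ge0 Ep.
pose Y := X * mass J + mass E + 1.
have Y0 : 0 < Y by rewrite /Y ltr_wpDl// addr_ge0// mulr_ge0.
have mY lam : 0 <= lam <= X -> mass (Lfam lam) <= Y.
  move=> /andP[l0 lX]; rewrite mass_Lfam /Y -addrA lerD ?ler_wpM2r//.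
  by rewrite lerDl.
pose B := 2 * (`|a| + `|b| * T) * expR (2 * Y * T).
have B0 : 0 <= B by rewrite /B !mulr_ge0// ?expR_ge0// addr_ge0// mulr_ge0// ltW.
have hB lam t : 0 <= lam <= X -> 0 <= t <= T -> `|psi lam t| <= B.
  move=> lX; have l0 : 0 <= lam by case/andP: lX.
  exact: (solution_bound (Lfam_positive l0) T0' Y0 (mY _ lX) (psi_sol l0)).
clearbody B.
exists (2 * (T * B * mass J) * expR (2 * Y * T)).
  by apply: mulr_ge0 (expR_ge0 _); rewrite !mulr_ge0.
move=> lam lam' t lX l'X; have [l0 l'0] : 0 <= lam /\ 0 <= lam' by split; lra.
have Lp := Lfam_positive l0.
have c1 := psi_cts l0; have c2 := psi_cts l'0.
have -> : 2 * (T * B * mass J) * expR (2 * Y * T) * `|lam - lam'| =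
   2 * (`|lam - lam'| * (T * B * mass J)) * expR (2 * Y * T) by ring.
move: t; apply: (gronwall Lp) => //.
- exact: mY.
- by rewrite !mulr_ge0.
- by solve_cts.
move=> t tT; rewrite (psi_sol l0).2// (psi_sol l'0).2//.
have -> : a + b * t - Lfam lam (fun s => ramp t s * psi lam s) -
    (a + b * t - Lfam lam' (fun s => ramp t s * psi lam' s)) =
    - Lfam lam (fun s => ramp t s * (psi lam s - psi lam' s)) -
      (lam - lam') * J (fun s => ramp t s * psi lam' s).
  have -> : (fun s => ramp t s * (psi lam s - psi lam' s)) =
    (fun s => ramp t s * psi lam s - ramp t s * psi lam' s).
    by apply/funext => s; rewrite mulrBr.
  by rewrite (pfB Lp); [rewrite /Lfam; ring|solve_cts..].
rewrite addrC; apply: le_trans (ler_normB _ _) _; apply: lerD.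
  rewrite normrN normrM ler_wpM2l//.
  apply: (pf_le_mass Jp); first by solve_cts.
  move=> s sT; rewrite normrM ger0_norm ?ramp_ge0// ler_pM ?ramp_ge0//.
    by apply: le_trans (ramp_le _ _) _; [lra|rewrite ger0_norm; lra].
  exact: hB.
apply: le_trans (pf_norm Lp _) _; first by solve_cts.
apply: (pf_le Lp); [by solve_cts..|move=> s _].
by rewrite normrM ger0_norm// ramp_ge0.
Qed.

Definition zero_at lam t := psi lam t = 0.

Lemma psi_separated X : 0 <= X -> exists2 d, 0 < d &
  forall lam u v, 0 <= lam <= X -> 0 <= u -> u < v -> v <= T ->
    zero_at lam u -> zero_at lam v -> d <= v - u.
Proof.
move=> X0; have mJ := mass_ge0 Jp; have mE := mass_ge0 Ep.
pose Y := X * mass J + mass E + 1.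
have Y0 : 0 < Y by rewrite /Y ltr_wpDl// addr_ge0// mulr_ge0.
exists Y^-1; first by rewrite invr_gt0.
move=> lam u v /andP[l0 lX] u0 uv vT zu zv.
have := zeros_separated (Lfam_positive l0) (psi_sol l0) ab u0 uv vT zu zv.
rewrite mass_Lfam => h; rewrite -[_^-1]mul1r ler_pdivrMr//; apply: le_trans h _.
rewrite ler_wpM2l ?subr_ge0 ?(ltW uv)// /Y -addrA lerD ?ler_wpM2r//.
by rewrite lerDl.
Qed.

(** Means at least [k] zeros, not exactly [k], so that it is monotone in [k]. *)
Definition zcount lam k := exists s : seq R,
  [/\ uniq s, size s = k & forall t, t \in s -> 0 < t < T /\ zero_at lam t].

Lemma zcount_le lam k j : (j <= k)%N -> zcount lam k -> zcount lam j.
Proof.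
move=> jk [s [us sk hs]]; exists (take j s); split.
- exact: take_uniq.
- by rewrite size_take sk; case: ltngtP jk => // -> .
- by move=> t /mem_take; exact: hs.
Qed.

(** A zero is a sign change by [zero_sign_change], and strict signs at two points survive a small
    change of the parameter. Each new zero lies within [d / 2] of the old one while the old ones are
    [d] apart, so distinct zeros stay distinct. *)
Lemma zcount_open lam k : 0 <= lam -> zcount lam k -> exists2 e, 0 < e &
  forall lam', 0 <= lam' -> `|lam' - lam| < e -> zcount lam' k.
Proof.
move=> l0 [s [us sk hs]].
have l1 : 0 <= lam + 1 by lra.
have [d d0 hd] := psi_separated l1; have [C C0 hC] := psi_lipschitz l1.
pose P z e := forall lam', 0 <= lam' -> `|lam' - lam| < e ->
  exists z', [/\ `|z' - z| < d / 2, 0 < z' < T & zero_at lam' z'].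
have lip lam' t : 0 <= lam' -> `|lam' - lam| < 1 -> 0 <= t <= T ->
    `|psi lam' t - psi lam t| <= C * `|lam' - lam|.
  rewrite ltr_norml => l'0 /andP[h1 h2] tT.
  by apply: hC => //; apply/andP; split; lra.
have [z zs|z e e' h ee' lam' l'0 hl'|e e0 he] := @uniform_radius _ s P.
- have [zT hz] := hs _ zs; have [z0 zT'] := andP zT.
  pose r := Num.min (d / 2) (Num.min z (T - z)).
  have r0 : 0 < r by rewrite !lt_min divr_gt0// z0 subr_gt0.
  have [r1 r2 r3] : [/\ r <= d / 2, r <= z & r <= T - z].
    by split; rewrite /r !ge_min lexx ?orbT.
  have [l [u [zl lz zu uz hlu]]] :=
    zero_sign_change (Lfam_positive l0) (psi_sol l0) ab zT hz r0.
  pose m := Num.min `|psi lam l| `|psi lam u|.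
  have hl0 : psi lam l != 0 by apply/eqP => h; move: hlu; rewrite h mul0r ltxx.
  have hu0 : psi lam u != 0 by apply/eqP => h; move: hlu; rewrite h mulr0 ltxx.
  have m0 : 0 < m by rewrite lt_min !normr_gt0 hl0.
  exists (Num.min 1 (m / (C + 1))).
    by rewrite lt_min ltr01 divr_gt0// ltr_wpDl.
  move=> lam' l'0; rewrite lt_min => /andP[h1 h2].
  have dm t : 0 <= t <= T -> `|psi lam' t - psi lam t| < m.
    move=> tT; apply: le_lt_trans (lip _ _ l'0 h1 tT) _.
    move: h2; rewrite ltr_pdivlMr ?ltr_wpDl// => h2.
    apply: le_lt_trans h2; rewrite mulrC ler_wpM2l//; lra.
  have lT : 0 <= l <= T by apply/andP; split; lra.
  have uT : 0 <= u <= T by apply/andP; split; lra.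
  have sg t : 0 <= t <= T -> m <= `|psi lam t| -> 0 < psi lam' t * psi lam t.
    move=> tT mt; have := dm _ tT; rewrite ltr_norml => /andP[q1 q2].
    move: mt; case: (ger0P (psi lam t)) => p mt.
      by rewrite mulr_gt0//; lra.
    by rewrite nmulr_lgt0//; lra.
  have sl : 0 < psi lam' l * psi lam l by apply: sg => //; rewrite /m ge_min lexx.
  have su : 0 < psi lam' u * psi lam u by apply: sg => //; rewrite /m ge_min lexx orbT.
  have lu : l <= u by lra.
  have [|z' /andP[z'1 z'2] hz'] := IVT_zero lu (psi_cts l'0).
    rewrite leNgt; apply/negP => p.
    have : 0 < (psi lam' l * psi lam l) * (psi lam' u * psi lam u) by exact: mulr_gt0.
    by rewrite mulrACA pmulr_rgt0// ltNge ltW.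
  exists z'; split=> //; last by apply/andP; split; lra.
  by rewrite ltr_norml; apply/andP; split; lra.
- by apply: h => //; exact: lt_le_trans ee'.
- exists (Num.min e 1) => [|lam' l'0]; first by rewrite lt_min e0 ltr01.
  rewrite lt_min => /andP[h1 h2].
  have /choice[f hf] (z : R) : exists z', z \in s ->
      [/\ `|z' - z| < d / 2, 0 < z' < T & zero_at lam' z'].
    have [zs|zs] := boolP (z \in s); last by exists 0.
    by have [z' hz'] := he z zs lam' l'0 h1; exists z'.
  exists (map f s); split=> [||_ /mapP[z zs ->]].
  - rewrite map_inj_in_uniq// => z z' zs z's fz.
    have [q1 _ _] := hf _ zs; have [q2 _ _] := hf _ z's.
    have [/andP[p0 p1] p2] := hs _ zs; have [/andP[p'0 p'1] p'2] := hs _ z's.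
    rewrite fz in q1; move: q1 q2; rewrite !ltr_norml => /andP[? ?] /andP[? ?].
    have lX : 0 <= lam <= lam + 1 by apply/andP; split; lra.
    case: (ltgtP z z') => // h.
      by have := hd _ _ _ lX (ltW p0) h (ltW p'1) p2 p'2; lra.
    by have := hd _ _ _ lX (ltW p'0) h (ltW p1) p'2 p2; lra.
  - by rewrite size_map.
  - by have [_ ? ?] := hf _ zs.
Qed.

Lemma psi_at0 lam : 0 <= lam -> psi lam 0 = a.
Proof.
move=> l0; rewrite (psi_sol l0).2 ?lexx ?(ltW T0)//.
have := psi_cts l0 => ?.
rewrite (pf_eq (Lfam_positive l0) (g := fun=> 0)); [|by solve_cts|exact: cts_cst|].
  by rewrite (pf_cst (Lfam_positive l0)); ring.
by move=> s /andP[s0 _]; rewrite /ramp sub0r max_r ?mul0r// oppr_le0.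
Qed.

Lemma zcount_closed lam : 0 <= lam -> exists s0 : seq R,
  [/\ uniq s0, forall t, t \in s0 -> 0 < t <= T /\ zero_at lam t &
   exists2 e, 0 < e & forall lam' k, 0 <= lam' -> `|lam' - lam| < e ->
     zcount lam' k -> (k <= size s0)%N].
Proof.
move=> l0; have l1 : 0 <= lam + 1 by lra.
have [d d0 hd] := psi_separated l1; have [C C0 hC] := psi_lipschitz l1.
have lX : 0 <= lam <= lam + 1 by apply/andP; split; lra.
have [|||z [uz hz]] := @separated_finite [set t | 0 <= t <= T /\ zero_at lam t] d d0.
- by move=> t [/andP[]].
- move=> t u [/andP[t0 _] zt] [/andP[_ uT] zu] tu.
  exact: (hd _ _ _ lX t0 tu uT zt zu).
- by exists T => t [/andP[]].
(* The tents around the zeros make [G] positive on [[0, T]]. Away from the tents [G] is the norm of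
   [psi lam], so its minimum tells how much the parameter must change before a zero can appear
   there. *)
pose G t := `|psi lam t| + \sum_(x <- z) Num.max 0 (d / 2 - `|t - x|).
have cG : cts G.
  apply: ctsD; first exact/cts_norm/psi_cts.
  by apply: cts_sum => x; solve_cts.
have S0 t : 0 <= \sum_(x <- z) Num.max 0 (d / 2 - `|t - x|).
  by apply: sumr_ge0 => x _; rewrite le_max lexx.
have [c cT hc] := EVT_min_cts (ltW T0) cG.
have Gc : 0 < G c.
  have [zc|nzc] := pselect (zero_at lam c); last first.
    by rewrite /G ltr_wpDr// normr_gt0; apply/eqP.
  have cz : c \in z by apply/hz.
  rewrite /G ltr_wpDl// (bigD1_seq c)//= ltr_wpDr//.
    by apply: sumr_ge0 => x _; rewrite le_max lexx.
  by rewrite subrr normr0 subr0 lt_max divr_gt0// orbT.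
exists [seq t <- z | 0 < t]; split.
- exact: filter_uniq.
- by move=> t; rewrite mem_filter => /andP[t0 /hz[/andP[_ tT] zt]]; rewrite t0 tT.
exists (Num.min 1 (G c / (C + 1))).
  by rewrite lt_min ltr01 divr_gt0// ltr_wpDl.
move=> lam' k l'0; rewrite lt_min => /andP[h1 h2] [s [us <- hs]].
have l'X : 0 <= lam' <= lam + 1.
  by move: h1; rewrite ltr_norml => /andP[? ?]; apply/andP; split; lra.
have /choice[f hf] (t : R) : exists x, t \in s -> x \in z /\ `|t - x| < d / 2.
  have [ts|ts] := boolP (t \in s); last by exists 0.
  have [/andP[t0 tT] zt] := hs _ ts.
  apply: contrapT => no; have nx x : x \in z -> d / 2 <= `|t - x|.
    by move=> xz; rewrite leNgt; apply/negP => xd; apply: no; exists x.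
  have tT' : 0 <= t <= T by rewrite !ltW.
  have := hc _ tT'; rewrite leNgt => /negP; apply.
  have -> : G t = `|psi lam t|.
    rewrite /G big1_seq ?addr0// => x /andP[_ /nx xd].
    by rewrite max_l// subr_le0.
  have := hC _ _ _ lX l'X tT'; rewrite zt subr0 => h.
  have C1 : 0 < C + 1 by rewrite ltr_wpDl.
  apply: le_lt_trans h _; move: h2; rewrite ltr_pdivlMr// distrC => h2.
  by apply: le_lt_trans h2; rewrite mulrC ler_wpM2l//; lra.
rewrite -(size_map f); apply: uniq_leq_size.
  rewrite map_inj_in_uniq// => t t' ts t's ft.
  have [_ q1] := hf _ ts; have [_ q2] := hf _ t's.
  have [/andP[p0 p1] p2] := hs _ ts; have [/andP[p'0 p'1] p'2] := hs _ t's.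
  rewrite ft in q1; move: q1 q2; rewrite !ltr_norml => /andP[? ?] /andP[? ?].
  case: (ltgtP t t') => // h.
    by have := hd _ _ _ l'X (ltW p0) h (ltW p'1) p2 p'2; lra.
  by have := hd _ _ _ l'X (ltW p'0) h (ltW p1) p'2 p2; lra.
move=> _ /mapP[t ts ->]; have [fz ftd] := hf _ ts.
rewrite mem_filter fz andbT; have [/andP[f0 _] zf] := (hz _).1 fz.
rewrite lt0r f0 andbT; apply/eqP => ft0.
have [/andP[t0 tT] zt] := hs _ ts.
(* At 0 every [psi] has the value [a], so a zero at 0 is present for [lam'] too, and [t] would be
   too close to it. This keeps 0 out of [s0]. *)
have z0 : zero_at lam' 0.
  by move: zf; rewrite /zero_at ft0 !psi_at0.
have := hd _ _ _ l'X (lexx _) t0 (ltW tT) z0 zt.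
by move: ftd; rewrite ft0 subr0 gtr0_norm//; lra.
Qed.

(* Let [lam_k] be the infimum of the parameters whose solution has [k] zeros in
   (0, T).  Zeros move continuously with the parameter and stay separated, so at
   [lam_k] the [k]-th zero is just entering through [T]. *)
Lemma zeros_give_eigenvalues x n : 0 <= x -> zcount x n ->
  exists s : seq R, [/\ uniq s, size s = n &
    forall lam, lam \in s -> 0 <= lam <= x /\ psi lam T = 0].
Proof.
move=> x0 xn.
have ev (k : nat) : exists lam : R, (0 < k <= n)%N ->
    [/\ 0 <= lam <= x, psi lam T = 0, zcount lam k.-1 & ~ zcount lam k].
  have [/andP[k0 kn]|_] := boolP (0 < k <= n)%N; last by exists 0.
  pose A := [set lam | 0 <= lam <= x /\ zcount lam k].
  have Ax : A x by split; [rewrite x0 lexx|exact: zcount_le xn].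
  have iA : has_inf A by split; [exists x|exists 0 => y [/andP[]]].
  pose l := inf A.
  have l0 : 0 <= l by apply: lb_le_inf; [exists x|move=> y [/andP[]]].
  have lx : l <= x by apply: ge_inf => //; exact: iA.2.
  have nz : ~ zcount l k.
    move=> zl; have [e e0 he] := zcount_open l0 zl.
    (* At [l = 0] there is no room to the left, but [psi0] excludes zeros; otherwise openness puts a
       smaller parameter into [A]. *)
    move: l0; rewrite le_eqVlt => /predU1P[l00|l0].
      have [s [_ sk hs]] := zl; rewrite -l00 in hs.
      case: s sk hs => [|t s] sk hs; first by rewrite -sk in k0.
      have [tT zt] := hs t (mem_head _ _).
      by have := psi0 tT; rewrite zt eqxx.
    pose m := Num.min (e / 2) l.
    have m0 : 0 < m by rewrite lt_min divr_gt0.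
    have [m1 m2] : m <= e / 2 /\ m <= l by split; rewrite /m ge_min lexx ?orbT.
    have : A (l - m).
      split; first by apply/andP; split; lra.
      apply: he; first by lra.
      by rewrite addrAC subrr sub0r normrN gtr0_norm//; lra.
    by move=> /(ge_inf iA.2); rewrite -/l; lra.
  have [s0 [us0 hs0 [e e0 he]]] := zcount_closed l0.
  have [lam' [/andP[l'0 l'x] zl'] l'e] := inf_adherent e0 iA.
  have ll' : l <= lam' by apply: ge_inf; [exact: iA.2|split=> //; rewrite l'0].
  have ks0 : (k <= size s0)%N.
    by apply: he zl' => //; rewrite ger0_norm; rewrite -/l in l'e; lra.
  (* If [T] were not a zero, the at least [k] zeros in [s0] would all be interior, against [nz]. *)
  have Ts0 : T \in s0.
    apply/negPn/negP => nT; apply: nz; apply: (zcount_le ks0).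
    exists s0; split=> // t ts; have [/andP[t0 tT] zt] := hs0 _ ts.
    split=> //; rewrite t0 lt_neqAle tT andbT; apply/eqP => tTe.
    by move: nT; rewrite -tTe ts.
  exists l => _; split=> //; first by rewrite l0.
    by have [] := hs0 _ Ts0.
  (* Removing [T] leaves at least [k - 1] interior zeros; this is what tells the parameters for
     different [k] apart. *)
  apply: (@zcount_le _ (size (rem T s0))).
    by rewrite size_rem// -!subn1 leq_sub2r.
  exists (rem T s0); split=> //; first exact: rem_uniq.
  move=> t; rewrite mem_rem_uniq// inE => /andP[tT ts].
  have [/andP[t0 tT'] zt] := hs0 _ ts.
  by split=> //; rewrite t0 lt_neqAle tT.
have /choice[l hl] := ev.
exists (map l (iota 1 n)); split; last 2 first.
- by rewrite size_map size_iota.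
- move=> lam /mapP[k]; rewrite mem_iota add1n ltnS => kn ->.
  by have [? ? _ _] := hl _ kn.
(* For [j < k] the parameter [l k] has at least [k - 1 >= j] interior zeros, whereas [l j] has fewer
   than [j]. *)
have lt_neq j k : (0 < j)%N -> (j < k)%N -> (k <= n)%N -> l j <> l k.
  move=> j0 jk kn e.
  have [|_ _ _ h1] := hl j; first by rewrite j0 (leq_trans (ltnW jk)).
  have [|_ _ h2 _] := hl k; first by rewrite kn (leq_trans _ jk).
  by apply: h1; rewrite e; apply: zcount_le h2; rewrite -ltnS (ltn_predK jk).
rewrite map_inj_in_uniq ?iota_uniq// => j k.
rewrite !mem_iota !add1n !ltnS => /andP[j0 jn] /andP[k0 kn] e.
case: (ltngtP j k) => // h; exfalso; [exact: lt_neq e|exact: lt_neq (esym e)].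
Qed.

End spectral_family.

(** * Integration against a probability measure on the unit interval *)

Section integral_functional.
Context {R : realType} (eta : probability R R).
Implicit Types (f g : R -> R) (D : set R).

Definition Jint D f : R := \int[eta]_(s in D) f s.

Local Notation I01 := (`[0, 1]%classic : set R).
Local Notation J := (Jint I01).

Lemma cts_measurable D f : cts f -> measurable_fun D f.
Proof. by move=> cf; apply: measurable_funTS; exact: continuous_measurable_fun. Qed.

Lemma cts_integrable D f : measurable D -> D `<=` I01 -> cts f ->
  eta.-integrable D (EFin \o f).
Proof.
move=> mD D01 cf; apply: measurable_bounded_integrable => //.
- by apply: le_lt_trans (probability_le1 eta mD) _; rewrite ltry.
- exact: cts_measurable.
have [c _ hc] := EVT_max_cts (@ler01 R) (cts_norm cf).
exists `|f c|; split; first by rewrite num_real.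
move=> M cM x /D01 /=; rewrite in_itv/= => x01.
by apply: le_trans (hc _ x01) _; exact: ltW.
Qed.
#[local] Hint Resolve cts_integrable : core.

Section on_subset.
Variable D : set R.
Hypotheses (mD : measurable D) (D01 : D `<=` I01).

Lemma JintD f g : cts f -> cts g ->
  Jint D (fun s => f s + g s) = Jint D f + Jint D g.
Proof. by move=> cf cg; rewrite /Jint RintegralD//; exact: cts_integrable. Qed.

Lemma JintZ k f : cts f -> Jint D (fun s => k * f s) = k * Jint D f.
Proof. by move=> cf; rewrite /Jint RintegralZl//; exact: cts_integrable. Qed.

Lemma Jint_ge0 f : (forall s, D s -> 0 <= f s) -> 0 <= Jint D f.
Proof. by move=> f0; exact: Rintegral_ge0. Qed.

Lemma Jint_le f g : cts f -> cts g -> (forall s, D s -> f s <= g s) ->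
  Jint D f <= Jint D g.
Proof. by move=> cf cg fg; apply: le_Rintegral => //; exact: cts_integrable. Qed.

Lemma Jint_eq f g : (forall s, D s -> f s = g s) -> Jint D f = Jint D g.
Proof. by move=> fg; apply: eq_Rintegral => x /set_mem/fg. Qed.

Lemma Jint_cst k : Jint D (fun=> k) = k * fine (eta D).
Proof. by rewrite /Jint Rintegral_cst. Qed.

End on_subset.

Lemma Jint_setU A B f : measurable A -> measurable B -> A `<=` I01 -> B `<=` I01 ->
  [disjoint A & B] -> cts f -> Jint (A `|` B) f = Jint A f + Jint B f.
Proof.
move=> mA mB A01 B01 AB cf; rewrite /Jint Rintegral_setU//.
by apply: cts_integrable => //; [exact: measurableU|rewrite subUset].
Qed.

Lemma Jint_subset A B f : measurable A -> measurable B -> A `<=` B -> B `<=` I01 ->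
  cts f -> (forall s, B s -> 0 <= f s) -> Jint A f <= Jint B f.
Proof.
move=> mA mB AB B01 cf f0.
have mBA : measurable (B `\` A) by exact: measurableD.
rewrite -(setDUK AB) Jint_setU//.
- by rewrite lerDl; apply: Jint_ge0 => s [/f0].
- exact: subset_trans B01.
- by move=> x [/B01].
- by rewrite disj_set2E setDIK.
Qed.

Lemma J_positive T : 1 <= T -> positive_functional T J.
Proof.
move=> T1; split=> [f g cf cg|k f cf|f cf f0].
- exact: JintD.
- exact: JintZ.
- apply: Jint_ge0 => s; rewrite /= in_itv/= => /andP[s0 s1]; apply: f0.
  by rewrite s0 (le_trans s1).
Qed.

(** Supplies the assumption on [w] in [zero_exists], with [w] the mass of a closed interval. *)
Lemma J_ge_mass g k p q : 0 <= p -> q <= 1 -> cts g ->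
  (forall s, 0 <= s <= 1 -> 0 <= g s) -> 0 <= k ->
  (forall s, p <= s <= q -> k <= g s) ->
  fine (eta `[p, q]%classic) * k <= J g.
Proof.
move=> p0 q1 cg g0 k0 gk.
have pq : `[p, q]%classic `<=` I01.
  by move=> x /=; rewrite !in_itv/= => /andP[? ?]; apply/andP; split; lra.
apply: (@le_trans _ _ (Jint `[p, q]%classic g)).
  rewrite mulrC -Jint_cst//; apply: Jint_le => //; exact: cts_cst.
exact: Jint_subset.
Qed.

Lemma J_mass : eta I01 = 1%E -> mass J = 1.
Proof. by move=> e1; rewrite /mass Jint_cst// e1 mul1r. Qed.

(** Fubini, applied to [f] and [g] cut off outside [[0, 1]] so that the integrand is bounded on the
    whole plane. It is the integration by parts behind Lagrange's identity. *)
Lemma ramp_swap f g : cts f -> cts g ->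
  J (fun t => g t * J (fun s => ramp t s * f s)) =
  J (fun s => f s * J (fun t => ramp t s * g t)).
Proof.
move=> cf cg.
pose H (z : R * R) : R := (g \_ I01) z.1 * (Num.max (z.1 - z.2) 0 * (f \_ I01) z.2).
have mI h : cts h -> measurable_fun setT (h \_ I01).
  move=> ch; apply/(measurable_restrictT _ _).1 => //.
  exact: cts_measurable.
have mH : measurable_fun setT H.
  apply: measurable_funM; first by apply: measurableT_comp => //; exact: mI.
  apply: measurable_funM; last by apply: measurableT_comp => //; exact: mI.
  by apply: measurable_maxr => //; apply: measurable_funB.
have [Mf Mf0 hf] : exists2 M, 0 <= M & forall x, `|(f \_ I01) x| <= M.
  have [c _ hc] := EVT_max_cts (@ler01 R) (cts_norm cf).
  exists `|f c| => // x; rewrite patchE; case: ifPn => [/set_mem|_]; last by rewrite normr0.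
  by rewrite /= in_itv/= => /hc.
have [Mg Mg0 hg] : exists2 M, 0 <= M & forall x, `|(g \_ I01) x| <= M.
  have [c _ hc] := EVT_max_cts (@ler01 R) (cts_norm cg).
  exists `|g c| => // x; rewrite patchE; case: ifPn => [/set_mem|_]; last by rewrite normr0.
  by rewrite /= in_itv/= => /hc.
have iH : (eta \x eta)%E.-integrable setT (EFin \o H).
  apply: measurable_bounded_integrable => //.
    have e1 : (eta \x eta)%E [set: R * R] = 1%E.
      rewrite -setXTT product_measure1E//.
      by have := probability_setT eta => /= ->; rewrite mule1.
    apply: (@le_lt_trans _ _ 1%E); last exact: ltry.
    by rewrite -e1.
  exists (Mg * (1 * Mf)); split; first by rewrite num_real.
  move=> M hM [x y] _ /=; apply: le_trans (ltW hM).
  rewrite /H /= !patchE; case: ifPn => [/set_mem|_]; last first.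
    by rewrite mul0r normr0 !mulr_ge0.
  rewrite /= in_itv/= => x01; case: ifPn => [/set_mem|_]; last first.
    by rewrite !mulr0 normr0 !mulr_ge0.
  rewrite /= in_itv/= => y01; rewrite !normrM ler_pM//.
  - by have := hg x; rewrite patchE mem_set//= in_itv.
  - rewrite ler_pM//.
      rewrite ger0_norm ?le_max ?lexx ?orbT// ge_max ler01 andbT.
      by move: x01 y01 => /andP[? ?] /andP[? ?]; lra.
    by have := hf y; rewrite patchE mem_set//= in_itv.
have innerE k h c : cts h -> cts k ->
    (c * J (fun s => k s * h s))%:E = (\int[eta]_s (c * (k s * (h \_ I01) s))%:E)%E.
  move=> ch ck.
  have iI : eta.-integrable I01 (EFin \o (fun s => k s * h s)).
    by apply: cts_integrable => //; exact: ctsM.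
  rewrite EFinM /Jint /Rintegral fineK; last exact: integrable_fin_num.
  rewrite -integralZl// integral_mkcond; apply: eq_integral => s _.
  rewrite !patchE; case: ifP => _; first by rewrite !EFinM.
  by rewrite !mulr0.
have := Fubini iH; rewrite /= => FH.
rewrite /Jint /Rintegral; congr fine.
rewrite integral_mkcond [RHS]integral_mkcond.
transitivity (\int[eta]_x (\int[eta]_y (H (x, y))%:E))%E.
  apply: eq_integral => x _; rewrite patchE; case: ifPn => xI.
    rewrite -[LHS]/((g x * J (fun s => ramp x s * f s))%:E) innerE//; last exact: ramp_cts.
    apply: eq_integral => y _; rewrite /H /= [in RHS]patchE xI.
    by rewrite /ramp.
  rewrite [LHS](_ : _ = 0%E)//; apply/esym/integral0_eq => y _.
  by rewrite /H /= patchE (negPf xI) mul0r.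
rewrite FH; apply: eq_integral => y _; rewrite patchE; case: ifPn => yI.
  have cr : cts (fun t => ramp t y) by rewrite /ramp; solve_cts.
  rewrite -[RHS]/((f y * J (fun t => ramp t y * g t))%:E) innerE//.
  have fE : (f \_ I01) y = f y by rewrite patchE yI.
  apply: eq_integral => x _; rewrite /H /= fE /ramp.
  by congr EFin; ring.
rewrite [RHS](_ : _ = 0%E)//; apply: integral0_eq => x _.
have fE : (f \_ I01) y = 0 by rewrite patchE (negPf yI).
by rewrite /H /= fE !mulr0.
Qed.

End integral_functional.

Lemma JintE (R : realType) (eta : probability R R) D f :
  Jint eta D f = \int[eta]_(s in D) f s.
Proof. by []. Qed.

#[global] Opaque Jint.

(** * The string eigenvalue problem *)

Section string_eigenproblem.
Context {R : realType} (eta : probability R R).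
Local Notation I01 := (`[0, 1]%classic : set R).
Local Notation J := (Jint eta I01).
Hypothesis J1 : mass J = 1.

(** To be instantiated by [sin alpha], [cos alpha], [cos beta], [sin beta]: the condition at 0 says
    that value and slope are proportional to [(a, b)]. *)
Variables a b cb sb : R.
Hypotheses (a0 : 0 <= a) (b0 : 0 <= b) (ab : (a != 0) || (b != 0)).
Hypotheses (cb0 : 0 <= cb) (cb1 : cb <= 1) (sb0 : 0 <= sb).
Hypotheses (csb : 0 < cb + sb) (sb_eq0 : sb = 0 -> cb = 1).
#[local] Hint Resolve ramp_cts : cts.

Let ab_gt0 : 0 < a + b.
Proof.
rewrite lt0r addr_ge0// andbT paddr_eq0//.
by move: ab; case: eqP => //= _ ->.
Qed.

Ltac bc_hyps := have ? := a0; have ? := b0; have ? := cb0; have ? := cb1;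
  have ? := sb0; have ? := csb; have ? := ab_gt0.

(* The condition at [0] is built into the initial data [(a, b)]; the slope of [h]
   at [1] is [b - lam * J h]. *)
Definition string_eigenfun (lam : R) (h : R -> R) : Prop :=
  [/\ cts h,
      forall t, 0 <= t <= 1 -> h t = a + b * t - lam * J (fun s => ramp t s * h s) &
      h 1 * cb + (b - lam * J h) * sb = 0].

Definition string_eigenvalue lam := exists h, string_eigenfun lam h.

Let Jp := J_positive eta (lexx (1 : R)).

Let ramp01 (t s : R) : 0 <= s -> t <= 1 -> `|ramp t s| <= 1.
Proof.
move=> s0 t1; rewrite ger0_norm ?ramp_ge0// /ramp ge_max ler01 andbT; lra.
Qed.

Let rampC (s t : R) : ramp s t = ramp t s - (t - s).
Proof.
by rewrite /ramp; case: (lerP (s - t) 0) => ?; case: (lerP (t - s) 0) => ?; lra.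
Qed.

(** For [lam < 0] the Volterra term has a positive sign, so the negative part of [h] vanishes by
    [gronwall0] and [h] stays above [a + b * t]. Value and slope at 1 are then nonnegative, and the
    condition at 1 forces [cb = 0], [b = 0] and a zero slope, which contradicts [J h >= a > 0]. *)
Lemma string_eigen_ge0 lam h : string_eigenfun lam h -> 0 <= lam.
Proof.
bc_hyps; move=> [ch eh bc]; rewrite leNgt; apply/negP => l0.
have nl0 : 0 <= - lam by lra.
pose L f := - lam * J f.
have Lp : positive_functional 1 L.
  split=> [f g cf cg|k f cf|f cf f0]; rewrite /L.
  - by rewrite (pfD Jp)//; ring.
  - by rewrite (pfZ Jp)//; ring.
  - by rewrite mulr_ge0// (pf_ge0 Jp).
have neg0 : forall t, 0 <= t <= 1 -> Num.max (- h t) 0 = 0.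
  apply: (gronwall0 Lp) => //; first by solve_cts.
  move=> t tT; have [t0 t1] := andP tT.
  have L0 : 0 <= L (fun s => ramp t s * `|Num.max (- h s) 0|).
    by apply: (pf_ge0 Lp) => [|s _]; [solve_cts|rewrite mulr_ge0// ramp_ge0].
  rewrite ger0_norm ?le_max ?lexx ?orbT// ge_max L0 andbT eh//.
  have : L (fun s => ramp t s * - h s) <= L (fun s => ramp t s * `|Num.max (- h s) 0|).
    apply: (pf_le Lp); [by solve_cts..|move=> s _].
    rewrite ler_wpM2l ?ramp_ge0//; apply: le_trans (ler_norm _).
    by rewrite le_max lexx.
  have -> : L (fun s => ramp t s * - h s) = lam * J (fun s => ramp t s * h s).
    rewrite /L (_ : (fun s => ramp t s * - h s) = fun s => - (ramp t s * h s)).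
      by rewrite (pfN Jp); [ring|solve_cts].
    by apply/funext => s; rewrite mulrN.
  by move=> le_L; apply: le_trans le_L; rewrite opprB gerBl addr_ge0// mulr_ge0.
have h0 t : 0 <= t <= 1 -> 0 <= h t.
  by move=> /neg0 e; rewrite -oppr_le0 -e le_max lexx.
have hab t : 0 <= t <= 1 -> a + b * t <= h t.
  move=> tT; rewrite eh//; have : 0 <= J (fun s => ramp t s * h s).
    by apply: (pf_ge0 Jp) => [|s sT]; [solve_cts|rewrite mulr_ge0 ?ramp_ge0// h0].
  by nra.
have Jh0 : 0 <= J h by exact: (pf_ge0 Jp).
have h1 : a + b <= h 1 by have := hab 1; rewrite ler01 lexx mulr1 => /(_ isT).
have p1 : 0 <= (b - lam * J h) * sb by rewrite mulr_ge0//; nra.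
have p2 : 0 <= (h 1 - (a + b)) * cb by rewrite mulr_ge0//; lra.
have p3 : 0 <= (a + b) * cb by rewrite mulr_ge0// ltW.
have cb_0 : cb = 0.
  have /eqP : (a + b) * cb = 0 by lra.
  by rewrite mulf_eq0 gt_eqF//= => /eqP.
have sb_gt0 : 0 < sb by lra.
have /eqP : (b - lam * J h) * sb = 0 by lra.
rewrite mulf_eq0 (gt_eqF sb_gt0) orbF => /eqP p4.
have p5 : 0 <= - lam * J h by rewrite mulr_ge0.
have b_0 : b = 0 by lra.
have Jha : a <= J h.
  have -> : a = J (fun=> a) by rewrite (pf_cst Jp) J1 mulr1.
  apply: (pf_le Jp); [exact: cts_cst|by []|move=> s /hab].
  by rewrite b_0 mul0r addr0.
by have : 0 < - lam * J h; [rewrite mulr_gt0//; lra|lra].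
Qed.

(** If the norm vanishes, [J] kills every continuous function dominated by [h], so [h] is affine on
    [[0, 1]]. The condition at 1 then leaves only the constant [a], whose norm is not zero. *)
Lemma string_eigen_norm_gt0 lam h : string_eigenfun lam h -> 0 < J (fun s => h s * h s).
Proof.
bc_hyps; move=> [ch eh bc].
have h20 : 0 <= J (fun s => h s * h s).
  by apply: (pf_ge0 Jp) => [|s _]; [solve_cts|rewrite -expr2 sqr_ge0].
rewrite lt0r h20 andbT; apply/eqP => h2.
have Jabs : J (fun s => `|h s|) = 0.
  apply/eqP; rewrite eq_le (pf_ge0 Jp) ?andbT; [|by solve_cts|by []].
  apply/ler_addgt0Pr => e e0; rewrite add0r.
  (* The inequality of the means, with [e] arbitrary, replaces Cauchy-Schwarz here. *)
  apply: (@le_trans _ _ (J (fun s => e + (4 * e)^-1 * (h s * h s)))).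
    apply: (pf_le Jp); [by solve_cts..|move=> s _].
    have e40 : 0 < 4 * e by lra.
    have -> : e + (4 * e)^-1 * (h s * h s) = (h s * h s + 4 * e * e) / (4 * e).
      by field; rewrite gt_eqF.
    rewrite ler_pdivlMr//.
    have -> : h s * h s = `|h s| * `|h s| by rewrite -!expr2 real_normK ?num_real.
    have := sqr_ge0 (`|h s| - 2 * e); lra.
  rewrite (pfD Jp) ?(pfZ Jp) ?h2 ?(pf_cst Jp) ?J1; [|by solve_cts..].
  by rewrite mulr0 addr0 mulr1.
have J0 (k : R -> R) : cts k -> (forall s, 0 <= s <= 1 -> `|k s| <= `|h s|) -> J k = 0.
  move=> ck kh; suff : `|J k| <= J (fun s => `|h s|) by rewrite Jabs normr_le0 => /eqP.
  apply: le_trans (pf_norm Jp ck) _.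
  by apply: (pf_le Jp); solve_cts.
have ht t : 0 <= t <= 1 -> h t = a + b * t.
  move=> tT; rewrite eh// J0 ?mulr0 ?subr0//; first by solve_cts.
  move=> s /andP[s0 _]; rewrite normrM ler_piMl// ramp01//; by case/andP: tT.
have Jh : J h = 0 by exact: J0.
have h1 : h 1 = a + b by rewrite ht ?mulr1// ler01 lexx.
move: bc; rewrite Jh mulr0 subr0 h1 => bc.
have p1 : 0 <= (a + b) * cb by rewrite mulr_ge0// ltW.
have p2 : 0 <= b * sb by rewrite mulr_ge0.
have /eqP : (a + b) * cb = 0 by lra.
rewrite mulf_eq0 gt_eqF//= => /eqP cb_0.
have /eqP : b * sb = 0 by lra.
rewrite mulf_eq0 => /orP[/eqP b_0|/eqP sb_0]; last by move: csb; lra.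
have : J (fun s => h s * h s) = J (fun=> a * a).
  apply: (pf_eq Jp); [by solve_cts|by solve_cts|move=> s sT].
  by rewrite ht// b_0 mul0r addr0.
rewrite h2 (pf_cst Jp) J1 mulr1 => /esym/eqP; rewrite mulf_eq0 orbb => /eqP a_0.
by have := ab_gt0; lra.
Qed.

(* Lagrange's identity: with [h, k] starting from the same data [(a, b)], the
   Wronskian at [1] equals [(lam - mu) * J (h * k)]; both boundary conditions
   make it vanish. *)
Lemma string_eigen_orth lam mu h k : string_eigenfun lam h -> string_eigenfun mu k ->
  lam != mu -> J (fun s => h s * k s) = 0.
Proof.
bc_hyps; move=> [ch eh bh] [ck ek bk] lm.
have [u cu uE] : exists2 u : R -> R, cts u & forall t, u t = J (fun s => ramp t s * h s).
  by eexists; last by []; exact: (volterra_cts Jp ler01 ch).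
have [w cw wE] : exists2 w : R -> R, cts w & forall t, w t = J (fun s => ramp t s * k s).
  by eexists; last by []; exact: (volterra_cts Jp ler01 ck).
pose A := J (fun t => k t * u t); pose B := J (fun t => h t * w t).
pose h0 := J h; pose h1 := J (fun s => s * h s).
pose k0 := J k; pose k1 := J (fun s => s * k s).
have AB : A - B = k1 * h0 - k0 * h1.
  (* Exchanging the integrals turns [ramp t s] into [ramp s t]; by [rampC] they differ by [t - s],
     and this difference yields the products of moments in [AB]. *)
  have -> : B = J (fun t => k t * (u t - (t * h0 - h1))).
    rewrite /B (_ : (fun t => h t * w t) = fun t => h t * J (fun s => ramp t s * k s)).
      rewrite ramp_swap//; congr Jint; apply/funext => t.
      rewrite uE; congr (_ * _).
      have -> : (fun s => ramp s t * h s) =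
          fun s => ramp t s * h s - (t * h s - s * h s).
        by apply/funext => s; rewrite (rampC s t); ring.
      by rewrite (pfB Jp) ?(pfB Jp) ?(pfZ Jp); [|by solve_cts..].
    by apply/funext => t; rewrite wE.
  have -> : (fun t => k t * (u t - (t * h0 - h1))) =
      fun t => k t * u t - (h0 * (t * k t) - h1 * k t).
    by apply/funext => t; ring.
  rewrite (pfB Jp) ?(pfB Jp) ?(pfZ Jp); [|by solve_cts..].
  by rewrite -/A /k0 /k1; ring.
pose X := J (fun s => h s * k s).
have X1 : X = a * k0 + b * k1 - lam * A.
  rewrite /X (pf_eq Jp (g := fun t => (a * k t + b * (t * k t)) - lam * (k t * u t))).
  - by rewrite (pfB Jp) ?(pfD Jp) ?(pfZ Jp); [|by solve_cts..].
  - by solve_cts.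
  - by solve_cts.
  - by move=> s sT; rewrite eh// uE; ring.
have X2 : X = a * h0 + b * h1 - mu * B.
  rewrite /X (pf_eq Jp (g := fun t => (a * h t + b * (t * h t)) - mu * (h t * w t))).
  - by rewrite (pfB Jp) ?(pfD Jp) ?(pfZ Jp); [|by solve_cts..].
  - by solve_cts.
  - by solve_cts.
  - by move=> s sT; rewrite ek// wE; ring.
have at1 f : cts f -> J (fun s => ramp 1 s * f s) = J f - J (fun s => s * f s).
  move=> cf; rewrite -(pfB Jp); [|by solve_cts..].
  apply: (pf_eq Jp); [by solve_cts..|move=> s /andP[_ s1]].
  by rewrite /ramp max_l ?subr_ge0//; ring.
have one : 0 <= (1 : R) <= 1 by rewrite ler01 lexx.
have := eh 1 one; rewrite at1// => hE; have := ek 1 one; rewrite at1// => kE.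
have wronskian : (mu - lam) * X = (b - lam * h0) * k 1 - h 1 * (b - mu * k0).
  have -> : (mu - lam) * X = mu * (a * k0 + b * k1 - lam * A) - lam * (a * h0 + b * h1 - mu * B).
    by rewrite -X1 -X2; ring.
  have -> : A = B + (k1 * h0 - k0 * h1) by rewrite -AB; ring.
  by rewrite hE kE -/h0 -/h1 -/k0 -/k1; ring.
have W0 : (b - lam * h0) * k 1 - h 1 * (b - mu * k0) = 0.
  have [sb_0|/eqP nsb] := eqVneq sb 0.
    move: bh bk; rewrite sb_0 (sb_eq0 sb_0) !mulr0 !addr0 !mulr1 => -> ->.
    by ring.
  have e : ((b - lam * h0) * k 1 - h 1 * (b - mu * k0)) * sb = 0.
    have -> : ((b - lam * h0) * k 1 - h 1 * (b - mu * k0)) * sb =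
      ((h 1 * cb + (b - lam * h0) * sb) * k 1 - h 1 * (k 1 * cb + (b - mu * k0) * sb)) by ring.
    by rewrite bh bk; ring.
  by move/eqP: e; rewrite mulf_eq0 (negPf (introN eqP nsb)) orbF => /eqP.
move/eqP: wronskian; rewrite W0 mulf_eq0 subr_eq0 eq_sym (negPf lm)/= => /eqP.
by [].
Qed.


(* The Robin condition at [1] becomes the Dirichlet condition at [1 + sb] once
   an atom of weight [(1 - cb) / sb], independent of the spectral parameter, is
   placed at [1] ([sb = 0] gives [T = 1] and no atom). *)
Lemma string_zeros_eigenvalues x : 0 <= x -> exists h, [/\
    solution 1 (fun f => x * J f) a b h &
    forall zs, uniq zs -> (forall z, z \in zs -> 0 < z < 1 /\ h z = 0) ->
    exists ls, [/\ uniq ls, size ls = size zs &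
      forall lam, lam \in ls -> 0 <= lam <= x /\ string_eigenvalue lam]].
Proof.
bc_hyps; move=> x0; pose T := 1 + sb; pose c := (1 - cb) / sb.
have T0 : 0 < T by rewrite /T; lra.
have T1 : 1 <= T by rewrite /T; lra.
have c0 : 0 <= c by rewrite /c divr_ge0//; lra.
have csE : c * sb = 1 - cb.
  have [sb_0|nsb] := eqVneq sb 0; first by rewrite sb_0 mulr0 (sb_eq0 sb_0) subrr.
  by rewrite /c divfK.
pose E (f : R -> R) := c * f 1.
have Ep : positive_functional T E.
  split=> [f g cf cg|k f cf|f cf f0]; rewrite /E; [by ring|by ring|].
  by rewrite mulr_ge0// f0// ler01 T1.
have JTp : positive_functional T J by exact: J_positive.
have /choice[psi psiP] (lam : R) :
    exists h, 0 <= lam -> solution T (Lfam J E lam) a b h.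
  have [l0|_] := boolP (0 <= lam); last by exists (fun=> 0).
  by have [h hh] := solution_exists (Lfam_positive JTp Ep l0) a b (ltW T0); exists h.
have psi1 lam : 0 <= lam -> solution 1 (fun f => lam * J f) a b (psi lam).
  move=> /psiP[cp ep]; split=> // t /andP[t0 t1].
  rewrite ep ?t0 ?(le_trans t1)// /Lfam /E.
  have -> : ramp t 1 = 0 by rewrite /ramp max_r// subr_le0.
  by rewrite mul0r mulr0 addr0.
(* Beyond 1 the solution is affine and its slope [b - lam * J (psi lam)] is lowered by
   [c * psi lam 1] at the atom. Over the length [sb] this gives [psi lam 1 * (1 - c * sb)] plus [sb]
   times the old slope, and [1 - c * sb = cb]. *)
have psiT lam : 0 <= lam ->
    psi lam T = psi lam 1 * cb + (b - lam * J (psi lam)) * sb.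
  move=> l0; have [cp ep] := psiP _ l0.
  rewrite ep ?lexx ?(ltW T0)// /Lfam /E.
  have -> : ramp T 1 = sb by rewrite /ramp /T max_l; lra.
  have -> : J (fun s => ramp T s * psi lam s) =
      J (fun s => ramp 1 s * psi lam s) + sb * J (psi lam).
    rewrite -(pfZ Jp)// -(pfD Jp); [|by solve_cts..].
    apply: (pf_eq Jp); [by solve_cts..|move=> s /andP[s0 s1]].
    by rewrite /ramp /T !max_l; [ring|lra|lra].
  have := (psi1 _ l0).2 1; rewrite ler01 lexx => /(_ isT) /= p1.
  set A := J (fun s => ramp 1 s * psi lam s) in p1 *.
  have lA : lam * A = a + b * 1 - psi lam 1 by rewrite p1; ring.
  by rewrite (mulrA c) csE (mulrDr lam) lA /T; ring.
have psi0 t : 0 < t < T -> psi 0 t != 0.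
  move=> /andP[t0 tT]; have [cp ep] := psiP _ (lexx 0).
  have e01 s : 0 <= s <= 1 -> psi 0 s = a + b * s.
    by move=> sT; rewrite (psi1 _ (lexx 0)).2// mul0r subr0.
  have tT' : 0 <= t <= T by rewrite !ltW.
  case: (lerP t 1) => t1.
    rewrite e01 ?(ltW t0)// gt_eqF//; case: (ltrgtP a 0) => [|pa|za]; first by lra.
      by rewrite ltr_pwDl// mulr_ge0// ltW.
    by rewrite za add0r mulr_gt0//; lra.
  rewrite ep// /Lfam /E mul0r add0r e01 ?ler01 ?lexx//.
  have -> : ramp t 1 = t - 1 by rewrite /ramp max_l; lra.
  rewrite mulr1 gt_eqF//.
  have sb_gt0 : 0 < sb by rewrite /T in tT; lra.
  (* linear on [[1, T]], positive at [1] and nonnegative at [T] *)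
  have -> : a + b * t - c * ((t - 1) * (a + b)) =
      ((T - t) * (a + b) + (t - 1) * ((a + b) * cb + b * sb)) / sb.
    apply: (mulIf (x := sb)); first by rewrite gt_eqF.
    rewrite divfK ?gt_eqF//.
    have -> : (a + b * t - c * ((t - 1) * (a + b))) * sb =
       (a + b * t) * sb - (c * sb) * ((t - 1) * (a + b)) by ring.
    by rewrite csE /T; ring.
  have t10 : 0 <= t - 1 by lra.
  have cb_ab : 0 <= (a + b) * cb + b * sb by rewrite addr_ge0// mulr_ge0// ltW.
  apply: divr_gt0 => //; apply: ltr_pwDl; last exact: mulr_ge0.
  by apply: mulr_gt0 => //; lra.
exists (psi x); split; first exact: psi1.
move=> zs uzs hzs.
have xn : zcount T psi x (size zs).
  exists zs; split=> // z /hzs[/andP[z0 z1] hz]; split=> //.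
  by rewrite z0 (lt_le_trans z1).
have [s [us ss hs]] := zeros_give_eigenvalues T0 JTp Ep ab psiP psi0 x0 xn.
exists s; split=> // lam /hs[lx pT]; split=> //.
have l0 : 0 <= lam by case/andP: lx.
have [cp ep] := psi1 _ l0.
by exists (psi lam); split=> //; rewrite -psiT.
Qed.

Lemma string_zero_exists x h u v d : 0 <= x ->
  solution 1 (fun f => x * J f) a b h -> 0 <= u -> v <= 1 -> 0 < d -> u + d <= v - d ->
  1 < x * fine (eta `[u + d, v - d]%classic) * (d ^+ 2 / (v - u)) ->
  exists2 z, u < z < v & h z = 0.
Proof.
move=> x0 sh u0 v1 d0 uv; have Lp : positive_functional 1 (fun f => x * J f).
  split=> [f g cf cg|k f cf|f cf f0].
  - by rewrite (pfD Jp)// mulrDr.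
  - by rewrite (pfZ Jp)//; ring.
  - by rewrite mulr_ge0// (pf_ge0 Jp).
apply: (zero_exists Lp sh) => // g k cg g0 k0 gk.
rewrite -mulrA ler_wpM2l//; apply: J_ge_mass => //; lra.
Qed.

(** * The L^2 estimate bounding the number of eigenvalues *)

Section upper_bound.

(** Open intervals, because the cutting points may carry atoms of [eta]; the functions estimated
    below vanish there. *)
Definition Jopen u v f := Jint eta `]u, v[%classic f.

Let W01 u v : 0 <= u -> v <= 1 -> (`]u, v[%classic : set R) `<=` I01.
Proof.
by move=> u0 v1 x /=; rewrite !in_itv/= => /andP[? ?]; apply/andP; split; lra.
Qed.

Let cts_sqr (g : R -> R) : cts g -> cts (fun s => g s ^+ 2).
Proof. by move=> cg; exact: ctsM. Qed.

Let mW u v : measurable (`]u, v[%classic : set R).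
Proof. exact: measurable_itv. Qed.

Lemma Jopen_split u p v f : 0 <= u -> v <= 1 -> u < p < v -> cts f ->
  Jopen u v f = Jopen u p f + f p * fine (eta [set p]) + Jopen p v f.
Proof.
move=> u0 v1 /andP[up pv] cf.
have E : (`]u, v[%classic : set R) = `]u, p[%classic `|` ([set p] `|` `]p, v[%classic).
  apply/seteqP; split=> s /=; rewrite !in_itv/=.
    move=> /andP[us sv]; case: (ltgtP s p) => [sp|ps|->]; last by right; left.
      by left; rewrite us.
    by right; right; rewrite sv.
  case=> [/andP[us sp]|[->|/andP[ps sv]]].
  - by rewrite us (lt_trans sp).
  - by rewrite up.
  - by rewrite sv (lt_trans up).
have p01 : [set p] `<=` I01.
  by move=> _ -> /=; rewrite in_itv/=; apply/andP; split; lra.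
have pv01 : (`]p, v[%classic : set R) `<=` I01 by apply: W01 => //; lra.
have up01 : (`]u, p[%classic : set R) `<=` I01 by apply: W01 => //; lra.
have d1 : [disjoint `]u, p[%classic & ([set p] `|` `]p, v[%classic : set R)].
  rewrite disj_set2E; apply/eqP/seteqP; split=> // s [] /=; rewrite !in_itv/=.
  by move=> /andP[_ sp] [sE|/andP[ps _]]; [move: sp; rewrite sE ltxx|lra].
have d2 : [disjoint [set p] & (`]p, v[%classic : set R)].
  rewrite disj_set2E; apply/eqP/seteqP; split=> // s [] /= ->; rewrite in_itv/=.
  by rewrite ltxx.
have mpv : measurable ([set p] `|` `]p, v[%classic : set R) by exact: measurableU.
rewrite /Jopen E Jint_setU//; last by rewrite subUset.
rewrite [X in _ + X = _]Jint_setU//.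
rewrite addrA; congr (_ + _ + _).
by rewrite -Jint_cst//; apply: Jint_eq => s ->.
Qed.

Lemma Jopen_full u v f : 0 <= u -> v <= 1 -> cts f ->
  (forall s, 0 <= s <= 1 -> (s <= u) || (v <= s) -> f s = 0) -> J f = Jopen u v f.
Proof.
move=> u0 v1 cf f0; have s01 := W01 u0 v1; have mu := mW u v.
rewrite /Jopen -[in LHS](setDUK s01) Jint_setU//.
- rewrite [X in _ + X](_ : _ = Jint eta (I01 `\` `]u, v[%classic) (fun=> 0)).
    by rewrite Jint_cst ?mul0r ?addr0//; exact: measurableD.
  apply: Jint_eq => s [/= s01' /negP]; rewrite in_itv/= negb_and -!leNgt => suv.
  by apply: f0 => //; move: s01'; rewrite in_itv.
- exact: measurableD.
- by rewrite disj_set2E setDIK.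
Qed.

Lemma Jopen_ge0 u v f : (forall s, 0 <= f s) -> 0 <= Jopen u v f.
Proof. by move=> f0; exact: Jint_ge0. Qed.

(* Cauchy-Schwarz: the quadratic polynomial [r |-> Jopen (|F| - r)^2] is nonnegative. *)
Lemma Jopen_cauchy u v F : 0 <= u -> v <= 1 -> cts F ->
  Jopen u v (fun s => `|F s|) ^+ 2 <= fine (eta `]u, v[%classic) * Jopen u v (fun s => F s ^+ 2).
Proof.
move=> u0 v1 cF; have s01 := W01 u0 v1; have mu := mW u v.
set A := Jopen u v (fun s => `|F s|); set B := Jopen u v (fun s => F s ^+ 2).
set m := fine _; have m0 : 0 <= m by exact: fine_ge0.
have B0 : 0 <= B by apply: Jopen_ge0 => s; exact: sqr_ge0.
have A0 : 0 <= A by apply: Jopen_ge0 => s; exact: normr_ge0.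
have cF2 := cts_sqr cF.
have q r : 0 <= B - 2 * r * A + r ^+ 2 * m.
  have : 0 <= Jopen u v (fun s => (`|F s| - r) ^+ 2) by apply: Jopen_ge0 => s; exact: sqr_ge0.
  have -> : (fun s => (`|F s| - r) ^+ 2) = fun s => F s ^+ 2 + (- (2 * r) * `|F s| + r ^+ 2).
    by apply/funext => s; rewrite sqrrB real_normK ?num_real//; ring.
  have -> : Jopen u v (fun s => F s ^+ 2 + (- (2 * r) * `|F s| + r ^+ 2)) =
      B + (- (2 * r) * A + r ^+ 2 * m).
    rewrite /Jopen JintD//; last by solve_cts.
    rewrite [X in _ + X]JintD//; [|by solve_cts..].
    by rewrite JintZ ?Jint_cst//; solve_cts.
  lra.
case: (ltrgtP m 0) => [|m_gt0|m_0]; first by rewrite ltNge m0.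
  have := q (A / m); rewrite -(pmulr_lge0 _ m_gt0).
  have -> : (B - 2 * (A / m) * A + (A / m) ^+ 2 * m) * m = m * B - A ^+ 2.
    by field; rewrite gt_eqF.
  lra.
rewrite m_0 mul0r; move: A0; rewrite le_eqVlt => /predU1P[<-|A_gt0]; first by rewrite expr0n.
have := q ((B + 1) / (2 * A)); rewrite m_0 mulr0 addr0.
have -> : B - 2 * ((B + 1) / (2 * A)) * A = -1 by field; rewrite gt_eqF.
by lra.
Qed.

(** The inhomogeneous string [- f'' = F d(eta)]. A combination of eigenfunctions for different
    eigenvalues satisfies it, with [F] the combination weighted by the eigenvalues. *)
Context (A B : R) (f F : R -> R).
Hypothesis cf : cts f.
Hypothesis cF : cts F.
Hypothesis fE : forall t, 0 <= t <= 1 -> f t = A + B * t - J (fun s => ramp t s * F s).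
Hint Resolve green_cts : cts.

Let cf2 : cts (fun s => f s ^+ 2).
Proof. exact: cts_sqr. Qed.
Let cF2 : cts (fun s => F s ^+ 2).
Proof. exact: cts_sqr. Qed.

(** Between two zeros [f] is the Green potential of [F], hence at most [v - u] times the integral of
    the norm of [F]. Cauchy-Schwarz gives one factor of the mass, integrating the constant bound
    over the cell another. *)
Lemma potential_cell u v : 0 <= u -> u < v -> v <= 1 -> f u = 0 -> f v = 0 ->
  Jopen u v (fun s => f s ^+ 2) <=
  ((v - u) * fine (eta `]u, v[%classic)) ^+ 2 * Jopen u v (fun s => F s ^+ 2).
Proof.
move=> u0 uv v1 fu fv; have s01 := W01 u0 v1; have mu := mW u v.
have m0 : 0 <= fine (eta `]u, v[%classic) by exact: fine_ge0.
have ft t : u < t < v -> `|f t| <= (v - u) * Jopen u v (fun s => `|F s|).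
  move=> /andP[ut tv]; have tuv : u <= t <= v by rewrite !ltW.
  have -> : f t = J (fun s => green u v t s * F s).
    have -> : (fun s => green u v t s * F s) = fun s => (v - u)^-1 *
       ((v - t) * (ramp u s * F s) + (t - u) * (ramp v s * F s)) - ramp t s * F s.
      by apply/funext => s; rewrite /green; ring.
    rewrite (pfB Jp); [|by solve_cts..].
    rewrite (pfZ Jp); last by solve_cts.
    rewrite (pfD Jp); [|by solve_cts..].
    rewrite !(pfZ Jp); [|by solve_cts..].
    have := fE (t := t); have := fE (t := u); have := fE (t := v); rewrite fu fv.
    have -> : 0 <= v <= 1 by apply/andP; split; lra.
    have -> : 0 <= u <= 1 by apply/andP; split; lra.
    have -> : 0 <= t <= 1 by apply/andP; split; lra.
    move=> /(_ isT)/esym/eqP; rewrite subr_eq0 => /eqP <-.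
    move=> /(_ isT)/esym/eqP; rewrite subr_eq0 => /eqP <-.
    move=> /(_ isT) ->.
    by field; rewrite subr_eq0 gt_eqF.
  apply: le_trans (pf_norm Jp _) _; first by solve_cts.
  have -> : J (fun s => `|green u v t s * F s|) = Jopen u v (fun s => `|green u v t s * F s|).
    apply: Jopen_full => //; first by solve_cts.
    by move=> s _ suv; rewrite green0// mul0r normr0.
  rewrite /Jopen -JintZ//; [|by solve_cts].
  apply: Jint_le => //; [by solve_cts..|move=> s _].
  have /andP[g0 g1] := green_le s uv tuv.
  by rewrite normrM (ger0_norm g0) ler_wpM2r.
have A0 : 0 <= Jopen u v (fun s => `|F s|) by apply: Jopen_ge0 => s; exact: normr_ge0.
apply: (@le_trans _ _ (Jopen u v (fun=> ((v - u) * Jopen u v (fun s => `|F s|)) ^+ 2))).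
  rewrite /Jopen; apply: Jint_le => //; first exact: cts_cst.
  move=> s /=; rewrite in_itv/= => /ft fs.
  rewrite -(real_normK (num_real (f s))) ler_sqr ?nnegrE//.
  by rewrite mulr_ge0// subr_ge0 ltW.
rewrite {1}/Jopen Jint_cst// !exprMn.
have -> : (v - u) ^+ 2 * fine (eta `]u, v[%classic) ^+ 2 * Jopen u v (fun s => F s ^+ 2) =
  (v - u) ^+ 2 * (fine (eta `]u, v[%classic) * Jopen u v (fun s => F s ^+ 2)) *
  fine (eta `]u, v[%classic) by ring.
by rewrite ler_wpM2r// ler_wpM2l ?sqr_ge0// Jopen_cauchy.
Qed.

(** Cutting at the points of [S] one after the other. An atom at a cutting point contributes nothing
    on the left, where [f] vanishes, and something nonnegative on the right. *)
Lemma potential_interval (k : R) (S : seq R) u v : 0 <= u -> u < v -> v <= 1 ->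
  (forall p, p \in S -> f p = 0) -> f u = 0 -> f v = 0 ->
  (forall p q, u <= p -> p < q -> q <= v -> (forall s, s \in S -> ~~ (p < s < q)) ->
     (q - p) * fine (eta `]p, q[%classic) <= k) ->
  Jopen u v (fun s => f s ^+ 2) <= k ^+ 2 * Jopen u v (fun s => F s ^+ 2).
Proof.
elim: S u v => [|p S ih] u v u0 uv v1 fS fu fv good.
  apply: le_trans (potential_cell u0 uv v1 fu fv) _.
  have gk : (v - u) * fine (eta `]u, v[%classic) <= k by exact: good.
  have g0 : 0 <= (v - u) * fine (eta `]u, v[%classic).
    by rewrite mulr_ge0 ?fine_ge0// subr_ge0 ltW.
  rewrite ler_wpM2r//; first by apply: Jopen_ge0 => s; exact: sqr_ge0.
  by rewrite ler_sqr ?nnegrE// (le_trans g0).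
have fp : f p = 0 by apply: fS; rewrite mem_head.
have fS' q : q \in S -> f q = 0 by move=> qS; apply: fS; rewrite inE qS orbT.
have [/andP[up pv]|npuv] := boolP (u < p < v); last first.
  apply: ih => // p' q' up' pq' qv' hS; apply: good => // s.
  rewrite inE => /predU1P[->|]; last exact: hS.
  apply: contra npuv => /andP[? ?]; apply/andP; split; lra.
rewrite !(@Jopen_split u p v)//; [|by rewrite up pv..].
rewrite fp expr0n mul0r addr0 !mulrDr -addrA lerD//.
  apply: ih => //; [lra|move=> p' q' up' pq' qv' hS].
  apply: good => //; first lra.
  move=> s; rewrite inE => /predU1P[->|]; last exact: hS.
  by rewrite negb_and -!leNgt qv' orbT.
apply: ler_wpDl.
  by apply: mulr_ge0; [exact: sqr_ge0|apply: mulr_ge0; [exact: sqr_ge0|exact: fine_ge0]].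
apply: ih => //; [lra|move=> p' q' up' pq' qv' hS].
apply: good => //; first lra.
move=> s; rewrite inE => /predU1P[->|]; last exact: hS.
by rewrite negb_and -!leNgt up'.
Qed.

End upper_bound.

Let pf_sum (I : Type) (r : seq I) (k : I -> R) (g : I -> R -> R) :
  (forall i, cts (g i)) ->
  J (fun s => \sum_(i <- r) k i * g i s) = \sum_(i <- r) k i * J (g i).
Proof.
move=> cg; elim: r => [|i r ih].
  rewrite (_ : (fun s => _) = fun=> 0); last by apply/funext => s; rewrite big_nil.
  by rewrite big_nil (pf_cst Jp) mul0r.
rewrite big_cons -ih (_ : (fun s => _) =
    fun s => k i * g i s + \sum_(j <- r) k j * g j s); last first.
  by apply/funext => s; rewrite big_cons.
rewrite (pfD Jp) ?(pfZ Jp)//; first by solve_cts.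
by apply: cts_sum => ?; solve_cts.
Qed.

Lemma string_eigenvalues_le_points x (S ls : seq R) : 0 < x -> uniq ls ->
  (forall lam, lam \in ls -> string_eigenvalue lam /\ lam <= x) ->
  (forall p q, 0 <= p -> p < q -> q <= 1 -> (forall s, s \in S -> ~~ (p < s < q)) ->
     (q - p) * fine (eta `]p, q[%classic) <= (2 * x)^-1) ->
  (size ls <= size S + 2)%N.
Proof.
move=> x0 uls hls good; rewrite leqNgt; apply/negP => lt_n.
set n := size ls in lt_n; pose pts := [:: 0, 1 & S]; pose m := size pts.
have mn : (m < n)%N by rewrite /m /pts /= -addn2.
have /choice[hh hhP] (lam : R) : exists h, lam \in ls -> string_eigenfun lam h.
  have [/hls[[h hE] _]|_] := boolP (lam \in ls); last by exists (fun=> 0).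
  by exists h.
pose la (i : 'I_n) := ls`_i; pose h i := hh (la i).
have hP i : string_eigenfun (la i) (h i) by apply: hhP; exact: mem_nth.
have ch i : cts (h i) by have [] := hP i.
pose M : 'M[R]_(n, m) := \matrix_(i, j) h i pts`_j.
(* There are more eigenfunctions (rows) than points (columns), so the left kernel is not zero. *)
have [c c0 cM] : exists2 c : 'rV[R]_n, c != 0 & c *m M = 0.
  have : kermx M != 0.
    rewrite -mxrank_eq0 mxrank_ker subn_eq0 -ltnNge.
    exact: leq_ltn_trans (rank_leq_col M) mn.
  by move=> /rowV0Pn[c /sub_kermxP cM c0]; exists c.
pose f s := \sum_(i < n) c 0 i * h i s.
pose F s := \sum_(i < n) (la i * c 0 i) * h i s.
have cf : cts f by apply: cts_sum => i; solve_cts; exact: ch.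
have cF : cts F by apply: cts_sum => i; solve_cts; exact: ch.
have fpts p : p \in pts -> f p = 0.
  move=> ppts; have jm : (index p pts < m)%N by rewrite /m index_mem.
  have := congr1 (fun A : 'rV_m => A 0 (Ordinal jm)) cM; rewrite !mxE => <-.
  by apply: eq_bigr => i _; rewrite mxE nth_index.
have fE t : 0 <= t <= 1 -> f t = (\sum_(i < n) c 0 i * a) + (\sum_(i < n) c 0 i * b) * t
    - J (fun s => ramp t s * F s).
  move=> tT.
  have -> : (fun s => ramp t s * F s) =
      fun s => \sum_(i < n) (la i * c 0 i) * (ramp t s * h i s).
    by apply/funext => s; rewrite /F mulr_sumr; apply: eq_bigr => i _; rewrite mulrCA.
  rewrite pf_sum; last by move=> i; have := ch i => ?; solve_cts.
  rewrite mulr_suml -big_split -sumrB; apply: eq_bigr => i _ /=.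
  by have [_ hE _] := hP i; rewrite hE//; ring.
have orth (d : 'I_n -> R) i :
    J (fun s => h i s * \sum_(j < n) d j * h j s) = d i * J (fun s => h i s * h i s).
  have -> : (fun s => h i s * \sum_(j < n) d j * h j s) =
      fun s => \sum_(j < n) d j * (h i s * h j s).
    by apply/funext => s; rewrite mulr_sumr; apply: eq_bigr => j _; rewrite mulrCA.
  rewrite pf_sum; last by move=> j; have := ch i => ?; have := ch j => ?; solve_cts.
  rewrite (bigD1 i)//= big1 ?addr0// => j ji.
  rewrite (string_eigen_orth (hP i) (hP j)) ?mulr0//.
  by rewrite /la nth_uniq// eq_sym.
pose N i := J (fun s => h i s * h i s).
have N0 i : 0 < N i by exact: string_eigen_norm_gt0 (hP i).
have norm2 (d : 'I_n -> R) (g : R -> R) : (forall s, g s = \sum_(j < n) d j * h j s) ->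
    J (fun s => g s ^+ 2) = \sum_(i < n) d i ^+ 2 * N i.
  move=> gE; have -> : g = fun s => \sum_(j < n) d j * h j s by exact/funext.
  have cg : cts (fun s => \sum_(j < n) d j * h j s).
    by apply: cts_sum => j; have := ch j => ?; solve_cts.
  have -> : (fun s => (\sum_(j < n) d j * h j s) ^+ 2) =
      fun s => \sum_(i < n) d i * (h i s * \sum_(j < n) d j * h j s).
    by apply/funext => s; rewrite expr2 {1}mulr_suml; apply: eq_bigr => i _; rewrite mulrA.
  rewrite pf_sum; last by move=> i; have := ch i => ?; solve_cts.
  by apply: eq_bigr => i _; rewrite orth mulrA expr2.
have f2 : J (fun s => f s ^+ 2) = \sum_(i < n) c 0 i ^+ 2 * N i by exact: norm2.
have F2 : J (fun s => F s ^+ 2) = \sum_(i < n) (la i * c 0 i) ^+ 2 * N i by exact: norm2.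
have cf2 : cts (fun s => f s ^+ 2) by exact: ctsM.
have cF2 : cts (fun s => F s ^+ 2) by exact: ctsM.
have f0 : f 0 = 0 by apply: fpts; rewrite inE eqxx.
have f1 : f 1 = 0 by apply: fpts; rewrite !inE eqxx orbT.
have Jf : J (fun s => f s ^+ 2) = Jopen 0 1 (fun s => f s ^+ 2).
  apply: Jopen_full => // s /andP[s0 s1] /orP[s0'|s1'].
    by rewrite (_ : s = 0) ?f0 ?expr0n//; apply/eqP; rewrite eq_le s0 s0'.
  by rewrite (_ : s = 1) ?f1 ?expr0n//; apply/eqP; rewrite eq_le s1 s1'.
have JF : Jopen 0 1 (fun s => F s ^+ 2) <= J (fun s => F s ^+ 2).
  rewrite /Jopen; apply: Jint_subset => //; last by move=> s _; exact: sqr_ge0.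
  by move=> s /=; rewrite !in_itv/= => /andP[/ltW -> /ltW ->].
have key : Jopen 0 1 (fun s => f s ^+ 2) <= (2 * x)^-1 ^+ 2 * Jopen 0 1 (fun s => F s ^+ 2).
  apply: (@potential_interval _ _ f F cf cF fE _ S) => //.
  by move=> p pS; apply: fpts; rewrite !inE pS !orbT.
(* By orthogonality this holds coefficientwise; nonnegativity of the eigenvalues is needed to square
   [lam <= x]. *)
have F2f2 : J (fun s => F s ^+ 2) <= x ^+ 2 * J (fun s => f s ^+ 2).
  rewrite f2 F2 mulr_sumr; apply: ler_sum => i _; rewrite mulrA.
  apply: ler_wpM2r; first exact: ltW.
  rewrite exprMn ler_wpM2r ?sqr_ge0// ler_sqr ?nnegrE ?(ltW x0)//.
    by have [] := hls (la i) (mem_nth _ (ltn_ord i)).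
  exact: string_eigen_ge0 (hP i).
have f2_0 : J (fun s => f s ^+ 2) = 0.
  have f20 : 0 <= J (fun s => f s ^+ 2).
    by apply: (pf_ge0 Jp) => // s _; exact: sqr_ge0.
  apply/eqP; rewrite eq_le f20 andbT.
  have : J (fun s => f s ^+ 2) <= (2 * x)^-1 ^+ 2 * (x ^+ 2 * J (fun s => f s ^+ 2)).
    rewrite {1}Jf; apply: le_trans key _; rewrite ler_wpM2l ?sqr_ge0//.
    exact: le_trans JF F2f2.
  (* The bound [(2 * x)^-1] rather than [x^-1] leaves a factor 1/4, and with it strictness. *)
  have -> : (2 * x)^-1 ^+ 2 * (x ^+ 2 * J (fun s => f s ^+ 2)) = J (fun s => f s ^+ 2) / 4.
    by field; rewrite gt_eqF.
  lra.
move: c0; apply/negP; rewrite negbK; apply/eqP/rowP => i; rewrite mxE.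
have /eqP := f2_0; rewrite f2 psumr_eq0; last first.
  by move=> j _; rewrite mulr_ge0 ?sqr_ge0// ltW.
move=> /allP /(_ i); rewrite mem_index_enum => /(_ isT) /=.
by rewrite mulf_eq0 (gt_eqF (N0 i)) orbF sqrf_eq0 => /eqP.
Qed.

End string_eigenproblem.

(** * Eigenvalue counts and dyadic masses *)

Section dyadic_counting.
Context {R : realType} (eta : probability R R).

Definition dyadic_cell (m k : nat) : set R :=
  `](k%:R / 2 ^+ m), (k.+1%:R / 2 ^+ m)]%classic.

Definition cell_mass m k : R := fine (eta (dyadic_cell m k)).

Lemma cell_mass_ge0 m k : 0 <= cell_mass m k.
Proof. exact: fine_ge0. Qed.

Lemma fine_eta_le (A B : set R) : measurable A -> measurable B -> A `<=` B ->
  fine (eta A) <= fine (eta B).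
Proof.
move=> mA mB AB; rewrite fine_le ?fin_num_measure//.
by apply: le_measure; rewrite ?inE.
Qed.

Lemma fine_eta_le1 (A : set R) : measurable A -> fine (eta A) <= 1.
Proof.
by move=> mA; rewrite -lee_fin fineK ?fin_num_measure// probability_le1.
Qed.

Lemma cell_mass_le1 m k : cell_mass m k <= 1.
Proof. by apply: fine_eta_le1; exact: measurable_itv. Qed.

Let p2 m : 0 < (2 ^+ m : R).
Proof. exact: exprn_gt0. Qed.

Definition bad x m k := (2 * x)^-1 < cell_mass m k / 2 ^+ m.

Definition bad_midpoints (x : R) (M : nat) : seq R :=
  flatten [seq [seq (2 * k + 1)%:R / 2 ^+ m.+1 | k <- iota 0 (2 ^ m) & bad x m k]
          | m <- iota 0 M].

Lemma dyadic_between (p q : R) : p < q -> 0 <= p ->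
  exists m i, p < i%:R / 2 ^+ m < q.
Proof.
move=> pq p0; have d0 : 0 < q - p by rewrite subr_gt0.
have [m hm] : exists m, (q - p)^-1 < 2 ^+ m.
  exists (Num.bound (q - p)^-1); apply: lt_trans (archi_boundP _) _.
    by rewrite invr_ge0 ltW.
  by rewrite -natrX ltr_nat ltn_expl.
exists m, (Num.truncn (p * 2 ^+ m)).+1.
have pm0 : 0 <= p * 2 ^+ m by rewrite mulr_ge0// ltW.
have /andP[t1 t2] := truncn_itv pm0.
rewrite ltr_pdivlMr// t2/= ltr_pdivrMr// -natr1.
have : 1 < (q - p) * 2 ^+ m by rewrite mulrC -ltr_pdivrMr// mul1r.
lra.
Qed.

(* The first dyadic level having a point inside an open interval that is bad
   puts that point in the middle of a bad dyadic cell of the previous level. *)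
Lemma bad_midpointsP x M p q : 0 < x -> 2 * x <= 2 ^+ M -> 0 <= p -> p < q -> q <= 1 ->
  (forall s, s \in bad_midpoints x M -> ~~ (p < s < q)) ->
  (q - p) * fine (eta `]p, q[%classic) <= (2 * x)^-1.
Proof.
move=> x0 xM p0 pq q1 hS; rewrite leNgt; apply/negP => bad_pq.
have ex : exists m, `[< exists i, p < i%:R / 2 ^+ m < q >].
  by have [m [i h]] := dyadic_between pq p0; exists m; apply/asboolP; exists i.
case: (ex_minnP ex) => m /asboolP[i /andP[pi iq]] mmin.
case: m pi iq mmin => [|m] pi iq mmin.
  move: pi iq; rewrite expr0 divr1; case: i => [|i]; first by rewrite ltNge p0.
  by move=> _ iq; have := lt_le_trans iq q1; rewrite ltrn1.
have no_m j : ~ (p < j%:R / 2 ^+ m < q).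
  move=> h; suff /mmin : `[< exists i : nat, p < i%:R / 2 ^+ m < q >] by rewrite ltnn.
  by apply/asboolP; exists j.
(* An even numerator would already give a point of the previous level. *)
have oddi : odd i.
  apply/negPn/negP => ei; apply: (no_m i./2).
  have -> : i./2%:R / 2 ^+ m = i%:R / 2 ^+ m.+1 :> R.
    rewrite -[in RHS](odd_double_half i) (negPf ei) add0n -muln2 natrM exprS.
    by field; rewrite expf_neq0.
  by rewrite pi.
set k := i./2; have iE : i = (2 * k + 1)%N.
  by rewrite -[LHS](odd_double_half i) oddi -muln2 mulnC addnC.
have mid : i%:R / 2 ^+ m.+1 = (k%:R / 2 ^+ m + k.+1%:R / 2 ^+ m) / 2 :> R.
  by rewrite iE exprS natrD natrM -natr1; field; rewrite expf_neq0.
have kk : k%:R / 2 ^+ m <= k.+1%:R / 2 ^+ m :> R.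
  by rewrite ler_pM2r ?invr_gt0// ler_nat.
have kp : k%:R / 2 ^+ m <= p.
  rewrite leNgt; apply/negP => h; apply: (no_m k); rewrite h/=.
  by apply: le_lt_trans iq; rewrite mid; lra.
have kq : q <= k.+1%:R / 2 ^+ m.
  rewrite leNgt; apply/negP => h; apply: (no_m k.+1); rewrite h andbT.
  by apply: lt_le_trans pi _; rewrite mid; lra.
have k2m : (k < 2 ^ m)%N.
  have : k%:R / 2 ^+ m < 1 :> R by apply: le_lt_trans kp (lt_le_trans pq q1).
  by rewrite ltr_pdivrMr// mul1r -natrX ltr_nat.
have sub : (`]p, q[%classic : set R) `<=` dyadic_cell m k.
  move=> s; rewrite /dyadic_cell /= !in_itv/= => /andP[ps sq].
  by rewrite (le_lt_trans kp ps) (le_trans (ltW sq) kq).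
have badmk : bad x m k.
  rewrite /bad; apply: lt_le_trans bad_pq _; rewrite mulrC ler_pM ?fine_ge0//.
  - by rewrite subr_ge0 ltW.
  - by apply: fine_eta_le => //; exact: measurable_itv.
  - have -> : (2 ^+ m)^-1 = k.+1%:R / 2 ^+ m - k%:R / 2 ^+ m :> R.
      by rewrite -natr1; ring.
    by rewrite lerB.
(* Masses are at most 1, so a bad cell of level [m] has [2 ^+ m < 2 * x]; levels below [M]
   suffice. *)
have mM : (m < M)%N.
  have : (2 * x)^-1 < (2 ^+ m)^-1.
    apply: lt_le_trans badmk _; rewrite ler_pdivrMr// mulVf ?gt_eqF//.
    exact: cell_mass_le1.
  rewrite ltf_pV2 ?posrE ?mulr_gt0// => h.
  by have := lt_le_trans h xM; rewrite -!natrX ltr_nat ltn_exp2l.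
have : i%:R / 2 ^+ m.+1 \in bad_midpoints x M.
  apply/flattenP; exists [seq (2 * k + 1)%:R / 2 ^+ m.+1 | k <- iota 0 (2 ^ m) & bad x m k].
    by apply/mapP; exists m => //; rewrite mem_iota.
  by apply/mapP; exists k; rewrite ?iE// mem_filter badmk mem_iota.
by move=> /hS; rewrite pi iq.
Qed.

Lemma size_bad_midpoints x M :
  size (bad_midpoints x M) = (\sum_(m < M) count (bad x m) (iota 0 (2 ^ m)))%N.
Proof.
rewrite /bad_midpoints size_flatten /shape -map_comp sumnE big_map.
have -> : iota 0 M = index_iota 0 M by rewrite /index_iota subn0.
rewrite big_mkord; apply: eq_bigr => m _ /=.
by rewrite size_map size_filter.
Qed.

Definition power_sum m (q : R) : R := \sum_(k <- iota 0 (2 ^ m)) cell_mass m k `^ q.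

Lemma power_sum_ge0 m q : 0 <= power_sum m q.
Proof. by apply: sumr_ge0 => k _; exact: powR_ge0. Qed.

(** Markov's inequality for the powers of the masses. *)
Lemma count_power_sum m q r : 0 < q -> 0 < r ->
  (count (fun k => r <= cell_mass m k) (iota 0 (2 ^ m)))%:R * r `^ q <= power_sum m q.
Proof.
move=> q0 r0; rewrite /power_sum; elim: (iota _ _) => [|k s ih].
  by rewrite big_nil mul0r.
rewrite big_cons /= natrD mulrDl lerD//.
case: (boolP (r <= cell_mass m k)) => rk; last by rewrite mul0r powR_ge0.
by rewrite mul1r ge0_ler_powR ?nnegrE ?(ltW q0) ?(ltW r0)// cell_mass_ge0.
Qed.

(* A mass is at most [2 * 2^-j] for the least [j] with [2^-j] below it, and this
   term occurs in the sum over all such thresholds. *)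
Lemma power_sum_layers (s : seq nat) m q (J : nat) : 0 < q ->
  (forall k, k \in s -> cell_mass m k = 0 \/ (2 ^+ J)^-1 < cell_mass m k) ->
  \sum_(k <- s) cell_mass m k `^ q <=
  2 `^ q * \sum_(j < J.+1) ((2 ^+ j)^-1 `^ q *
     (count (fun k => (2 ^+ j)^-1 <= cell_mass m k) s)%:R).
Proof.
move=> q0 hs; elim: s hs => [|k s ih] hs.
  by rewrite big_nil mulr_ge0 ?powR_ge0// sumr_ge0// => j _; rewrite mulr_ge0// powR_ge0.
rewrite big_cons.
under [X in _ <= _ * X]eq_bigr do rewrite /= natrD mulrDr.
rewrite big_split mulrDr lerD//; first last.
  by apply: ih => i si; apply: hs; rewrite inE si orbT.
have S0 : 0 <= \sum_(i < J.+1) (2 ^+ i)^-1 `^ q * ((2 ^+ i)^-1 <= cell_mass m k)%R%:R.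
  by rewrite sumr_ge0// => j _; rewrite mulr_ge0// powR_ge0.
have [e0|lJ] := hs k (mem_head _ _).
  rewrite [X in X `^ q <= _]e0 powR0 ?gt_eqF//.
  by apply: mulr_ge0 S0; exact: powR_ge0.
have ex : exists j, (2 ^+ j)^-1 <= cell_mass m k by exists J; exact: ltW.
case: (ex_minnP ex) => j hj jmin.
have jJ : (j < J.+1)%N by rewrite ltnS; apply: jmin; exact: ltW.
have kj : cell_mass m k <= 2 * (2 ^+ j)^-1.
  case: j hj jmin jJ => [|j] hj jmin jJ.
    by rewrite expr0 invr1 mulr1 (le_trans (cell_mass_le1 _ _))// ler1n.
  rewrite exprS invfM mulrA divff// mul1r leNgt; apply/negP => h.
  by have := jmin j (ltW h); rewrite ltnn.
apply: (@le_trans _ _ (2 `^ q * (2 ^+ j)^-1 `^ q)).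
  have j0 : 0 <= (2 ^+ j)^-1 :> R by rewrite invr_ge0 ltW.
  rewrite -powRM//; apply: ge0_ler_powR => //; first exact: ltW.
    by rewrite nnegrE cell_mass_ge0.
  by rewrite nnegrE mulr_ge0.
rewrite ler_wpM2l ?powR_ge0// (bigD1 (Ordinal jJ))//= hj mulr1 lerDl.
by rewrite sumr_ge0// => i _; rewrite mulr_ge0// powR_ge0.
Qed.

End dyadic_counting.

(** * Translation between eigenvalue counts and dyadic power sums *)

Section counting_asymptotics.
Context {R : realType} (eta : probability R R) (ev : R -> Prop).
Local Notation cell_mass := (cell_mass eta).
Local Notation power_sum := (power_sum eta).

Hypothesis ev_upper : forall x (S ls : seq R), 0 < x -> uniq ls ->
  (forall lam, lam \in ls -> ev lam /\ lam <= x) ->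
  (forall p q, 0 <= p -> p < q -> q <= 1 -> (forall s, s \in S -> ~~ (p < s < q)) ->
     (q - p) * fine (eta `]p, q[%classic) <= (2 * x)^-1) ->
  (size ls <= size S + 2)%N.

Hypothesis ev_lower : forall x : R, 0 <= x -> exists h : R -> R,
  (forall u v d, 0 <= u -> v <= 1 -> 0 < d -> u + d <= v - d ->
     1 < x * fine (eta `[u + d, v - d]%classic) * (d ^+ 2 / (v - u)) ->
     exists2 z, u < z < v & h z = 0) /\
  (forall zs, uniq zs -> (forall z, z \in zs -> 0 < z < 1 /\ h z = 0) ->
     exists ls, [/\ uniq ls, size ls = size zs &
       forall lam, lam \in ls -> 0 <= lam <= x /\ ev lam]).

Let p2 m : 0 < (2 ^+ m : R).
Proof. exact: exprn_gt0. Qed.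

Lemma geometric_le (r : R) n : 0 <= r -> r < 1 -> \sum_(i < n) r ^+ i <= (1 - r)^-1.
Proof.
move=> r0 r1; have r10 : 0 < 1 - r by lra.
rewrite -[leRHS]mul1r ler_pdivlMr// mulrC.
have -> : (1 - r) * (\sum_(i < n) r ^+ i) = 1 - r ^+ n.
  by rewrite -opprB mulNr -subrX1 opprB.
by rewrite gerBl exprn_ge0.
Qed.

Lemma powRXn (a s : R) n : 0 <= a -> (a ^+ n) `^ s = (a `^ s) ^+ n.
Proof.
move=> a0; elim: n => [|n ih]; first by rewrite !expr0 powR1.
by rewrite !exprS powRM ?exprn_ge0// ih.
Qed.

Lemma powR_inv_ge0 (a s : R) : 0 < a -> a^-1 `^ s = (a `^ s)^-1.
Proof.
move=> a0; apply: (mulfI (x := a `^ s)); first by rewrite gt_eqF// powR_gt0.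
by rewrite -powRM ?invr_ge0 ?(ltW a0)// !divff ?powR1// gt_eqF// powR_gt0.
Qed.

Lemma powR2_lt1 (s q : R) : s < q -> 0 <= (2 `^ s / 2 `^ q : R) < 1.
Proof.
move=> sq; rewrite divr_ge0 ?powR_ge0//= ltr_pdivrMr ?powR_gt0// mul1r.
by rewrite /powR pnatr_eq0/= ltr_expR ltr_pM2r// ln_gt0// ltr1n.
Qed.

Lemma ev_count_upper (q s : R) (m0 : nat) : 0 < q -> s < q ->
  (forall m, (m0 <= m)%N -> power_sum m q <= (2 `^ s) ^+ m) ->
  exists2 C, 0 < C & forall x (ls : seq R), 1 <= x -> uniq ls ->
    (forall lam, lam \in ls -> ev lam /\ lam <= x) -> (size ls)%:R <= C * x `^ q.
Proof.
move=> q0 sq hm; pose r := 2 `^ s / 2 `^ q : R.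
have /andP[r0 r1] : 0 <= r < 1 by exact: powR2_lt1.
have r_gt0 : 0 < r by rewrite divr_gt0 ?powR_gt0.
have r10 : 0 < 1 - r by lra.
(* Chosen so that [K * r ^+ m] bounds the trivial number [2 ^ m] of cells at the levels below
   [m0]. *)
pose K := 2 ^+ m0 / r ^+ m0.
have K0 : 0 < K by rewrite divr_gt0 ?exprn_gt0.
exists ((K + 2 `^ q) / (1 - r) + 2).
  by rewrite ltr_wpDl// divr_ge0 ?ltW// addr_gt0// powR_gt0.
move=> x ls x1 uls hls; have x0 : 0 < x by lra.
have xq1 : 1 <= x `^ q by rewrite -(powRr0 x) ler_powR// ltW.
have [M hM] : exists M, 2 * x <= 2 ^+ M.
  exists (Num.bound (2 * x)); apply/ltW; apply: lt_trans (archi_boundP _) _.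
    by rewrite mulr_ge0// ltW.
  by rewrite -natrX ltr_nat ltn_expl.
have := ev_upper x0 uls hls (fun p q p0 pq q1 => bad_midpointsP (M := M) x0 hM p0 pq q1).
rewrite size_bad_midpoints => le_n.
have cnt m : (count (bad eta x m) (iota 0 (2 ^ m)))%:R <= (K + (2 * x) `^ q) * r ^+ m.
  have [mm0|m0m] := ltnP m m0.
    apply: (@le_trans _ _ (2 ^+ m0)).
      rewrite -natrX ler_nat; apply: leq_trans (count_size _ _) _.
      by rewrite size_iota leq_exp2l// ltnW.
    apply: (@le_trans _ _ (K * r ^+ m)); last first.
      by rewrite ler_wpM2r ?exprn_ge0// lerDl powR_ge0.
    rewrite /K -mulrA ler_peMr ?exprn_ge0// mulrC ler_pdivlMr ?exprn_gt0// mul1r.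
    by apply: ler_wiXn2l => //; [exact: ltW|exact: ltnW].
  apply: (@le_trans _ _ ((2 * x) `^ q * r ^+ m)); last first.
    by rewrite ler_wpM2r ?exprn_ge0// lerDr ltW.
  (* The mass above which a cell of level [m] is bad. *)
  pose t := (2 * x)^-1 * 2 ^+ m.
  have t0 : 0 < t by rewrite mulr_gt0 ?invr_gt0 ?mulr_gt0.
  have c1 := count_power_sum eta m q0 t0.
  have c2 : (count (bad eta x m) (iota 0 (2 ^ m)) <=
      count (fun k => (t <= cell_mass m k)%R) (iota 0 (2 ^ m)))%N.
    apply: sub_count => k; rewrite /bad /t => /ltW.
    by rewrite -ler_pdivrMr ?invr_gt0// invrK.
  have tq : t `^ q = (2 `^ q) ^+ m / (2 * x) `^ q.
    by rewrite /t powRM ?invr_ge0 ?mulr_ge0 ?(ltW x0) ?(ltW (p2 _))// powRXn// powR_inv_ge0 1?mulrC// mulr_gt0.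
  have : (count (bad eta x m) (iota 0 (2 ^ m)))%:R * t `^ q <= (2 `^ s) ^+ m.
    apply: le_trans (hm _ m0m); apply: le_trans c1.
    by rewrite ler_wpM2r ?powR_ge0// ler_nat.
  rewrite -ler_pdivlMr ?powR_gt0//.
  have -> // : (2 `^ s) ^+ m / t `^ q = (2 * x) `^ q * r ^+ m.
  by rewrite tq /r exprMn exprVn invfM invrK; ring.
apply: (@le_trans _ _ ((K + (2 * x) `^ q) / (1 - r) + 2)).
  apply: (@le_trans _ _ ((\sum_(m < M) count (bad eta x m) (iota 0 (2 ^ m)))%:R + 2%:R)).
    by rewrite -natrD ler_nat.
  rewrite lerD2r natr_sum; apply: (@le_trans _ _ (\sum_(m < M) (K + (2 * x) `^ q) * r ^+ m)).
    by apply: ler_sum => m _; exact: cnt.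
  rewrite -mulr_sumr ler_wpM2l ?geometric_le// addr_ge0 ?powR_ge0//; exact: ltW.
rewrite powRM ?(ltW x0)// [leRHS]mulrDl lerD//; last by rewrite ler_peMr.
rewrite mulrAC ler_wpM2r ?invr_ge0 ?(ltW r10)// mulrDl lerD2r ler_peMr//; exact: ltW.
Qed.

(* The zero found lies in the cell or a neighbour, so cells whose indices agree
   modulo 3 give distinct zeros. *)
Lemma ev_of_cells x m (ks : seq nat) : 0 <= x -> uniq ks ->
  (forall k, k \in ks -> [/\ (0 < k)%N, (k.+1 < 2 ^ m)%N & 3 < x * cell_mass m k / 2 ^+ m]) ->
  exists ls, [/\ uniq ls, (size ks <= 3 * size ls)%N &
    forall lam, lam \in ls -> 0 <= lam <= x /\ ev lam].
Proof.
move=> x0 uks hks; have [h [hz hev]] := ev_lower x0.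
have /choice[z zP] (k : nat) : exists z, k \in ks ->
    (k%:R - 1) / 2 ^+ m < z < (k%:R + 2) / 2 ^+ m /\ h z = 0.
  have [/hks[k0 k2m kx]|_] := boolP (k \in ks); last by exists 0.
  have i0 : 0 < (2 ^+ m)^-1 :> R by rewrite invr_gt0.
  (* The core is the cell, the interval adds one neighbour on each side, and [d ^+ 2 / (v - u)]
     becomes a third of the cell length: hence the 3 in the hypothesis. The neighbours must lie in
     [[0, 1]], which excludes the first and the last cell. *)
  have [|||||z zk hz0] := hz ((k%:R - 1) / 2 ^+ m) ((k%:R + 2) / 2 ^+ m) (2 ^+ m)^-1.
  - by rewrite divr_ge0 ?(ltW (p2 _))// subr_ge0 ler1n.
  - by rewrite ler_pdivrMr// mul1r -natrX -natrD ler_nat addn2.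
  - by rewrite invr_gt0.
  - by lra.
  - have e1 : (k%:R - 1) / 2 ^+ m + (2 ^+ m)^-1 = k%:R / 2 ^+ m :> R by ring.
    have e2 : (k%:R + 2) / 2 ^+ m - (2 ^+ m)^-1 = k.+1%:R / 2 ^+ m :> R by rewrite -natr1; ring.
    have e3 : (2 ^+ m)^-1 ^+ 2 / ((k%:R + 2) / 2 ^+ m - (k%:R - 1) / 2 ^+ m) = (2 ^+ m)^-1 / 3 :> R.
      by field; rewrite expf_neq0//= -?natr1; lra.
    rewrite e1 e2 e3 mulrA ltr_pdivlMr// mul1r; apply: lt_le_trans kx _.
    rewrite ler_wpM2r ?invr_ge0 ?(ltW (p2 _))// ler_wpM2l//.
    apply: fine_eta_le; [exact: measurable_itv|exact: measurable_itv|].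
    by move=> y; rewrite /dyadic_cell /= !in_itv/= => /andP[/ltW -> ->].
  - by exists z.
pose c (i : nat) := [seq k <- ks | k %% 3 == i]%N.
(* Some residue class contains at least a third of the cells. *)
have [i hi] : exists i, (size ks <= 3 * size (c i))%N.
  have sz : (size ks = size (c 0) + size (c 1) + size (c 2))%N.
    rewrite /c !size_filter; elim: (ks) => //= k s ->.
    have := ltn_pmod k (isT : 0 < 3)%N.
    by case: (k %% 3)%N => [|[|[|//]]] _ /=; rewrite ?add0n ?add1n ?addSn ?addnS.
  apply: contrapT => no; have {}no i : (3 * size (c i) < size ks)%N.
    by rewrite ltnNge; apply/negP => le_i; apply: no; exists i.
  by have := no 0%N; have := no 1%N; have := no 2%N; lia.
have cks k : k \in c i -> k \in ks /\ (k %% 3 = i)%N.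
  by rewrite mem_filter => /andP[/eqP -> ->].
have zinj k k' : k \in c i -> k' \in c i -> (k < k')%N -> z k < z k'.
  move=> /cks[kks ki] /cks[k'ks k'i] kk'.
  have [/andP[_ z1] _] := zP _ kks; have [/andP[z2 _] _] := zP _ k'ks.
  apply: lt_trans z1 (le_lt_trans _ z2).
  have k3 : (k + 3 <= k')%N.
    have : (k' = k %[mod 3])%N by rewrite k'i ki.
    by move/eqP; rewrite eqn_mod_dvd ?(ltnW kk')// => /dvdnP[d]; lia.
  have k3R : k%:R + 3 <= k'%:R :> R by rewrite -natrD ler_nat.
  by rewrite ler_pM2r ?invr_gt0//; lra.
have [||ls [uls sls hls]] := hev (map z (c i)).
- rewrite map_inj_in_uniq ?filter_uniq// => k k' kc k'c zz.
  by case: (ltngtP k k') => // /zinj lt; [have := lt kc k'c|have := lt k'c kc]; rewrite zz ltxx.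
- move=> _ /mapP[k /cks[kks _] ->]; have [/andP[z1 z2] hz0] := zP _ kks.
  split=> //; have [k0 k2m _] := hks _ kks; apply/andP; split.
    by apply: le_lt_trans z1; rewrite divr_ge0 ?(ltW (p2 _))// subr_ge0 ler1n.
  by apply: lt_le_trans z2 _; rewrite ler_pdivrMr// mul1r -natrX -natrD ler_nat addn2.
by exists ls; split=> //; rewrite sls size_map.
Qed.

(** Finitely many masses, so the positive ones are bounded below. This only makes the layer sum
    finite: [J] depends on the level, and the bounds built on it are uniform in [J]. *)
Lemma mass_threshold (s : seq nat) m : exists J : nat,
  forall k, k \in s -> cell_mass m k = 0 \/ (2 ^+ J)^-1 < cell_mass m k.
Proof.
elim: s => [|k s [J hJ]]; first by exists 0%N.
have [k0|nk0] := eqVneq (cell_mass m k) 0.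
  by exists J => i; rewrite inE => /predU1P[->|/hJ//]; left.
have kgt0 : 0 < cell_mass m k by rewrite lt0r nk0 cell_mass_ge0.
pose I := Num.bound (cell_mass m k)^-1.
have hI : (2 ^+ I)^-1 < cell_mass m k.
  rewrite -[ltRHS]invrK ltf_pV2 ?posrE ?invr_gt0//.
  apply: lt_trans (archi_boundP _) _; first by rewrite invr_ge0 ltW.
  by rewrite -natrX ltr_nat ltn_expl.
have le_inv a b : (a <= b)%N -> (2 ^+ b)^-1 <= (2 ^+ a)^-1 :> R.
  by move=> ab; rewrite lef_pV2 ?posrE// ler_weXn2l// ler1n.
exists (maxn I J) => i; rewrite inE => /predU1P[->|/hJ[->|lt]]; [right|by left|right].
  exact: le_lt_trans (le_inv _ _ (leq_maxl _ _)) hI.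
exact: le_lt_trans (le_inv _ _ (leq_maxr _ _)) lt.
Qed.

(** At level [n], the cells of mass at least [2^-j] number at most three times the eigenvalues up to
    a multiple of [2^n 2^j]. Weighted by [2^(-q j)] these counts form a geometric series in [j], of
    total order [2^(s n)]. *)
Lemma power_sum_upper (s q x1 : R) : 0 < s -> s < q ->
  (forall x (ls : seq R), x1 <= x -> uniq ls ->
    (forall lam, lam \in ls -> ev lam /\ lam <= x) -> (size ls)%:R <= x `^ s) ->
  exists2 C, 0 < C & exists m1, forall m, (m1 <= m)%N ->
    power_sum m q <= C * (2 `^ s) ^+ m.
Proof.
move=> s0 sq cnt; have q0 := lt_trans s0 sq.
pose r := 2 `^ s / 2 `^ q : R; have /andP[r0 r1] : 0 <= r < 1 by exact: powR2_lt1.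
have r10 : 0 < 1 - r by lra.
have s2 : 1 <= 2 `^ s :> R by rewrite -[leLHS](powRr0 2) ler_powR ?ler1n//; exact: ltW.
pose C := 2 `^ q * (3 * 4 `^ s / (1 - r)).
have C0 : 0 <= C by rewrite /C mulr_ge0 ?powR_ge0// divr_ge0 ?(ltW r10)// mulr_ge0 ?powR_ge0.
exists (2 + C); first by rewrite ltr_pwDl.
exists (Num.bound `|x1|).+1 => -[//|m] hm.
set n := m.+1 in hm *.
have x1n : x1 <= 2 ^+ n.
  apply: le_trans (ler_norm _) (ltW (lt_trans (archi_boundP (normr_ge0 _)) _)).
  by rewrite -natrX ltr_nat; apply: leq_ltn_trans (ltnW hm) _; exact: ltn_expl.
(* The two end cells lack a neighbour in [[0, 1]]. Each contributes at most 1 to the sum, whence the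
   2 in the constant. *)
pose inner := iota 1 (2 ^ n - 2).
have n2 : (2 <= 2 ^ n)%N by rewrite -{1}(expn1 2) leq_exp2l.
have split_iota : iota 0 (2 ^ n) = 0%N :: inner ++ [:: (2 ^ n - 1)%N].
  have -> : (2 ^ n = 1 + (2 ^ n - 2) + 1)%N by lia.
  rewrite -addnA iotaD /= add0n iotaD /= /inner; congr (_ :: iota _ _ ++ [:: _]); lia.
have inner_le : \sum_(k <- inner) cell_mass n k `^ q <= C * (2 `^ s) ^+ n.
  have [J hJ] := mass_threshold inner n.
  apply: le_trans (power_sum_layers q0 hJ) _.
  rewrite /C -mulrA ler_wpM2l ?powR_ge0//.
  apply: (@le_trans _ _ (\sum_(j < J.+1) (3 * 4 `^ s * (2 `^ s) ^+ n) * r ^+ j)); last first.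
    rewrite -mulr_sumr mulrAC -!mulrA ler_wpM2l// ler_wpM2l ?powR_ge0//.
    by rewrite ler_wpM2r ?exprn_ge0 ?powR_ge0// geometric_le.
  apply: ler_sum => j _.
  pose ks := [seq k <- inner | ((2 ^+ j)^-1 <= cell_mass n k)%R].
  (* Mass at least [2^-j] gives [x * cell_mass n k / 2 ^+ n >= 4], above the 3 required by
     [ev_of_cells]. *)
  pose x : R := 4 * 2 ^+ n * 2 ^+ j.
  have x0 : 0 <= x by rewrite !mulr_ge0// ltW.
  have x1x : x1 <= x.
    apply: le_trans x1n _; rewrite /x mulrAC ler_peMl//.
    by rewrite -natrX -natrM ler1n muln_gt0 expn_gt0.
  have [||ls [uls kls hls]] := @ev_of_cells x n ks x0.
  - by rewrite filter_uniq// iota_uniq.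
  - move=> k; rewrite mem_filter mem_iota => /andP[jk /andP[k0 kn]].
    split=> //; first by move: kn n2; move: (2 ^ n)%N => N2; clear; lia.
    have : 1 <= 2 ^+ j * cell_mass n k.
      by rewrite -ler_pdivrMl// mulr1.
    rewrite /x ltr_pdivlMr// => h.
    have -> : 4 * 2 ^+ n * 2 ^+ j * cell_mass n k = 4 * 2 ^+ n * (2 ^+ j * cell_mass n k) by ring.
    have := p2 n; nra.
  have ln : (size ls)%:R <= x `^ s.
    by apply: cnt x1x uls _ => lam /hls[/andP[_ ?] ?].
  have -> : count (fun k => (2 ^+ j)^-1 <= cell_mass n k) inner = size ks.
    by rewrite size_filter.
  have kx : (size ks)%:R <= 3 * x `^ s.
    apply: (@le_trans _ _ ((3 * size ls)%:R)); first by rewrite ler_nat.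
    by rewrite natrM ler_wpM2l.
  apply: (@le_trans _ _ ((2 ^+ j)^-1 `^ q * (3 * x `^ s))).
    by rewrite ler_wpM2l ?powR_ge0.
  rewrite /x !powRM ?mulr_ge0 ?(ltW (p2 _))// !powRXn// powR_inv_ge0// powRXn//.
  by rewrite /r exprMn exprVn le_eqVlt; apply/orP; left; apply/eqP; ring.
have one k : cell_mass n k `^ q <= 1.
  apply: (@le_trans _ _ (1 `^ q)); last by rewrite powR1.
  by rewrite ge0_ler_powR ?nnegrE ?(ltW q0) ?cell_mass_ge0 ?cell_mass_le1.
rewrite /power_sum split_iota big_cons big_cat big_seq1 /=.
rewrite mulrDl addrA addrC addrA -addrC.
have s2n : 1 <= (2 `^ s) ^+ n by exact: exprn_ege1.
have := one 0%N; have := one (2 ^ n - 1)%N; move: inner_le.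
set A := \sum_(_ <- _) _; lra.
Qed.

(** Closed intervals exhaust ]0, 1[, so one of them has positive mass and produces a zero once [x]
    is large. This bounds the logarithm of the count from below. *)
Lemma ev_exists : 0 < fine (eta `]0, 1[%classic) ->
  exists x0, forall x, x0 <= x -> exists2 lam, ev lam & lam <= x.
Proof.
move=> eta_gt0.
pose F n : set R := `[n.+1%:R^-1, 1 - n.+1%:R^-1]%classic.
have mF n : measurable (F n) by exact: measurable_itv.
have [n hn] : exists n, 0 < fine (eta (F n)).
  apply: contrapT => no.
  have eF n : eta (F n) = 0%E.
    have := fine_ge0 (measure_ge0 eta (F n)); rewrite le_eqVlt => /predU1P[e|h].
      by rewrite -(fineK (fin_num_measure eta _ (mF n))) -e.
    by case: no; exists n.
  have : eta (\bigcup_n F n) = 0%E.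
    apply/negligibleP; first exact: bigcup_measurable.
    by apply: negligible_bigcup => n; exists (F n); split; [exact: mF|exact: eF|].
  have -> : \bigcup_n F n = `]0, 1[%classic.
    apply/seteqP; split=> x /=.
      move=> [n _]; rewrite /F /= !in_itv/= => /andP[h1 h2].
      have i0 : 0 < n.+1%:R^-1 :> R by rewrite invr_gt0.
      move: h1 h2 i0; move: (n.+1%:R^-1) => t h1 h2 i0.
      by apply/andP; split; lra.
    rewrite in_itv/= => /andP[x0 x1].
    pose m := Num.min x (1 - x); have m0 : 0 < m by rewrite lt_min x0 subr_gt0.
    exists (Num.bound m^-1) => //; rewrite /F /= in_itv/=.
    have h : (Num.bound m^-1).+1%:R^-1 <= m.
      rewrite -[leRHS]invrK lef_pV2 ?posrE ?invr_gt0//.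
      apply: ltW; apply: lt_trans (archi_boundP _) _; first by rewrite invr_ge0 ltW.
      by rewrite ltr_nat.
    have [m1 m2] : m <= x /\ m <= 1 - x by split; rewrite /m ge_min lexx ?orbT.
    move: h; move: (_.+1%:R^-1) => t h.
    by apply/andP; split; lra.
  by move=> e; move: eta_gt0; rewrite e ltxx.
pose d := n.+1%:R^-1 : R; have d0 : 0 < d by rewrite invr_gt0.
have dd : d <= 1 - d.
  rewrite leNgt; apply/negP => h; move: hn; rewrite /F set_itv_ge ?measure0 ?ltxx//.
  by rewrite bnd_simp -ltNge.
pose K := fine (eta (F n)) * (d ^+ 2 / 1).
have K0 : 0 < K by rewrite mulr_gt0// divr_gt0// exprn_gt0.
exists (K^-1 + 1) => x xK.
have x0 : 0 <= x by apply: le_trans xK; rewrite addr_ge0// invr_ge0 ltW.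
have [h [hz hev]] := ev_lower x0.
have [|||||z z01 hz0] := hz 0 1 d => //; first by rewrite add0r.
  rewrite add0r subr0 -mulrA -/K -ltr_pdivrMr// mul1r.
  by apply: lt_le_trans xK; rewrite ltrDl.
have [||ls [_ sls hls]] := hev [:: z] => //.
  by move=> _ /[!inE]/eqP ->.
case: ls sls hls => // lam ls _ /(_ lam (mem_head _ _))[/andP[_ lx] el].
by exists lam.
Qed.

End counting_asymptotics.

(** * Spectral dimension and critical exponent *)

Section limsup.
Context {R : realType}.
Local Open Scope ereal_scope.

Lemma limf_esup_lt (T : choiceType) (X : filteredType T)
    (f : X -> \bar R) (F : set (set X)) (l : \bar R) :
  limf_esup f F < l -> exists2 V, F V & ereal_sup (f @` V) < l.
Proof. by move=> /ereal_inf_lt[_ [V FV <-] h]; exists V. Qed.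

Lemma limf_esup_le (T : choiceType) (X : filteredType T)
    (f : X -> \bar R) (F : set (set X)) (l : \bar R) V :
  F V -> (forall x, V x -> f x <= l) -> limf_esup f F <= l.
Proof.
move=> FV h; apply: (@le_trans _ _ (ereal_sup (f @` V))).
  by apply: ereal_inf_lbound; exists V.
by apply: ge_ereal_sup => _ [x Vx <-]; exact: h.
Qed.

Lemma limf_esup_lt_EFin (T : choiceType) (X : filteredType T)
    (f : X -> \bar R) (F : set (set X)) (q : R) :
  limf_esup f F < q%:E -> exists2 s : R, (s < q)%R &
    exists2 V, F V & forall x, V x -> f x < s%:E.
Proof.
move=> /limf_esup_lt[V FV h].
have [s sq hs] : exists2 s : R, (s < q)%R & ereal_sup (f @` V) < s%:E.
  move: h; case: (ereal_sup _) => [r|//|_].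
    rewrite lte_fin => rq; exists ((r + q) / 2)%R; first lra.
    by rewrite lte_fin; lra.
  by exists (q - 1)%R; [lra|rewrite ltNyr].
exists s => //; exists V => // x Vx; apply: le_lt_trans hs.
by apply: ereal_sup_ubound; exists x.
Qed.

Lemma lne_div_lt (N : \bar R) (s y : R) : (0 < y)%R -> 0 <= N ->
  lne N / y%:E < s%:E -> N < (expR (s * y))%:E.
Proof.
move=> y0; rewrite inver gt_eqF// lte_pdivrMr// -EFinM.
case: N => [n| |]//; rewrite ?lee_fin => n0.
  move: n0; rewrite le_eqVlt => /predU1P[<-|n0]; first by rewrite lte_fin expR_gt0.
  by rewrite lne_EFin// !lte_fin -[X in _ -> (X < _)%R](@lnK _ n) ?posrE// ltr_expR.
Qed.

Lemma lne_div_le (n s y : R) : (0 < y)%R -> (n <= expR (s * y))%R ->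
  lne n%:E / y%:E <= s%:E.
Proof.
move=> y0 h; rewrite inver gt_eqF// lee_pdivrMr// -EFinM.
have [n0|n0] := ltP 0%R n; last by rewrite le0_lneNy ?leNye// lee_fin.
by rewrite lne_EFin// lee_fin -ler_expR lnK ?posrE.
Qed.

End limsup.

(** * The L^q spectrum as the growth rate of finite sums *)

Section Lq_spectrum_power_sum.
Context {R : realType} (eta : probability R R).
Hypothesis eta_le0 : eta `]-oo, 0]%classic = 0%E.
Hypothesis eta_ge1 : eta `[1, +oo[%classic = 0%E.

Lemma null_subset (A B : set R) : measurable A -> measurable B -> A `<=` B ->
  eta B = 0%E -> eta A = 0%E.
Proof.
move=> mA mB AB B0; apply/eqP; rewrite eq_le measure_ge0 andbT -B0.
by apply: le_measure; rewrite ?inE.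
Qed.

(** Only the indices from 0 to [2 ^ m - 1] contribute. The cell of index -1 ends at 0 and is null
    only because [eta] has no atom there. *)
Lemma esum_dyadic m (q : R) : 0 < q ->
  (\esum_(k in [set: int])
     eta `](k%:~R / 2 ^+ m)%R, ((k + 1)%:~R / 2 ^+ m)%R]%classic `^ q)%E =
  (power_sum eta m q)%:E.
Proof.
move=> q0; have qn0 : q != 0 by rewrite gt_eqF.
have p2 : 0 < (2 ^+ m : R) by exact: exprn_gt0.
set a := fun k : int => _.
pose r := [seq Posz k | k <- iota 0 (2 ^ m)].
have ur : uniq r by rewrite map_inj_uniq ?iota_uniq// => i j [].
have a0 k : k \notin r -> a k = 0%E.
  move=> kr; rewrite /a; case: k kr => k kr.
    have km : (2 ^ m <= k)%N.
      rewrite leqNgt; apply: contra kr => km; apply/mapP; exists k => //.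
      by rewrite mem_iota.
    rewrite (null_subset _ _ _ eta_ge1) ?poweR0r//; try exact: measurable_itv.
    move=> x /=; rewrite !in_itv/= andbT => /andP[kx _]; apply: le_trans (ltW kx).
    by rewrite ler_pdivlMr// mul1r -natrX -pmulrn ler_nat.
  rewrite (null_subset _ _ _ eta_le0) ?poweR0r//; try exact: measurable_itv.
  move=> x /=; rewrite !in_itv/= => /andP[_ xk]; apply: le_trans xk _.
  rewrite pmulr_lle0 ?invr_gt0//.
rewrite (_ : (\esum_(k in [set: int]) a k)%E = (\esum_(k in [set` r]) a k)%E); last first.
  rewrite [RHS]esum_mkcond; apply: eq_esum => k _.
  by case: ifPn => // /negP kr; rewrite a0//; apply/negP => h; apply: kr; rewrite inE.
have age0 k : (0 <= a k)%E by exact: poweR_ge0.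
rewrite esum_fset//; last exact: (finite_seq r).
rewrite -[LHS](fsbig_seq GRing.add a ur) /r big_map /power_sum -sumEFin.
apply: eq_bigr => k _; rewrite /a /cell_mass /dyadic_cell -poweR_EFin fineK ?fin_num_measure//.
by rewrite (_ : (k%:Z + 1)%R = k.+1 :> int)//; lia.
Qed.

Let ln2 : 0 < ln 2 :> R.
Proof. by rewrite ln_gt0// ltr1n. Qed.

Lemma powR2_expR (s : R) n : (2 `^ s) ^+ n = expR (s * (n%:R * ln 2)).
Proof.
by rewrite /powR pnatr_eq0/= -expRM_natl; congr expR; ring.
Qed.

Lemma Lq_spectrum_lt q : 0 < q -> (Lq_spectrum eta q < q%:E)%E ->
  exists s m0, s < q /\ forall m, (m0 <= m)%N -> power_sum eta m q <= (2 `^ s) ^+ m.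
Proof.
move=> q0 /limf_esup_lt_EFin[s sq [V [N _ NV] hV]].
(* Level 0 is avoided, where the divisor [n * ln 2] vanishes. *)
exists s, N.+1; split=> // -[//|m] Nm.
have := hV m.+1 (NV _ (ltnW Nm)); rewrite esum_dyadic//.
move=> /lne_div_lt; rewrite lee_fin power_sum_ge0 lte_fin mulr_gt0// => /(_ isT isT).
by rewrite powR2_expR => /ltW.
Qed.

Lemma Lq_spectrum_le q s t : 0 < q -> s < t ->
  (exists2 C, 0 < C & exists m1, forall m, (m1 <= m)%N ->
    power_sum eta m q <= C * (2 `^ s) ^+ m) ->
  (Lq_spectrum eta q <= t%:E)%E.
Proof.
move=> q0 st [C C0 [m1 hm]].
(* The gap between [s] and [t] absorbs the constant [C] at large levels. *)
have [m2 hm2] : exists m2, forall m, (m2 <= m)%N -> C <= expR ((t - s) * (m%:R * ln 2)).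
  have d0 : 0 < (t - s) * ln 2 by rewrite mulr_gt0// subr_gt0.
  exists (Num.bound (`|ln C| / ((t - s) * ln 2))) => m hm2.
  rewrite -[leLHS]lnK ?posrE// ler_expR (le_trans (ler_norm _))//.
  rewrite mulrCA -ler_pdivrMr//; apply: ltW; apply: lt_le_trans (archi_boundP _) _.
    by rewrite divr_ge0// ltW.
  by rewrite ler_nat.
apply: (@limf_esup_le _ _ _ _ _ _ [set m | (maxn m1 m2 < m)%N]).
  by exists (maxn m1 m2).+1.
move=> [//|m] /= hmm; rewrite esum_dyadic//.
apply: lne_div_le; first by rewrite mulr_gt0.
have [h1 h2] : (m1 <= m.+1)%N /\ (m2 <= m.+1)%N.
  by split; apply: leq_trans (ltnW hmm); rewrite ?leq_maxl ?leq_maxr.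
apply: le_trans (hm _ h1) _; rewrite powR2_expR.
have -> : t * (m.+1%:R * ln 2) = (t - s) * (m.+1%:R * ln 2) + s * (m.+1%:R * ln 2) :> R by ring.
by rewrite expRD ler_wpM2r ?expR_ge0// hm2.
Qed.

Lemma critical_exponent_le (s : R) : 0 <= s ->
  (forall q, s < q -> exists s', s' < q /\ exists2 C, 0 < C &
     exists m1, forall m, (m1 <= m)%N -> power_sum eta m q <= C * (2 `^ s') ^+ m) ->
  (critical_exponent eta <= s%:E)%E.
Proof.
move=> s0 h; apply/lee_addgt0Pr => e e0; rewrite -EFinD.
apply: ereal_inf_lbound; exists (s + e) => //=.
have se : s < s + e by rewrite ltrDl.
have q0 : 0 < s + e by rewrite ltr_wpDl.
split=> //; have [s' [s'q hs']] := h _ se.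
apply: (@le_lt_trans _ _ ((s' + (s + e)) / 2)%:E); last by rewrite lte_fin; lra.
by apply: (Lq_spectrum_le q0 _ hs'); lra.
Qed.

End Lq_spectrum_power_sum.

Section counting_lists.
Context {R : realType} (T : choiceType) (X : set T).

Lemma counting_ge_size (ls : seq T) : uniq ls -> (forall t, t \in ls -> X t) ->
  ((size ls)%:R%:E <= counting X :> \bar R)%E.
Proof.
move=> ul lX; rewrite /counting; case: asboolP => [fX|_]; last exact: leey.
rewrite lee_fin ler_nat; apply: uniq_leq_size => // t /lX Xt.
by rewrite in_fset_set// inE.
Qed.

Lemma counting_le_size (c : R) :
  (forall ls, uniq ls -> (forall t, t \in ls -> X t) -> (size ls)%:R <= c) ->
  exists2 n : R, counting X = n%:E & n <= c.
Proof.
move=> h; have fX : finite_set X.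
  apply: contrapT => /(@infinite_set_fset _ _ (Num.bound `|c|))[B BX cB].
  have : (size (finmap.enum_fset B))%:R <= c by apply: h => [|t]; [exact: finmap.fset_uniq|exact: BX].
  rewrite leNgt => /negP; apply; rewrite (le_lt_trans (ler_norm c))//.
  by rewrite (lt_le_trans (archi_boundP _))// ler_nat.
exists (size (finmap.enum_fset (fset_set X)))%:R; first by rewrite /counting asboolT.
by apply: h => [|t]; [exact: finmap.fset_uniq|rewrite in_fset_set// inE].
Qed.

End counting_lists.

Section spectral_dimension.
Context {R : realType} (eta : probability R R) (ev : R -> Prop).
Hypothesis eta_le0 : eta `]-oo, 0]%classic = 0%E.
Hypothesis eta_ge1 : eta `[1, +oo[%classic = 0%E.
Hypothesis eta_gt0 : 0 < fine (eta `]0, 1[%classic).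

Hypothesis ev_upper : forall x (S ls : seq R), 0 < x -> uniq ls ->
  (forall lam, lam \in ls -> ev lam /\ lam <= x) ->
  (forall p q, 0 <= p -> p < q -> q <= 1 -> (forall s, s \in S -> ~~ (p < s < q)) ->
     (q - p) * fine (eta `]p, q[%classic) <= (2 * x)^-1) ->
  (size ls <= size S + 2)%N.

Hypothesis ev_lower : forall x : R, 0 <= x -> exists h : R -> R,
  (forall u v d, 0 <= u -> v <= 1 -> 0 < d -> u + d <= v - d ->
     1 < x * fine (eta `[u + d, v - d]%classic) * (d ^+ 2 / (v - u)) ->
     exists2 z, u < z < v & h z = 0) /\
  (forall zs, uniq zs -> (forall z, z \in zs -> 0 < z < 1 /\ h z = 0) ->
     exists ls, [/\ uniq ls, size ls = size zs &
       forall lam, lam \in ls -> 0 <= lam <= x /\ ev lam]).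

Let N (x : R) : \bar R := counting [set lam | ev lam /\ lam <= x].
Let usd : \bar R := limf_esup (fun x : R => (lne (N x) / (ln x)%:E)%E) +oo.

Lemma near_pinfty_gt (x1 : R) : (+oo : set_system R) [set x | x1 < x].
Proof. by exists x1; split=> //; rewrite num_real. Qed.

Lemma spectral_dim_le (q : R) : 0 < q -> (Lq_spectrum eta q < q%:E)%E -> (usd <= q%:E)%E.
Proof.
move=> q0 /(Lq_spectrum_lt eta_le0 eta_ge1 q0)[s [m0 [sq hm]]].
have [C C0 hC] := ev_count_upper ev_upper q0 sq hm.
apply/lee_addgt0Pr => e e0; rewrite -EFinD.
pose x1 := Num.max 1 (expR (ln C / e)).
apply: (@limf_esup_le _ _ _ _ _ _ [set x | x1 < x]); first exact: near_pinfty_gt.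
move=> x /=; rewrite /x1 gt_max => /andP[x1x Cx].
have x0 : 0 < x by lra.
have [n Nn nC] := @counting_le_size R _ [set lam | ev lam /\ lam <= x] (C * x `^ q)
  (fun ls ul h => hC x ls (ltW x1x) ul h).
rewrite /N Nn; apply: lne_div_le; first by rewrite ln_gt0.
apply: le_trans nC _; rewrite mulrDl expRD mulrC /powR gt_eqF//.
rewrite ler_wpM2l ?expR_ge0// -[leLHS]lnK ?posrE// ler_expR -ler_pdivrMl//.
by rewrite mulrC -[leLHS]expRK ler_ln ?posrE ?expR_gt0// ltW.
Qed.

(** The critical exponent is an infimum over positive [q], so equality requires ruling out a
    negative or infinitely negative spectral dimension. *)
Lemma spectral_dim_ge0 : (0 <= usd)%E.
Proof.
rewrite leNgt; apply/negP => /limf_esup_lt_EFin[s s0 [V [x1 [_ hV]] hs]].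
have [x2 hx2] := ev_exists ev_lower eta_gt0.
pose x := Num.max 1 (Num.max x1 x2) + 1.
have [x1x x2x xgt1] : [/\ x1 < x, x2 <= x & 1 < x].
  rewrite /x; split.
  - by rewrite ltr_pwDr// !le_max lexx orbT.
  - by rewrite ler_wpDr// !le_max lexx !orbT.
  - by rewrite ltr_pwDr// !le_max lexx.
have [lam el lx] := hx2 x x2x.
have N1 : (1 <= N x)%E.
  by apply: (@counting_ge_size R _ _ [:: lam]) => // t; rewrite inE => /eqP->.
have := hs x (hV _ x1x) => /lne_div_lt; rewrite ln_gt0// (le_trans _ N1)//.
move=> /(_ isT isT); rewrite ltNge => /negP; apply; apply: le_trans N1.
rewrite lee_fin -expR0 ler_expR nmulr_rle0// ltW// ln_gt0//.
Qed.

Lemma spectral_dim_eq : usd = critical_exponent eta.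
Proof.
apply/eqP; rewrite eq_le; apply/andP; split.
  by apply: le_ereal_inf_tmp => _ [q [q0 hq] <-]; exact: spectral_dim_le.
have := spectral_dim_ge0; case E : usd => [r| |]//; last by move=> _; exact: leey.
rewrite lee_fin => r0; apply: (critical_exponent_le eta_le0 eta_ge1 r0) => q rq.
(* A counting exponent strictly between: above [r], so that it bounds the counts eventually, and
   below [q], as [power_sum_upper] demands. *)
pose t := (r + q) / 2; have [rt tq] : r < t /\ t < q by rewrite /t; split; lra.
have t0 : 0 < t := le_lt_trans r0 rt.
exists t; split=> //.
have [s st [V [x1 [_ hV]] hs]] : exists2 s : R, s < t & exists2 V, (+oo : set_system R) V &
    forall x, V x -> (lne (N x) / (ln x)%:E < s%:E)%E.
  by apply: limf_esup_lt_EFin; rewrite -/usd E lte_fin.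
apply: (power_sum_upper ev_lower (x1 := Num.max 1 x1 + 1) t0 tq) => x ls hx ul hl.
have [x1x xgt1] : x1 < x /\ 1 < x.
  by split; apply: lt_le_trans hx; rewrite ltr_pwDr// le_max lexx ?orbT.
have Nls := @counting_ge_size R _ [set lam | ev lam /\ lam <= x] _ ul hl.
have := hs x (hV _ x1x) => /lne_div_lt; rewrite ln_gt0// (le_trans _ Nls) ?lee_fin//.
move=> /(_ isT isT) /(le_lt_trans Nls); rewrite lte_fin => /ltW; move/le_trans; apply.
by rewrite /powR gt_eqF ?(lt_trans _ xgt1)// ler_expR ler_wpM2r ?ln_ge0 ?ltW.
Qed.

End spectral_dimension.

(** * Minkowski dimension *)

Section support.
Context {R : realType} (eta : {measure set R -> \bar R}).

(** Every point outside the support lies in a null interval with rational ends, and there are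
    countably many of these. *)
Lemma supp_negligible : eta.-negligible (~` supp eta).
Proof.
pose F n : set R := if @unpickle (rat * rat)%type n is Some pq
  then (if eta `](ratr pq.1), (ratr pq.2)[%classic == 0%E
        then `](ratr pq.1), (ratr pq.2)[%classic else set0) else set0.
have mF n : measurable (F n).
  by rewrite /F; case: unpickle => [[p q]/=|//]; case: eqP.
have eF n : eta (F n) = 0%E.
  by rewrite /F; case: unpickle => [[p q]/=|//]; case: eqP.
apply: (@negligibleS _ _ _ _ (\bigcup_n F n)); last first.
  apply: negligible_bigcup => n; exists (F n).
  by split; [exact: mF|exact: eF|].
move=> x /existsNP[U /not_implyP[oU /not_implyP[Ux /negP]]].
rewrite -leNgt => etaU.
have [e /= e0 eU] := (nbhs_ballP _ _).1 (oU x Ux).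
have xe : x - e < x by rewrite ltrBlDr ltrDl.
have [p] := rat_in_itvoo xe.
rewrite in_itv/= => /andP[xp px].
have xxe : x < x + e by rewrite ltrDl.
have [q] := rat_in_itvoo xxe.
rewrite in_itv/= => /andP[xq qx].
exists (pickle (p, q)); first exact: I.
rewrite /F pickleK /=.
have pqU : `](ratr p), (ratr q)[ `<=` U.
  move=> y /=; rewrite in_itv/= => /andP[py yq]; apply: eU => /=.
  by rewrite /ball/= ltr_norml; apply/andP; split; lra.
rewrite (_ : eta _ = 0%E) ?eqxx/= ?in_itv/= ?px//.
apply/eqP; rewrite eq_le measure_ge0 andbT (le_trans _ etaU)//.
by apply: le_measure; rewrite ?inE//; exact: open_measurable.
Qed.

Lemma supp_meets (A : set R) : measurable A -> (0 < eta A)%E -> A `&` supp eta !=set0.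
Proof.
move=> mA A0; apply/set0P/negP => /eqP /disjoints_subset AS.
have : eta.-negligible A by apply: negligibleS supp_negligible => x /AS.
by move=> /(negligibleP _ mA) A00; rewrite A00 ltxx in A0.
Qed.

End support.

Section covering.
Context {R : realType}.

Lemma covering_number_lt (A : set R) (e t : R) : (covering_number A e < t%:E)%E ->
  exists n (c : 'I_n -> R), n%:R < t /\ A `<=` \bigcup_i ball (c i) e.
Proof.
move=> /ereal_inf_lt[_ [n [c Ac] <-]]; rewrite lte_fin => nt.
by exists n, c.
Qed.

Lemma covering_number_ge1 (A : set R) e : A !=set0 -> (1 <= covering_number A e)%E.
Proof.
move=> [x Ax]; apply: le_ereal_inf_tmp => _ [n [c Ac] <-].
by rewrite lee_fin ler1n lt0n; apply/eqP => n0; subst n; have [[]] := Ac x Ax.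
Qed.

Lemma covering_number_le (A : set R) (n : nat) (e : R) :
  A `<=` `[0, 1] -> 0 < e -> 1 < n%:R * e -> (covering_number A e <= n%:R%:E)%E.
Proof.
move=> A01 e0 ne; apply: ereal_inf_lbound; exists n => //=.
exists (fun i => i%:R * e) => x /A01/=; rewrite in_itv/= => /andP[x0 x1].
have xe0 : 0 <= x / e by rewrite divr_ge0// ltW.
have /andP[] := truncn_itv xe0; set i := Num.truncn _ => ix xi.
have i_n : (i < n)%N.
  rewrite -(ltr_nat R); apply: le_lt_trans ix _.
  by rewrite ltr_pdivrMr// (le_lt_trans x1).
exists (Ordinal i_n) => //; rewrite /ball/= ltr_norml.
move: ix xi; rewrite ler_pdivlMr// ltr_pdivrMr// -natr1 => ix xi.
by apply/andP; split; lra.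
Qed.

Lemma upper_minkowski_dim_ge0 (A : set R) : A !=set0 -> (0 <= upper_minkowski_dim A)%E.
Proof.
move=> A0; rewrite leNgt; apply/negP => /limf_esup_lt_EFin[s s0 [V [r /= r0 rV] hs]].
pose e := Num.min (r / 2) 2^-1.
have e0 : 0 < e by rewrite lt_min divr_gt0//= invr_gt0.
have er : e <= r / 2 by rewrite ge_min lexx.
have e1 : e <= 2^-1 by rewrite ge_min lexx orbT.
have Ve : V e by apply: rV => //=; rewrite sub0r normrN gtr0_norm//; lra.
have N1 := covering_number_ge1 e A0.
have ln_e : 0 < - ln e by rewrite oppr_gt0 ln_lt0// e0/=; lra.
have := hs e Ve => /(lne_div_lt ln_e); rewrite (le_trans _ N1)// => /(_ isT).
rewrite ltNge => /negP; apply; apply: le_trans N1.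
by rewrite lee_fin -expR0 ler_expR nmulr_rle0// ltW.
Qed.

(** Serves to make the dimension a real number. The crude exponent 2 absorbs the rounding of [e^-1]
    to an integer. *)
Lemma upper_minkowski_dim_le2 (A : set R) :
  A `<=` `[0, 1] -> (upper_minkowski_dim A <= 2%:E)%E.
Proof.
move=> A01; apply: (@limf_esup_le R R R _ _ _ [set e : R | 0 < e < 2^-1]).
  exists 2^-1 => /=; first by rewrite invr_gt0.
  move=> e /=; rewrite sub0r normrN => e2 e0; rewrite e0/=.
  by apply: le_lt_trans e2; rewrite ler_norm.
move=> e /= /andP[e0 e2].
pose n := (Num.truncn e^-1).+1.
have nA : (covering_number A e <= n%:R%:E)%E.
  by apply: covering_number_le; rewrite // -ltr_pdivrMr// mul1r truncnS_gt.
have ln_e : 0 < - ln e by rewrite oppr_gt0 ln_lt0// e0/=; lra.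
suff h : n%:R <= expR (2 * - ln e).
  move: nA; case: (covering_number A e) => [c| |]//; rewrite ?lee_fin => cn.
    exact: lne_div_le ln_e (le_trans cn h).
  by rewrite le0_lneNy// inver gt_eqF// mulNyr gtr0_sg ?invr_gt0// mul1e leNye.
have -> : expR (2 * - ln e) = e^-1 ^+ 2 by rewrite expRM_natl expRN lnK ?posrE.
have te : (Num.truncn e^-1)%:R <= e^-1 by rewrite truncn_le invr_ge0 ltW.
rewrite /n -natr1.
have : 2 < e^-1 by rewrite -[ltLHS]invrK ltf_pV2// posrE invr_gt0.
nra.
Qed.

Lemma upper_minkowski_dim_lt (A : set R) (s : R) : (upper_minkowski_dim A < s%:E)%E ->
  exists m0, forall m, (m0 <= m)%N ->
    exists n (c : 'I_n -> R), n%:R < (2 `^ s) ^+ m /\ A `<=` \bigcup_i ball (c i) (2 ^+ m)^-1.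
Proof.
move=> /limf_esup_lt_EFin[t ts [V [r /= r0 rV] ht]].
exists (Num.bound r^-1).+1 => -[//|m]; set k := m.+1 => km.
have p2 : 0 < (2 ^+ k : R) by exact: exprn_gt0.
have kr : (2 ^+ k)^-1 < r.
  rewrite -[ltRHS]invrK ltf_pV2 ?posrE ?invr_gt0//.
  apply: lt_trans (archi_boundP _) _; first by rewrite invr_ge0 ltW.
  by rewrite -natrX ltr_nat (leq_trans km)// ltnW// ltn_expl.
have Ve : V (2 ^+ k)^-1.
  by apply: rV; rewrite /= ?sub0r ?normrN ?gtr0_norm ?invr_gt0.
have lnk : - ln (2 ^+ k)^-1 = k%:R * ln 2 :> R.
  by rewrite lnV ?posrE// opprK lnXn// [RHS]mulr_natl.
have ln_e : 0 < - ln (2 ^+ k)^-1 :> R by rewrite lnk mulr_gt0// ln_gt0// ltr1n.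
have := ht _ Ve => /(lne_div_lt ln_e).
have [->|/set0P A0] := eqVneq A set0.
  move=> _; exists 0%N, (fun=> 0); split; first by rewrite exprn_gt0// powR_gt0.
  by [].
rewrite (le_trans _ (covering_number_ge1 _ A0))// => /(_ isT).
move=> /covering_number_lt[n [c [nt Ac]]]; exists n, c; split=> //.
apply: lt_le_trans nt _; rewrite powR2_expR ler_expR -lnk.
by rewrite ler_wpM2r// ltW.
Qed.
End covering.

Section minkowski.
Context {R : realType} (eta : probability R R).
Hypothesis eta_le0 : eta `]-oo, 0]%classic = 0%E.
Hypothesis eta_ge1 : eta `[1, +oo[%classic = 0%E.

Lemma supp_unit_itv : supp eta `<=` `[0, 1].
Proof.
move=> x sx /=; rewrite in_itv/=; apply/andP; split; rewrite leNgt; apply/negP => xi.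
- have : (0 < eta `]-oo, 0%R[%classic)%E by apply: sx; rewrite //= in_itv.
  rewrite (null_subset _ _ _ eta_le0) ?ltxx// => y /=.
  by rewrite !in_itv/=; exact: ltW.
- have : (0 < eta `]1%R, +oo[%classic)%E by apply: sx; rewrite //= in_itv/= xi.
  rewrite (null_subset _ _ _ eta_ge1) ?ltxx// => y /=.
  by rewrite !in_itv/= !andbT; exact: ltW.
Qed.

Lemma supp_neq0 : supp eta !=set0.
Proof.
have [|x [_ sx]] := @supp_meets R eta setT measurableT; last by exists x.
by rewrite [X in (0 < X)%E](probability_setT eta).
Qed.

Let p2 m : 0 < (2 ^+ m : R).
Proof. exact: exprn_gt0. Qed.

Lemma sum_cell_mass m : \sum_(k <- iota 0 (2 ^ m)) cell_mass eta m k <= 1.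
Proof.
have h n : \sum_(k <- iota 0 n) cell_mass eta m k <= fine (eta `]0, (n%:R / 2 ^+ m)]%classic).
  elim: n => [|n ih]; first by rewrite big_nil fine_ge0.
  rewrite -addn1 iotaD big_cat/= big_seq1 add0n.
  apply: le_trans (lerD ih (lexx _)) _.
  rewrite /cell_mass /dyadic_cell -fineD ?fin_num_measure//.
  rewrite -measureU//; last first.
    apply/seteqP; split=> // x [] /=; rewrite !in_itv/= => /andP[_ xn] /andP[nx _].
    by move: (lt_le_trans nx xn); rewrite ltxx.
  apply: fine_eta_le => //; first exact: measurableU.
  have nn1 : n%:R / 2 ^+ m <= (n + 1)%:R / 2 ^+ m :> R.
    by rewrite ler_pM2r ?invr_gt0// ler_nat leq_addr.
  move=> x [] /=; rewrite !in_itv/= => /andP[x0 xn]; apply/andP; split=> //.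
  - exact: le_trans xn nn1.
  - by apply: le_lt_trans x0; rewrite divr_ge0// ltW.
  - by rewrite addn1.
by apply: le_trans (h _) _; apply: fine_eta_le1.
Qed.

(* The cells meeting a ball of radius [2^-m] have indices differing by at most 2,
   so the index modulo 3 tells them apart. *)
Lemma count_cells_cover m n (c : 'I_n -> R) :
  supp eta `<=` \bigcup_i ball (c i) (2 ^+ m)^-1 ->
  (count (fun k => 0 < cell_mass eta m k)%R (iota 0 (2 ^ m)) <= n * 3)%N.
Proof.
move=> cov; pose P k := 0 < cell_mass eta m k.
have /choice[f fP] (k : nat) : exists i : option 'I_n, P k ->
    exists2 j, i = Some j & (k%:R - 1) / 2 ^+ m < c j < (k%:R + 2) / 2 ^+ m.
  have [Pk|] := boolP (P k); last by exists None.
  have [|x [xk sx]] := @supp_meets R eta (dyadic_cell m k) (measurable_itv _).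
    by rewrite lt0e measure_ge0 andbT; apply: contraTneq Pk; rewrite /P /cell_mass => ->; rewrite ltxx.
  have [j _] := cov x sx; rewrite /ball/= ltr_norml => /andP[xj jx].
  exists (Some j) => _; exists j => //.
  move: xk; rewrite /dyadic_cell /= in_itv/= -natr1 => /andP[].
  rewrite ltr_pdivrMr// ler_pdivlMr// => kx xk.
  rewrite ltr_pdivrMr// ltr_pdivlMr//.
  move: xj jx; rewrite -(ltr_pM2r (p2 m)) mulNr mulVf ?gt_eqF// => xj.
  rewrite -(ltr_pM2r (p2 m)) mulVf ?gt_eqF// => jx.
  by apply/andP; split; lra.
pose s := [seq k <- iota 0 (2 ^ m) | P k].
pose g k : option 'I_n * 'I_3 := (f k, inord (k %% 3)).
rewrite -size_filter -/s.
have us : uniq s by rewrite filter_uniq ?iota_uniq.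
have gs : {in s &, injective g}.
  move=> k l; rewrite !mem_filter => /andP[Pk _] /andP[Pl _] [fkl].
  have [i fi /andP[i1 i2]] := fP k Pk.
  have [j fj /andP[j1 j2]] := fP l Pl.
  move: fkl; rewrite fi fj => -[ij]; subst j => /(congr1 val)/=.
  rewrite !inordK ?ltn_mod// => kl3.
  have := lt_trans i1 j2; have := lt_trans j1 i2.
  rewrite !ltr_pM2r ?invr_gt0// => lk kl.
  have : (l < k + 3)%N by rewrite -(ltr_nat R) natrD; lra.
  have : (k < l + 3)%N by rewrite -(ltr_nat R) natrD; lra.
  by move=> {lk kl}; lia.
have sub : {subset map g s <= [seq (Some p.1, p.2) | p <- enum {: 'I_n * 'I_3}]}.
  move=> y /mapP[k]; rewrite mem_filter => /andP[Pk _] ->.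
  have [j fj _] := fP k Pk; apply/mapP; exists (j, inord (k %% 3)); first by rewrite mem_enum.
  by rewrite /g fj.
have ug : uniq (map g s) by rewrite map_inj_in_uniq.
have := uniq_leq_size ug sub.
rewrite size_map => /leq_trans; apply.
by rewrite size_map -cardT card_prod !card_ord.
Qed.

(** Up to the factor 2, the value for [M] equal masses [M^-1]. *)
Lemma power_sum_le_count m q (M : R) : 0 < q -> q <= 1 -> 0 < M ->
  (count (fun k => 0 < cell_mass eta m k) (iota 0 (2 ^ m)))%:R <= M ->
  power_sum eta m q <= 2 * M `^ (1 - q).
Proof.
move=> q0 q1 M0 cM; pose x k := cell_mass eta m k.
have x0 k : 0 <= x k by exact: cell_mass_ge0.
have MV0 : 0 < M^-1 by rewrite invr_gt0.
(* Concavity of the power function, in the form of two regimes cut at 1/M. *)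
have pt k : x k `^ q <= (if 0 < x k then M^-1 `^ q else 0) + M `^ (1 - q) * x k.
  have [xk|xk] := ltP 0 (x k); last first.
    have -> : x k = 0 by apply/eqP; rewrite eq_le xk x0.
    by rewrite powR0 ?gt_eqF// mulr0 addr0.
  have [xM|Mx] := leP (x k) M^-1.
    apply: (@le_trans _ _ (M^-1 `^ q)); last by rewrite lerDl mulr_ge0 ?powR_ge0.
    by rewrite ge0_ler_powR ?nnegrE ?(ltW q0) ?(ltW MV0).
  apply: (@le_trans _ _ (M `^ (1 - q) * x k)); last by rewrite lerDr powR_ge0.
  have -> : x k `^ q = (x k)^-1 `^ (1 - q) * x k.
    rewrite powR_inv_ge0// -[X in _ * X](powRr1 (x0 k)) mulrC -powRN -powRD; last first.
      by rewrite (gt_eqF xk) implybT.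
    by congr (_ `^ _); ring.
  rewrite ler_wpM2r// ge0_ler_powR ?nnegrE ?invr_ge0 ?(ltW M0)//; first lra.
  by rewrite -[leRHS]invrK lef_pV2 ?posrE// ltW.
apply: (@le_trans _ _ (M^-1 `^ q *
    (count (fun k => 0 < x k) (iota 0 (2 ^ m)))%:R + M `^ (1 - q) * \sum_(k <- iota 0 (2 ^ m)) x k)).
  apply: le_trans (ler_sum _ (fun k _ => pt k)) _.
  rewrite big_split/= -mulr_sumr lerD2r -big_mkcond/= big_const_seq -Monoid.iteropE.
  by rewrite mulr_natr; exact: lexx.
have -> : 2 * M `^ (1 - q) = M^-1 `^ q * M + M `^ (1 - q) * 1.
  rewrite powR_inv_ge0// -powRN -[X in _ * X + _](powRr1 (ltW M0)) -powRD; last first.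
    by rewrite (gt_eqF M0) implybT.
  by rewrite (_ : - q + 1 = 1 - q); ring.
by rewrite lerD// ler_wpM2l ?powR_ge0//; exact: sum_cell_mass.
Qed.

(** With about [2^(s m)] charged cells the power sum with exponent [p] grows at rate at most
    [s * (1 - p)], and this is below [p] exactly when [p > s / (1 + s)]. *)
Lemma critical_exponent_le_of_dim (s : R) : 0 < s ->
  (upper_minkowski_dim (supp eta) < s%:E)%E -> (critical_exponent eta <= (s / (1 + s))%:E)%E.
Proof.
move=> s0 /upper_minkowski_dim_lt[m0 hm]; have s1 : 0 < 1 + s by lra.
set t := s / (1 + s); have t0 : 0 < t by rewrite divr_gt0.
have t1 : t < 1 by rewrite ltr_pdivrMr//; lra.
apply: critical_exponent_le => // [|q tq]; first exact: ltW.
(* The concavity bound needs an exponent at most 1; lowering [q] to [p] only increases the sum, as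
   all masses are at most 1. *)
pose p := Num.min q ((t + 1) / 2).
have [tp p1 pq] : [/\ t < p, p < 1 & p <= q].
  by rewrite lt_min gt_min ge_min tq lexx; split=> //; [lra|apply/orP; right; lra].
exists (s * (1 - p)); split.
  apply: lt_le_trans pq; move: tp; rewrite /t ltr_pdivrMr//; lra.
exists (2 * 3 `^ (1 - p)); first by rewrite mulr_gt0// powR_gt0.
exists m0 => m /hm[n [c [nM cov]]].
apply: (@le_trans _ _ (power_sum eta m p)).
  apply: ler_sum => k _; have := cell_mass_ge0 eta m k.
  rewrite le_eqVlt => /predU1P[<-|k0]; first by rewrite !powR0// gt_eqF//; lra.
  by rewrite /powR gt_eqF// ler_expR ler_wnM2r// ln_le0 ?cell_mass_le1.
have P0 : 0 < (2 `^ s : R) by rewrite powR_gt0.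
have -> : 2 * 3 `^ (1 - p) * 2 `^ (s * (1 - p)) ^+ m = 2 * ((3 * (2 `^ s) ^+ m) `^ (1 - p)).
  by rewrite powRM ?exprn_ge0 ?(ltW P0)// powRXn ?(ltW P0)// -powRrM mulrA.
apply: power_sum_le_count; [lra|lra|by rewrite mulr_gt0// exprn_gt0|].
apply: (@le_trans _ _ (n * 3)%:R); first by rewrite ler_nat; exact: count_cells_cover cov.
by rewrite natrM mulrC ler_wpM2l// ltW.
Qed.

Lemma critical_exponent_le_minkowski (d := upper_minkowski_dim (supp eta)) :
  (critical_exponent eta <= d / (1 + d))%E.
Proof.
(* The dimension is a nonnegative real, so the quotient of extended reals is the ordinary one. *)
have := upper_minkowski_dim_ge0 supp_neq0; have := upper_minkowski_dim_le2 supp_unit_itv.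
rewrite -/d; case E : d => [r| |]//; rewrite !lee_fin => _ r0.
have r10 : 0 < 1 + r by lra.
rewrite -EFinD inver (gt_eqF r10).
rewrite -EFinM; apply/lee_addgt0Pr => e e0; rewrite -EFinD.
apply: (@le_trans _ _ ((r + e) / (1 + (r + e)))%:E).
  by apply: critical_exponent_le_of_dim; [lra|rewrite -/d E lte_fin ltrDl].
rewrite lee_fin ler_pdivrMr; last lra.
have r1 : 1 + r != 0 by rewrite gt_eqF//; lra.
have -> : (r / (1 + r) + e) * (1 + (r + e)) = r + e + (r * e / (1 + r) + e * r + e * e).
  by field.
by rewrite lerDl !addr_ge0// ?mulr_ge0 ?invr_ge0//; lra.
Qed.

End minkowski.

(** * From the Laplacian to the string *)

Section distribution_function.
Context {R : realType} (mu nu : probability R R).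
Hypothesis supp_mu : supp mu `<=` `[0, 1]%classic.
Hypothesis atomless_mu : atomless mu.
Hypothesis emb : embedded nu mu.
Local Notation F := (distr_fun mu).

Lemma null_of_supp (rho : probability R R) (A : set R) : measurable A ->
  A `&` supp rho `<=` set0 -> rho A = 0%E.
Proof.
move=> mA AS; apply/eqP; rewrite eq_le measure_ge0 andbT leNgt; apply/negP.
by move=> /(supp_meets mA)[x /AS].
Qed.

Lemma null_setU (rho : probability R R) (A B : set R) :
  measurable A -> measurable B -> rho A = 0%E -> rho B = 0%E -> rho (A `|` B) = 0%E.
Proof.
move=> mA mB A0 B0; apply/eqP; rewrite eq_le measure_ge0 andbT.
by apply: le_trans (measureU2 _ mA mB) _; rewrite [X in (X + _)%E]A0 [X in (_ + X)%E]B0 adde0.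
Qed.

Lemma atomless0 x : mu [set x] = 0%E.
Proof.
by apply/eqP; rewrite eq_le measure_ge0 andbT leNgt; apply/negP/atomless_mu.
Qed.

Lemma distr_fun_itv x y : x <= y -> F y - F x = fine (mu `]x, y]%classic).
Proof.
move=> xy; rewrite /distr_fun.
have -> : (`]-oo, y]%classic : set R) = `]-oo, x]%classic `|` `]x, y]%classic.
  apply/seteqP; split=> z /=; rewrite !in_itv/=.
    by move=> zy; case: (leP z x) => zx; [left|right; rewrite zy].
  by move=> [zx|/andP[]//]; exact: le_trans xy.
rewrite measureU//; last first.
  apply/seteqP; split=> // z [] /=; rewrite !in_itv/= => zx /andP[xz _].
  by move: (le_lt_trans zx xz); rewrite ltxx.
by rewrite fineD ?fin_num_measure// addrC addKr.
Qed.

Lemma distr_fun_nondecreasing x y : x <= y -> F x <= F y.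
Proof. by move=> xy; rewrite -subr_ge0 distr_fun_itv// fine_ge0. Qed.

Lemma distr_fun_ge0 x : 0 <= F x.
Proof. exact: fine_ge0. Qed.

Lemma distr_fun_le1 x : F x <= 1.
Proof. exact: fine_eta_le1. Qed.

Lemma distr_fun_eq0 x : x <= 0 -> F x = 0.
Proof.
move=> x0; rewrite /distr_fun.
have m0 : mu `]-oo, 0[%classic = 0%E.
  apply: null_of_supp => // y [] /=; rewrite in_itv/= => y0 /supp_mu/=.
  by rewrite in_itv/= leNgt y0.
rewrite (null_subset _ _ _ (null_setU _ _ m0 (atomless0 0)))//.
  exact: measurableU.
move=> y /=; rewrite !in_itv/= => yx; have := le_trans yx x0.
by rewrite le_eqVlt => /predU1P[->|]; [right|left].
Qed.

Lemma distr_fun_eq1 x : 1 <= x -> F x = 1.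
Proof.
move=> x1; rewrite /distr_fun.
have m0 : mu `]x, +oo[%classic = 0%E.
  apply: null_of_supp => // y [] /=; rewrite in_itv/= andbT => xy /supp_mu/=.
  by rewrite in_itv/= => /andP[_ y1]; lra.
have := probability_setC mu (measurable_itv `]x, +oo[).
by rewrite setCitvr m0 sube0 => ->.
Qed.

(** Two-sided intervals shrinking to [x] have mass tending to that of the point, which is 0;
    monotonicity of the increments does the rest. *)
Lemma distr_fun_cts : cts F.
Proof.
suff h (x e : R) : 0 < e ->
    exists2 d, 0 < d & forall y, `|x - y| < d -> `|F x - F y| < e.
  move=> x; apply/cvgrPdist_lt => e /(h x)[d d0 hd].
  by exists d => //= y /hd.
move=> e0; pose A n : set R := `](x - n.+1%:R^-1), (x + n.+1%:R^-1)]%classic.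
have n0 n : 0 < n.+1%:R^-1 :> R by rewrite invr_gt0.
have AI : \bigcap_n A n = [set x].
  apply/seteqP; split=> y /=; last first.
    by move=> -> n _; rewrite /A/= in_itv/=; move: (n0 n); move: _^-1 => k k0; apply/andP; split; lra.
  move=> yA; apply/eqP; rewrite -subr_eq0 -normr_le0 leNgt; apply/negP => xy.
  have /(_ I) := yA (Num.truncn `|y - x|^-1).
  have := truncnS_gt `|y - x|^-1; rewrite /A/= in_itv/=.
  set k := _.+1%:R; move=> kx.
  have kv : k^-1 < `|y - x|.
    by rewrite -[ltRHS]invrK ltf_pV2// posrE ?invr_gt0// ltr0n.
  move: kv; move: k^-1 => l; clear.
  by case: (ger0P (y - x)) => ? ? /andP[? ?]; lra.
have mA n : measurable (A n) by exact: measurable_itv.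
have : (mu \o A) n @[n --> \oo] --> mu (\bigcap_n A n).
  apply: nonincreasing_cvg_mu => //.
  - by rewrite (le_lt_trans (probability_le1 _ _))// ltry.
  - exact: bigcapT_measurable.
  move=> n m nm; apply/subsetPset => y /=; rewrite /A/= !in_itv/= => /andP[h1 h2].
  have : m.+1%:R^-1 <= n.+1%:R^-1 :> R by rewrite lef_pV2 ?posrE// ler_nat.
  move: h1 h2; move: _.+1%:R^-1 _.+1%:R^-1 => k l h1 h2 kl.
  by apply/andP; split; lra.
rewrite AI atomless0 => /fine_cvgP[_ /cvgrPdist_lt/(_ _ e0)[n _ /(_ n (leqnn n))]].
rewrite /= sub0r normrN ger0_norm ?fine_ge0// => mun.
exists n.+1%:R^-1 => // y xy; apply: le_lt_trans mun.
move: xy; rewrite ltr_norml => /andP[h1 h2].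
have [xy|yx] := leP x y.
  rewrite distrC ger0_norm ?subr_ge0 ?distr_fun_nondecreasing// distr_fun_itv//.
  apply: fine_eta_le => // z; rewrite /A/= !in_itv/= => /andP[h3 h4].
  by move: h1 h2 (n0 n); move: _^-1 => k h1 h2 k0; apply/andP; split; lra.
rewrite ger0_norm ?subr_ge0 ?distr_fun_nondecreasing ?(ltW yx)// distr_fun_itv ?(ltW yx)//.
apply: fine_eta_le => // z; rewrite /A/= !in_itv/= => /andP[h3 h4].
by move: h1 h2 (n0 n); move: _^-1 => k h1 h2 k0; apply/andP; split; lra.
Qed.

(* An atom of [nu] at [c] would belong to the support of [mu], hence to the boundary
   of the component containing [I]. *)
Lemma embedded_null_gap (I : set R) (c : R) : open I -> connected I -> I !=set0 ->
  closure I c -> mu I = 0%E -> nu (I `|` [set c]) = 0%E.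
Proof.
move=> oI cI [x Ix] Ic I0; have mI := open_measurable oI.
have IS : I `<=` ~` supp mu by move=> y Iy /(_ I oI Iy); rewrite [X in (_ < X)%E]I0 ltxx.
have nI : nu I = 0%E.
  by apply: null_of_supp => // y [Iy /emb.1 sy]; exact: IS sy.
have nc : nu [set c] = 0%E.
  apply/eqP; rewrite eq_le measure_ge0 andbT leNgt; apply/negP => ac.
  have sc : supp mu c.
    apply: emb.1 => U oU Uc; apply: lt_le_trans ac _; apply: le_measure; rewrite ?inE//.
      exact: open_measurable.
    by move=> _ ->.
  apply: (emb.2 x c (IS _ Ix) ac); split.
    apply: closure_subset Ic; exact: connected_component_max.
  by move=> /interior_subset/connected_component_sub.
exact: null_setU.
Qed.

Local Notation eta := (distribution nu F).

(** With [c] the last point where [F] vanishes, [mu] has no mass to the left of [c]. The preimage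
    lies in this gap together with [c], and embeddedness handles the possible atom of [nu] at
    [c]. *)
Lemma distribution_le0 : eta `]-oo, 0]%classic = 0%E.
Proof.
rewrite /distribution/= /pushforward.
pose Z := [set x | F x <= 0]; have cF := distr_fun_cts.
have Z0 : Z 0 by rewrite /Z/= distr_fun_eq0.
have Zb : has_ubound Z.
  exists 1 => x Zx; rewrite leNgt; apply/negP => x1.
  by move: Zx; rewrite /Z/= distr_fun_eq1 ?(ltW x1)// ler10.
have Zs : has_sup Z by split=> //; exists 0.
set c := sup Z.
have Fc : F c = 0.
  apply/eqP; rewrite eq_le distr_fun_ge0 andbT.
  have cZ : closed Z.
    rewrite (_ : Z = F @^-1` [set t | t <= 0])//.
    by apply: closed_comp => [x _|]; [exact: cF|exact: closed_le].
  by apply: (cZ : closure Z `<=` Z); apply: closure_sup => //; exists 0.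
have mu0 : mu `]-oo, c[%classic = 0%E.
  have := @le_measure _ _ _ mu `]-oo, c[%classic `]-oo, c]%classic.
  rewrite !inE => /(_ (measurable_itv _) (measurable_itv _)) h.
  apply/eqP; rewrite eq_le measure_ge0 andbT.
  apply: le_trans (h _) _; first by move=> y /=; rewrite !in_itv/=; exact: ltW.
  by rewrite -(fineK (fin_num_measure mu _ (measurable_itv _))) -/(F c) Fc.
have h : nu (`]-oo, c[%classic `|` [set c]) = 0%E.
  apply: embedded_null_gap mu0.
  - exact: interval_open.
  - by apply/connected_intervalP; exact: interval_is_interval.
  - by exists (c - 1); rewrite /= in_itv/=; lra.
  - move=> U [e /= e0 eU]; exists (c - e / 2).
    rewrite /= in_itv/=; split; first lra.
    by apply: eU; rewrite /= ltr_norml; apply/andP; split; lra.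
apply: null_subset h.
- by rewrite -[X in measurable X]setTI; exact: distr_fun_measurable.
- exact: measurableU.
move=> x /=; rewrite !in_itv/= => Fx.
have : x <= c by apply: sup_ubound.
by rewrite le_eqVlt => /predU1P[->|]; [right|left].
Qed.

Lemma distribution_ge1 : eta `[1, +oo[%classic = 0%E.
Proof.
rewrite /distribution/= /pushforward.
pose Z := [set x | 1 <= F x]; have cF := distr_fun_cts.
have Z1 : Z 1 by rewrite /Z/= distr_fun_eq1.
have Zb : has_lbound Z.
  exists 0 => x Zx; rewrite leNgt; apply/negP => x0.
  by move: Zx; rewrite /Z/= distr_fun_eq0 ?(ltW x0)// ler10.
set c := inf Z.
have Fc : F c = 1.
  apply/eqP; rewrite eq_le distr_fun_le1/=.
  have cZ : closed Z.
    rewrite (_ : Z = F @^-1` [set t | 1 <= t])//.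
    by apply: closed_comp => [x _|]; [exact: cF|exact: closed_ge].
  apply: (cZ : closure Z `<=` Z) => U [e /= e0 eU].
  have [|z Zz zc] := @inf_adherent _ Z e e0; first by split=> //; exists 1.
  exists z; split=> //; apply: eU; rewrite /= distrC ger0_norm ?ltrBlDl// subr_ge0.
  exact: inf_lbound.
have mu0 : mu `]c, +oo[%classic = 0%E.
  have := probability_setC mu (measurable_itv `]-oo, c]).
  rewrite setCitvl -[X in (_ - X)%E](fineK (fin_num_measure mu _ (measurable_itv _))).
  by rewrite -/(F c) Fc -EFinD subrr.
have h : nu (`]c, +oo[%classic `|` [set c]) = 0%E.
  apply: embedded_null_gap mu0.
  - exact: interval_open.
  - by apply/connected_intervalP; exact: interval_is_interval.
  - by exists (c + 1); rewrite /= in_itv/= andbT; lra.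
  - move=> U [e /= e0 eU]; exists (c + e / 2).
    rewrite /= in_itv/= andbT; split; first lra.
    by apply: eU; rewrite /= ltr_norml; apply/andP; split; lra.
apply: null_subset h.
- by rewrite -[X in measurable X]setTI; exact: distr_fun_measurable.
- exact: measurableU.
move=> x /=; rewrite !in_itv/= !andbT => Fx.
have : c <= x by apply: inf_lbound.
by rewrite le_eqVlt => /predU1P[->|]; [right|left].
Qed.

Lemma distribution_01 : eta `[0, 1]%classic = 1%E.
Proof.
rewrite /distribution/= /pushforward (_ : _ @^-1` _ = setT); first exact: probability_setT.
apply/seteqP; split=> // x _ /=.
by rewrite in_itv/= distr_fun_ge0 distr_fun_le1.
Qed.

End distribution_function.

Lemma open_unit_itv_gt0 (R : realType) (eta : probability R R) :
  eta `]-oo, 0]%classic = 0%E -> eta `[1, +oo[%classic = 0%E -> 0 < fine (eta `]0, 1[%classic).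
Proof.
move=> e0 e1.
have := probability_setC eta (measurable_itv `]0, 1[).
rewrite (null_subset _ _ _ (null_setU _ _ e0 e1))//; first last.
- by move=> x /= /negP; rewrite !in_itv/= andbT negb_and -!leNgt => /orP[]; [left|right].
- exact: measurableU.
- exact: measurableC.
rewrite -[X in (_ - X)%E](fineK (fin_num_measure eta _ (measurable_itv _))) -EFinD => -[]; lra.
Qed.

Lemma Lfun_bounded_cts (R : realType) (nu : probability R R) (g : R -> R) (M : R) :
  cts g -> (forall x, `|g x| <= M) -> g \in Lfun nu 2%:E.
Proof.
move=> cg gM; have mg := cts_measurable (D := setT) cg.
rewrite inE; apply/andP; split; rewrite inE//= /finite_norm unlock /=.
apply: poweR_lty.
apply: (@le_lt_trans _ _ (\int[nu]_x (M `^ 2)%:E)%E).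
  apply: ge0_le_integral => //.
  - apply/measurable_EFinP.
    have -> : (fun x => `|g x| `^ 2) = (fun x => `|g x| * `|g x|).
      by apply/funext => x; rewrite powR_mulrn// expr2.
    by apply: cts_measurable; apply: ctsM; exact: cts_norm.
  - move=> x _; rewrite lee_fin.
    by rewrite ge0_ler_powR// nnegrE (le_trans _ (gM x)).
by rewrite integral_cst//= probability_setT mule1 ltry.
Qed.

(** * Equivalence of the two eigenvalue problems *)

Section string_laplacian.
Context {R : realType} (mu nu : probability R R).
Hypothesis supp_mu : supp mu `<=` `[0, 1]%classic.
Hypothesis atomless_mu : atomless mu.
Hypothesis emb : embedded nu mu.
Local Notation F := (distr_fun mu).
Local Notation eta := (distribution nu F).
Local Notation I01 := (`[0, 1]%classic : set R).
Local Notation J := (Jint eta I01).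
Local Notation Jn := (Jint nu I01).

Let cF : cts F := distr_fun_cts atomless_mu.

Lemma nuC01 : nu (~` I01) = 0%E.
Proof.
apply: null_of_supp => [|x [nx /emb.1/supp_mu//]].
exact: measurableC.
Qed.

Lemma ae_01 : {ae nu, forall x, I01 x}.
Proof.
exists (~` I01); split; [exact: measurableC|exact: nuC01|].
by move=> x.
Qed.

Lemma ae_eq_Rintegral (f g : R -> R) : measurable_fun setT f -> measurable_fun setT g ->
  {ae nu, forall x, f x = g x} -> \int[nu]_x f x = \int[nu]_x g x.
Proof.
move=> mf mg fg; congr fine; apply: ae_eq_integral => //.
- exact/measurable_EFinP.
- exact/measurable_EFinP.
by apply: filterS fg => x -> _.
Qed.

Lemma Rintegral_01 (f : R -> R) : measurable_fun setT f ->
  \int[nu]_x f x = \int[nu]_(x in I01) f x.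
Proof.
move=> mf; rewrite [RHS]Rintegral_mkcond; apply: ae_eq_Rintegral => //.
  by apply/(measurable_restrictT _ _).1 => //; exact: measurable_funTS.
by apply: filterS ae_01 => x x01; rewrite patchE mem_set.
Qed.

Lemma Jint_distribution k : cts k -> Jn (fun y => k (F y)) = J k.
Proof.
move=> ck; have ckF : cts (fun y => k (F y)).
  by move=> x; apply: continuous_comp; [exact: cF|exact: ck].
have FT : F @^-1` I01 = setT.
  by apply/seteqP; split=> // x _; rewrite /= in_itv/= distr_fun_ge0 distr_fun_le1.
rewrite !JintE -Rintegral_01; last exact: cts_measurable.
congr fine; rewrite [RHS]integral_pushforward ?FT//.
  by apply/measurable_EFinP; exact: cts_measurable.
have [c _ hc] := EVT_max_cts (@ler01 R) (cts_norm ck).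
apply: measurable_bounded_integrable => //.
- by rewrite (le_lt_trans (probability_le1 _ _))// ltry.
- exact: cts_measurable.
exists `|k c|; split; first by rewrite num_real.
move=> M cM x _ /=; apply: le_trans (ltW cM); apply: hc.
by rewrite distr_fun_ge0 distr_fun_le1.
Qed.

(** Since [F] is nondecreasing, [ramp (F x) (F y)] vanishes for [y >= x]; the domain of integration
    becomes fixed and the kernel a function of [F x] and [F y] alone. *)
Lemma Rintegral_ramp x (g G : R -> R) : 0 <= x <= 1 -> measurable_fun setT g -> cts G ->
  {ae nu, forall y, g y = G y} ->
  \int[nu]_(y in `[0, x]) ((F x - F y) * g y) = Jn (fun y => ramp (F x) (F y) * G y).
Proof.
move=> /andP[x0 x1] mg cG gG.
have cr : cts (fun y => ramp (F x) (F y)).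
  by rewrite /ramp; apply: cts_max; [apply: ctsB => //; exact: cts_cst|exact: cts_cst].
rewrite JintE [LHS]Rintegral_mkcond [RHS]Rintegral_mkcond.
apply: ae_eq_Rintegral.
- apply/(measurable_restrictT _ _).1 => //; apply: measurable_funM.
    by apply: cts_measurable; apply: ctsB => //; exact: cts_cst.
  exact: measurable_funTS.
- apply/(measurable_restrictT _ _).1 => //; apply: cts_measurable.
  exact: ctsM.
apply: filterS gG => y gG.
rewrite !patchE !mem_setE !in_itv/= gG.
case: (leP 0 y) => //= y0; case: (leP y x) => [yx|xy].
  rewrite (le_trans yx x1) /ramp max_l// subr_ge0.
  exact: distr_fun_nondecreasing.
case: ifP => // _; rewrite /ramp max_r ?mul0r// subr_le0.
exact: distr_fun_nondecreasing (ltW xy).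
Qed.

Lemma Jint_ramp0 (f : R -> R) : J (fun s => ramp 0 s * f s) = 0.
Proof.
rewrite (@Jint_eq _ _ _ _ (fun=> 0)) ?Jint_cst ?mul0r// => s.
by rewrite /= in_itv/= => /andP[s0 _]; rewrite /ramp sub0r max_r ?mul0r// oppr_le0.
Qed.

Lemma ae_eq0_Jint (f : R -> R) : cts f -> {ae nu, forall x, f (F x) = 0} ->
  J (fun s => f s * f s) = 0.
Proof.
move=> cf f0; rewrite -Jint_distribution; last exact: ctsM.
have cfF : cts (fun y => f (F y)).
  by move=> x; apply: continuous_comp; [exact: cF|exact: cf].
rewrite JintE -Rintegral_01; last by apply: cts_measurable; exact: ctsM.
rewrite (@ae_eq_Rintegral _ (fun=> 0)).
- by rewrite Rintegral_cst// mul0r.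
- by apply: cts_measurable; exact: ctsM.
- by [].
by apply: filterS f0 => x ->; rewrite mul0r.
Qed.

Lemma clamp_lipschitz (x y : R) :
  `|Num.max 0 (Num.min x 1) - Num.max 0 (Num.min y 1)| <= `|x - y|.
Proof.
case: (leP x 1) => x1; case: (leP y 1) => y1.
- by case: (leP 0 x) => x0; case: (leP 0 y) => y0; rewrite ?subrr ?normr0//;
    case: (ger0P (x - y)) => ?; rewrite ler_norml; apply/andP; split; lra.
- by case: (leP 0 x) => x0; case: (leP 0 1) => y0; rewrite ?subrr ?normr0//;
    case: (ger0P (x - y)) => ?; rewrite ler_norml; apply/andP; split; lra.
- by case: (leP 0 1) => x0; case: (leP 0 y) => y0; rewrite ?subrr ?normr0//;
    case: (ger0P (x - y)) => ?; rewrite ler_norml; apply/andP; split; lra.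
- by rewrite subrr normr0.
Qed.

(** Constant extension beyond both ends: the domain constrains [f] on [[0, 1]] only, while [cts]
    concerns R. *)
Lemma cts_clamp (f : R -> R) : {within I01, continuous f} ->
  cts (fun x => f (Num.max 0 (Num.min x 1))).
Proof.
move=> /subspace_continuousP cf x; pose c (y : R) : R := Num.max 0 (Num.min y 1).
have c01 y : I01 (c y).
  by rewrite /= in_itv/= /c le_max lexx ge_max ler01 ge_min lexx orbT.
apply/cvgrPdist_lt => e e0.
have /cvgrPdist_lt/(_ _ e0)[d /= d0 hd] := cf (c x) (c01 x).
exists d => //= y xy; apply: hd; last exact: c01.
by apply: le_lt_trans xy; exact: clamp_lipschitz.
Qed.

Section boundary_conditions.
Variables (alpha beta : R).
Local Notation a := (sin alpha).
Local Notation b := (cos alpha).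
Local Notation cb := (cos beta).
Local Notation sb := (sin beta).
Hypotheses (a0 : 0 <= a) (b0 : 0 <= b) (ab : (a != 0) || (b != 0)).
Hypotheses (cb0 : 0 <= cb) (cb1 : cb <= 1) (sb0 : 0 <= sb).
Hypotheses (csb : 0 < cb + sb) (sb_eq0 : sb = 0 -> cb = 1).

Lemma string_eigenvalue_laplacian lam :
  string_eigenvalue eta a b cb sb lam -> laplacian_eigenvalue nu mu alpha beta lam.
Proof.
move=> [h hE]; have [ch eh bc] := hE.
have J1 : mass J = 1 by apply: J_mass; exact: distribution_01.
have h2 : 0 < J (fun s => h s * h s) by apply: string_eigen_norm_gt0 hE.
have chF : cts (fun y => h (F y)).
  by move=> x; apply: continuous_comp; [exact: cF|exact: ch].
pose g y := - lam * h (F y).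
have cg : cts g by apply: ctsM => //; exact: cts_cst.
exists (fun x => h (F x)), g; split; last 2 first.
- by move=> /ae_eq0_Jint h0; move: h2; rewrite h0// ltxx.
- by apply: aeW => x; rewrite /g mulNr opprK.
have F0 : F 0 = 0 by exact: distr_fun_eq0.
have F1 : F 1 = 1 by exact: distr_fun_eq1.
have Jng : \int[nu]_y g y = - lam * J h.
  rewrite Rintegral_01; last exact: cts_measurable.
  rewrite -JintE -JintZ// -Jint_distribution//; first by apply: ctsM => //; exact: cts_cst.
exists a, b; split.
- split.
  + exact: continuous_subspaceT.
  + have [c _ hc] := EVT_max_cts (@ler01 R) (cts_norm ch).
    apply: (@Lfun_bounded_cts _ _ _ (`|lam| * `|h c|)) => // x.
    rewrite /g normrM normrN ler_wpM2l// hc//.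
    by rewrite distr_fun_ge0 distr_fun_le1.
  + move=> x; rewrite in_itv/= => x01.
    rewrite (@Rintegral_ramp _ _ g)//; [|exact: cts_measurable|by apply: aeW].
    rewrite (@Jint_distribution (fun s => ramp (F x) s * (- lam * h s))); last first.
      by apply: ctsM; [exact: ramp_cts|apply: ctsM => //; exact: cts_cst].
    rewrite eh ?distr_fun_ge0 ?distr_fun_le1// -mulNr -JintZ//; last first.
      by apply: ctsM => //; exact: ramp_cts.
    by congr (_ + _); congr Jint; apply/funext => s; ring.
- by rewrite F0 eh ?lexx ?ler01// Jint_ramp0; ring.
- by rewrite F1 Jng mulNr.
Qed.

(** The defining equation itself furnishes the string solution: replacing [F x] by a free variable
    [t] gives [h], and [f] is [h] composed with [F]. *)
Lemma laplacian_eigenvalue_string lam :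
  laplacian_eigenvalue nu mu alpha beta lam -> string_eigenvalue eta a b cb sb lam.
Proof.
move=> [f [g [[a' [b' [[cf gL fE] bc0 bc1]]] f0 gf]]].
have mg : measurable_fun setT g by have /andP[/set_mem] := gL.
pose f1 x := f (Num.max 0 (Num.min x 1)).
have f1E x : 0 <= x <= 1 -> f1 x = f x.
  by move=> /andP[x0 x1]; rewrite /f1 min_l// max_r.
have cf1 : cts f1 by exact: cts_clamp.
(* A continuous representative of the class of [g], provided by the eigenvalue equation. *)
pose G y := - lam * f1 y.
have cG : cts G by apply: ctsM => //; exact: cts_cst.
have gG : {ae nu, forall y, g y = G y}.
  apply: filterS2 gf ae_01 => y gy; rewrite /= in_itv/= => y01.
  by rewrite /G f1E// mulNr -gy opprK.
have F0 : F 0 = 0 by exact: distr_fun_eq0.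
have F1 : F 1 = 1 by exact: distr_fun_eq1.
have Jp := J_positive nu (lexx (1 : R)).
have Jep := J_positive eta (lexx (1 : R)).
pose h t := a' + b' * t + Jn (fun y => ramp t (F y) * G y).
have crF t : cts (fun y => ramp t (F y)).
  by rewrite /ramp; apply: cts_max; [apply: ctsB => //; exact: cts_cst|exact: cts_cst].
have ch : cts h.
  apply: ctsD; first by apply: ctsD; [exact: cts_cst|apply: ctsM; [exact: cts_cst|exact: cts_id]].
  have [k k0 hk] := @bounded_cts _ 1 G ler01 cG.
  apply: (@lipschitz_cts _ _ (k * mass Jn)) => x y.
  rewrite -(pfB Jp); [|exact: ctsM..].
  rewrite mulrAC; apply: (pf_le_mass Jp) => [|s s01].
    by apply: ctsB; exact: ctsM.
  rewrite -mulrBl normrM mulrC ler_pM// ?hk//.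
  exact: ramp_lipschitz.
have fh x : 0 <= x <= 1 -> f x = h (F x).
  by move=> x01; rewrite fE ?in_itv// (Rintegral_ramp x01 mg cG gG).
have chF : cts (fun y => h (F y)).
  by move=> x; apply: continuous_comp; [exact: cF|exact: ch].
have GE y : I01 y -> G y = - lam * h (F y).
  by rewrite /= in_itv/= => y01; rewrite /G f1E// fh.
have hE t : h t = a' + b' * t - lam * J (fun s => ramp t s * h s).
  rewrite /h; congr (_ + _).
  rewrite (@Jint_eq _ _ _ _ (fun y => - lam * (ramp t (F y) * h (F y)))); last first.
    by move=> y /GE ->; ring.
  rewrite JintZ//; last exact: ctsM.
  rewrite mulNr (@Jint_distribution (fun s => ramp t s * h s))//.
  by apply: ctsM => //; exact: ramp_cts.
have a'E : a' = f 0.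
  by rewrite fh ?lexx ?ler01// F0 hE Jint_ramp0; ring.
(* The condition at 0 says that [(a', b')] is parallel to the unit vector [(sin alpha, cos alpha)];
   [k] is the inner product of the two. *)
pose k := a' * a + b' * b.
have e1 : a' * b - b' * a = 0 by rewrite a'E.
have ak : a' = k * a.
  have -> : k * a = a' - b * (a' * b - b' * a) + a' * (a ^+ 2 + b ^+ 2 - 1).
    by rewrite /k; ring.
  by rewrite e1 sin2cos2; ring.
have bk : b' = k * b.
  have -> : k * b = b' + a * (a' * b - b' * a) + b' * (a ^+ 2 + b ^+ 2 - 1).
    by rewrite /k; ring.
  by rewrite e1 sin2cos2; ring.
(* With zero initial data [gronwall0] makes [h], hence [f], vanish. The norm of [lam] is used since
   its sign is not known here. *)
have k0 : k != 0.
  apply/eqP => k0; apply: f0; apply: filterS ae_01 => x; rewrite /= in_itv/= => x01.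
  rewrite fh//.
  pose L u := `|lam| * J u.
  have Lp : positive_functional 1 L.
    split=> [u v cu cv|r u cu|u cu u0]; rewrite /L.
    - by rewrite (pfD Jep)// mulrDr.
    - by rewrite (pfZ Jep)// mulrCA.
    - by rewrite mulr_ge0// (pf_ge0 Jep).
  apply: (gronwall0 Lp ler01 ch); last by rewrite distr_fun_ge0 distr_fun_le1.
  move=> t t01; rewrite {1}hE ak bk k0 !mul0r !add0r normrN normrM /L ler_wpM2l//.
  have ct : cts (fun s => ramp t s * h s) by apply: ctsM => //; exact: ramp_cts.
  apply: le_trans (pf_norm Jep ct) _; apply: (pf_le Jep).
  - exact: cts_norm.
  - by apply: ctsM; [exact: ramp_cts|exact: cts_norm].
  - by move=> s _; rewrite normrM ger0_norm ?ramp_ge0.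
exists (fun t => k^-1 * h t); split.
- by apply: ctsM => //; exact: cts_cst.
- move=> t _; have -> : (fun s => ramp t s * (k^-1 * h s)) = (fun s => k^-1 * (ramp t s * h s)).
    by apply/funext => s; ring.
  rewrite JintZ//; last by apply: ctsM => //; exact: ramp_cts.
  by rewrite {1}hE ak bk; field.
rewrite JintZ//.
have Jng : \int[nu]_y g y = - lam * J h.
  rewrite (ae_eq_Rintegral mg _ gG); last exact: cts_measurable.
  rewrite Rintegral_01; last exact: cts_measurable.
  rewrite -JintE (Jint_eq nu GE) JintZ//.
  by rewrite Jint_distribution.
have := bc1; rewrite Jng fh ?lexx ?ler01// F1 bk => e.
apply: (mulfI k0); rewrite mulr0 -[RHS]e; field.
exact: k0.
Qed.

End boundary_conditions.
End string_laplacian.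

Theorem theorem15 (R : realType) (mu nu : probability R R) (alpha beta : R)
    (supp_mu : supp mu `<=` `[0, 1]%classic)
    (atomless_mu : atomless mu)
    (embedded_nu_mu : embedded nu mu)
    (alpha_itv : alpha \in `[0, pi / 2])
    (beta_itv : beta \in `[0, pi / 2]) :
  let eta := distribution nu (distr_fun mu) in
  let d := upper_minkowski_dim (supp eta) in
  upper_spectral_dim nu mu alpha beta = critical_exponent eta /\
  (critical_exponent eta <= d / (1 + d))%E.
Proof.
move=> eta d.
have e0 : eta `]-oo, 0]%classic = 0%E by exact: distribution_le0.
have e1 : eta `[1, +oo[%classic = 0%E by exact: distribution_ge1.
have J1 : mass (Jint eta `[0, 1]%classic) = 1 by apply: J_mass; exact: distribution_01.
split; last exact: critical_exponent_le_minkowski.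
have trig (t : R) : t \in `[0, pi / 2] -> [/\ 0 <= sin t, 0 <= cos t, cos t <= 1,
    0 < cos t + sin t & sin t = 0 -> cos t = 1].
  rewrite in_itv/= => /andP[t0 tpi]; have p0 := pi_gt0 R.
  have s0 : 0 <= sin t by apply: sin_ge0_pi; apply/andP; split; lra.
  have c0 : 0 <= cos t by apply: cos_ge0_pihalf; apply/andP; split; lra.
  have := cos2Dsin2 t; move: (cos t) (sin t) c0 s0 => c s c0 s0 cs.
  by split=> // [||s00]; nra.
have [sa ca _ csa sa0] := trig _ alpha_itv.
have [sb cb cb1 csb sb0] := trig _ beta_itv.
have ab : (sin alpha != 0) || (cos alpha != 0).
  by case: eqVneq => // /sa0 ->; rewrite oner_neq0.
pose ev := string_eigenvalue eta (sin alpha) (cos alpha) (cos beta) (sin beta).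
have evE : laplacian_eigenvalue nu mu alpha beta = ev.
  apply/funext => lam; apply/propext; split.
    exact: laplacian_eigenvalue_string.
  exact: string_eigenvalue_laplacian.
rewrite /upper_spectral_dim /eigenvalue_counting evE.
apply: spectral_dim_eq => //.
- exact: open_unit_itv_gt0.
- by move=> x S ls; exact: string_eigenvalues_le_points.
move=> x x0.
have [h [sh hz]] := string_zeros_eigenvalues (distribution nu (distr_fun mu))
  sa ca ab cb cb1 sb csb sb0 x0.
by exists h; split=> [u v d0|//]; exact: string_zero_exists x0 sh.
Qed.
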